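(* Let $\Omega\subset\mathbb C^n$ be a bounded domain, and let $S_1:A^2_{(0,1)}(\Omega)\to L^2(\Omega)$ be the canonical solution operator to $\overline\partial$ restricted to $(0,1)$-forms with coefficients in the Bergman space. Then for every $g=\sum_{j=1}^n g_j\,d\overline z_j\in A^2_{(0,1)}(\Omega)$, $$S_1(g)(z)=\int_\Omega B(z,w)\,\langle g(w),z-w\rangle\,d\lambda(w),$$ where $B$ is the Bergman kernel of $\Omega$ and $$\langle g(w),z-w\rangle=\sum_{j=1}^n g_j(w)\,(\overline z_j-\overline w_j)$$ for $z=(z_1,\dots,z_n)$, $w=(w_1,\dots,w_n)$.
   Context: $\lambda$ is Lebesgue measure on $\mathbb C^n$ and $L^2(\Omega)=L^2(\Omega,\lambda)$. $A^2(\Omega)$ is the Bergman space of holomorphic functions $f:\Omega\to\mathbb C$ with $\int_\Omega|f|^2\,d\lambda<\infty$, a closed subspace of $L^2(\Omega)$. The Bergman kernel $B(z,w)$ is the reproducing kernel of $A^2(\Omega)$: the orthogonal projection $P:L^2(\Omega)\to A^2(\Omega)$ (Bergman projection) is $P(f)(z)=\int_\Omega B(z,w)f(w)\,d\lambda(w)$. $A^2_{(0,1)}(\Omega)$ is the space of $(0,1)$-forms $g=\sum_{j=1}^n g_j\,d\overline z_j$ with all $g_j\in A^2(\Omega)$. The canonical solution operator $S_1:A^2_{(0,1)}(\Omega)\to L^2(\Omega)$ assigns to $g$ the unique $S_1(g)\in L^2(\Omega)$ with $\overline\partial S_1(g)=g$ and $S_1(g)\perp A^2(\Omega)$. *)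

(* Defs.v *)
From HB Require Import structures.
From mathcomp Require Import all_boot all_order all_algebra.
From mathcomp Require Import all_classical all_reals all_analysis.
From mathcomp Require Import complex.
Set Implicit Arguments.
Unset Strict Implicit.
Unset Printing Implicit Defensive.
Import Order.TTheory GRing.Theory Num.Theory.
Import numFieldNormedType.Exports.
Local Open Scope classical_set_scope.
Local Open Scope ring_scope.
Local Open Scope complex_scope.

(* R[i] bundled as a field, so that it and 'rV[C R]_n inherit the topology and
   the norm that the library puts on numeric fields; R[i] itself carries the
   competing structure of an R-module. *)
Definition C (R : realType) : numClosedFieldType := R[i].

(* Stated again because the canonical instance of the library does not apply to
   a product of two arbitrary sigma-finite measures. *)
Lemma product_measure1_sigma_finite d1 d2 (T1 : measurableType d1)
    (T2 : measurableType d2) (R : realType)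
    (m1 : {sigma_finite_measure set T1 -> \bar R})
    (m2 : {sigma_finite_measure set T2 -> \bar R}) :
  sigma_finite setT (product_measure1 m1 m2).
Proof.
have /sigma_finiteP[F [TF ndF Foo]] := sigma_finiteT m1.
have /sigma_finiteP[G [TG ndG Goo]] := sigma_finiteT m2.
exists (fun n => F n `*` G n).
  rewrite -setXTT TF TG predeqE => -[x y]; split.
    move=> [/= [n _ Fnx] [k _ Gky]]; exists (maxn n k) => //; split.
    - by move: x Fnx; exact/subsetPset/ndF/leq_maxl.
    - by move: y Gky; exact/subsetPset/ndG/leq_maxr.
  by move=> [n _ []/= ? ?]; split; exists n.
move=> k; have [? ?] := Foo k; have [? ?] := Goo k.
split; first exact: measurableX.
by rewrite product_measure1E// lte_mul_pinfty// ge0_fin_numE.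
Qed.

Section power_measure.
Context d (T : measurableType d) (R : realType).
Variable m : {sigma_finite_measure set T -> \bar R}.

Section step.
Variables (n : nat) (mn : {sigma_finite_measure set (n.-tuple T) -> \bar R}).

Let cons_pair (p : T * n.-tuple T) : n.+1.-tuple T := [tuple of p.1 :: p.2].

Let measurable_cons_pair : measurable_fun setT cons_pair.
Proof. exact: measurable_cons. Qed.

Definition power_step : set (n.+1.-tuple T) -> \bar R :=
  pushforward (product_measure1 m mn) cons_pair.

Let power_step0 : power_step set0 = 0%E.
Proof. by rewrite /power_step /pushforward preimage_set0 measure0. Qed.

Let power_step_ge0 A : (0 <= power_step A)%E.
Proof. exact: measure_ge0. Qed.

Let power_step_sigma_additive : semi_sigma_additive power_step.
Proof.
exact: (@measure_semi_sigma_additive _ _ _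
  (measure_function_pushforward__canonical__measure_function_Measure
    (product_measure1 m mn) measurable_cons_pair)).
Qed.

HB.instance Definition _ := isMeasure.Build _ _ _ power_step
  power_step0 power_step_ge0 power_step_sigma_additive.

Let power_step_sigma_finite : sigma_finite setT power_step.
Proof.
have [F TF mF] := product_measure1_sigma_finite m mn.
pose g (t : n.+1.-tuple T) := (thead t, [tuple of behead t]).
have mg : measurable_fun setT g.
  by apply: measurable_fun_pair; [exact: measurable_tnth|exact: measurable_behead].
have gK p : g (cons_pair p) = p.
  by case: p => x t; congr pair; apply/val_inj.
exists (fun i => g @^-1` F i).
  by rewrite -preimage_bigcup -TF preimage_setT.
move=> i; have [mFi Fi] := mF i; split.
  by rewrite -[X in measurable X]setTI; exact: mg.
rewrite /power_step /pushforward -comp_preimage.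
by rewrite (_ : g \o cons_pair = id)//; apply/funext.
Qed.

HB.instance Definition _ :=
  Measure_isSigmaFinite.Build _ _ _ power_step power_step_sigma_finite.

End step.

(* The n-fold product measure m x ... x m on n.-tuple T. *)
Fixpoint power_measure (n : nat) :
    {sigma_finite_measure set (n.-tuple T) -> \bar R} :=
  if n is n'.+1 then power_step (power_measure n')
  else \d_([tuple] : 0.-tuple T).

End power_measure.

Definition lebesgue_R2 (R : realType) :
    set (measurableTypeR R * measurableTypeR R) -> \bar R :=
  product_measure1 lebesgue_measure lebesgue_measure.

HB.instance Definition _ (R : realType) := Measure.on (@lebesgue_R2 R).
HB.instance Definition _ (R : realType) :=
  Measure_isSigmaFinite.Build _ _ _ (@lebesgue_R2 R)
    (product_measure1_sigma_finite lebesgue_measure lebesgue_measure).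

Section lebesgue_Cn.
Context {R : realType} {n : nat}.

Definition of_reals (t : n.-tuple (measurableTypeR R * measurableTypeR R)) :
    'rV[C R]_n :=
  \row_j ((tnth t j).1 +i* (tnth t j).2).

Definition to_reals (z : 'rV[C R]_n) :
    n.-tuple (measurableTypeR R * measurableTypeR R) :=
  [tuple (complex.Re (z ord0 j), complex.Im (z ord0 j)) | j < n].

Lemma to_realsK : cancel to_reals of_reals.
Proof.
move=> z; apply/rowP => j; rewrite mxE tnth_mktuple /=.
by case: (z ord0 j).
Qed.

Lemma of_realsK : cancel of_reals to_reals.
Proof.
by move=> t; apply: eq_from_tnth => j; rewrite tnth_mktuple mxE -surjective_pairing.
Qed.

(* The Borel sigma-algebra of C^n, transported from R^(2n). *)
HB.instance Definition _ := Measurable.copy 'rV[C R]_n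
  (g_sigma_algebra_preimageType to_reals).

Lemma measurable_of_reals : measurable_fun setT of_reals.
Proof.
move=> _ _ [A mA <-]; rewrite !setTI -comp_preimage.
by rewrite (_ : to_reals \o of_reals = id)//; apply/funext/of_realsK.
Qed.

Definition lebesgue_Cn : set 'rV[C R]_n -> \bar R :=
  pushforward (power_measure (@lebesgue_R2 R) n) of_reals.

Let lebesgue_Cn0 : lebesgue_Cn set0 = 0%E.
Proof. by rewrite /lebesgue_Cn /pushforward preimage_set0 measure0. Qed.

Let lebesgue_Cn_ge0 A : (0 <= lebesgue_Cn A)%E.
Proof. by rewrite /lebesgue_Cn /pushforward measure_ge0. Qed.

Let lebesgue_Cn_sigma_additive : semi_sigma_additive lebesgue_Cn.
Proof.
exact: (@measure_semi_sigma_additive _ _ _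
  (measure_function_pushforward__canonical__measure_function_Measure
    (power_measure (@lebesgue_R2 R) n) measurable_of_reals)).
Qed.

HB.instance Definition _ := isMeasure.Build _ _ _ lebesgue_Cn
  lebesgue_Cn0 lebesgue_Cn_ge0 lebesgue_Cn_sigma_additive.

End lebesgue_Cn.

Section complex_analysis.
Context {R : realType} {n : nat}.
Local Notation Cn := 'rV[C R]_n.
Local Notation lambda := (@lebesgue_Cn R n).
Implicit Types (Om : set Cn) (f u phi : Cn -> C R) (z w : Cn).

Definition Re_part f z : R := complex.Re (f z).
Definition Im_part f z : R := complex.Im (f z).

Definition Cintegrable Om f :=
  lambda.-integrable Om (EFin \o Re_part f) /\
  lambda.-integrable Om (EFin \o Im_part f).

Definition Cintegral Om f : C R :=
  (\int[lambda]_(z in Om) Re_part f z) +i* (\int[lambda]_(z in Om) Im_part f z).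

Definition is_domain Om := [/\ Om !=set0, open Om & connected Om].

(* Complex differentiability: the scalars of 'rV[C R]_n and of C R are C R. *)
Definition holomorphic Om f := forall z, Om z -> differentiable f z.

Definition finite_L2norm Om f :=
  (\int[lambda]_(z in Om) (Normc.normc (f z) ^+ 2)%:E < +oo)%E.

(* Functions, not classes: equality in L^2 is almost everywhere equality. *)
Definition L2 Om f :=
  [/\ measurable_fun Om (Re_part f), measurable_fun Om (Im_part f) &
      finite_L2norm Om f].

(* Measurability is automatic, f being continuous on the open set Om. *)
Definition A2 Om f := holomorphic Om f /\ finite_L2norm Om f.

Definition A2_01 Om (g : 'I_n -> Cn -> C R) := forall j, A2 Om (g j).

(* B(z, .) is conjugated because the inner product of L^2 is conjugate-linear in
   its second argument: f(z) = <f, k_z> with k_z(w) the conjugate of B(z, w). *)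
Definition bergman_kernel Om (B : Cn -> Cn -> C R) :=
  forall z, Om z ->
    A2 Om (fun w => (B z w)^*) /\
    forall f, A2 Om f -> f z = Cintegral Om (fun w => B z w * f w).

Definition orthogonal_A2 Om u :=
  forall h, A2 Om h -> Cintegral Om (fun z => u z * (h z)^*) = 0.

(* Derivative at z along v for the real structure of C^n. *)
Definition rderivable phi (v z : Cn) :=
  derivable (fun t : R => Re_part phi (z + (t%:C : C R) *: v)) 0 1 /\
  derivable (fun t : R => Im_part phi (z + (t%:C : C R) *: v)) 0 1.

Definition rderive phi (v z : Cn) : C R :=
  derive1 (fun t : R => Re_part phi (z + (t%:C : C R) *: v)) 0 +i*
  derive1 (fun t : R => Im_part phi (z + (t%:C : C R) *: v)) 0.

(* (j, false) stands for the real coordinate x_j, (j, true) for y_j, where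
   z_j = x_j + i y_j. *)
Definition direction (c : 'I_n * bool) : Cn :=
  if c.2 then ('i : C R) *: delta_mx 0 c.1 else delta_mx 0 c.1.

Definition pderive (c : 'I_n * bool) phi z : C R := rderive phi (direction c) z.

(* All iterated real partial derivatives exist and are continuous. *)
Definition smooth phi := forall s : seq ('I_n * bool),
  let psi := foldr pderive phi s in
  continuous psi /\ forall c z, rderivable psi (direction c) z.

Definition test_function Om phi :=
  smooth phi /\
  exists K : set Cn, [/\ compact K, K `<=` Om & forall z, ~ K z -> phi z = 0].

Definition dbar (j : 'I_n) phi z : C R :=
  (pderive (j, false) phi z + 'i * pderive (j, true) phi z) / 2%:R.

(* The equation dbar u = g holds in the sense of distributions on Om. *)
Definition dbar_eq Om u (g : 'I_n -> Cn -> C R) :=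
  forall j phi, test_function Om phi ->
    Cintegral Om (fun z => u z * dbar j phi z) =
    - Cintegral Om (fun z => g j z * phi z).

(* These conditions determine S1 g almost everywhere on Om, since a locally
   integrable u with dbar u = 0 agrees almost everywhere with a holomorphic
   function. *)
Definition canonical_solution_operator Om
    (S1 : ('I_n -> Cn -> C R) -> Cn -> C R) :=
  forall g, A2_01 Om g ->
    [/\ L2 Om (S1 g), dbar_eq Om (S1 g) g & orthogonal_A2 Om (S1 g)].

Definition pairing (g : 'I_n -> Cn -> C R) z w : C R :=
  \sum_j g j w * ((z 0 j)^* - (w 0 j)^*).

End complex_analysis.

(* Main.v *)
Require Import Defs.
From HB Require Import structures.
From mathcomp Require Import all_boot all_order all_algebra.
From mathcomp Require Import all_classical all_reals all_analysis.
From mathcomp Require Import measurable_realfun complex.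
From mathcomp Require Import ring lra.
Import Order.TTheory GRing.Theory Num.Theory.
Import numFieldNormedType.Exports.
Local Open Scope classical_set_scope.
Local Open Scope ring_scope.
Set Implicit Arguments.
Unset Strict Implicit.
Unset Printing Implicit Defensive.

(* Write u = S1 g and v(z) = sum_j conj(z_j) g_j(z). Both have dbar equal to g,
   so h = u - v is weakly dbar-closed and, by Weyl's lemma, agrees almost everywhere
   with some H in A^2. As u is orthogonal to A^2, the Bergman projection of v is -H,
   while that of g_j is g_j; hence the integral of B(z,w) <g(w), z - w> is
   v(z) - (P v)(z) = v(z) + H(z), which is u(z) for almost every z.

   Weyl's lemma is proved by mollification with a^n E(1 - a |z - w|^2), where
   E(x) = exp(-1/x) for x > 0. For a weakly closed h the mollification is holomorphic
   in z and independent of a; letting a tend to infinity shows that it is h times the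
   mollification of 1. That holomorphic functions, which are only assumed to be
   complex differentiable, are weakly closed is a Goursat-type argument on each
   complex line parallel to an axis. *)

(** * The divergence theorem without continuous derivatives *)

Section Bisection.
Context {R : realType}.
Implicit Types W : R -> R -> R.

(** [holomorphic] asserts complex differentiability only, so continuous derivatives, and with them
    Stokes' theorem, are not at hand. The way around: for a test function phi, the field (Re (f
    phi), - Im (f phi)) on a complex line has divergence 2 Re (f dbar phi), because the derivatives
    of f cancel by the Cauchy-Riemann equations. The divergence is thus continuous although the
    partial derivatives of the field need not be, and this is a situation that bisection can handle.
    The kernel depends on w through |z - w|^2 so that both of its relevant derivatives are
    dbar-exact in w. With q = 1 - a |z - w|^2, the derivative of E(q) in conj w_j is a (z_j - w_j)
    E'(q), the negative of that in conj z_j; and the derivative of a^n E(q) in a is - a^(n-1) times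
    the sum over j of the derivatives in conj w_j of conj(z_j - w_j) E(q). The exponent n makes the
    second identity exact: it compensates the volume, of order a^(-n), of a ball of radius a^(-1/2)
    in real dimension 2n. *)

Definition box_increment W (a b l : R) :=
  W (a + l) (b + l) - W a (b + l) - W (a + l) b + W a b.

Lemma box_increment_split W a b l : box_increment W a b l =
  box_increment W a b (l / 2) + box_increment W (a + l / 2) b (l / 2) +
  box_increment W a (b + l / 2) (l / 2) +
  box_increment W (a + l / 2) (b + l / 2) (l / 2).
Proof.
have [h ->] : exists h, l = h + h by exists (l / 2); lra.
have -> : (h + h) / 2 = h by lra.
rewrite /box_increment !addrA; ring.
Qed.

(** Pigeonhole: the four quarters carry the whole increment and each has a quarter of the area, so
    one of them keeps the ratio of increment to area above [e]. *)
Lemma bisect_step W a b l e : 0 < l -> e * l ^+ 2 < `|box_increment W a b l| ->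
  exists p : R * R, [/\ a <= p.1, p.1 + l / 2 <= a + l,
    b <= p.2, p.2 + l / 2 <= b + l &
    e * (l / 2) ^+ 2 < `|box_increment W p.1 p.2 (l / 2)|].
Proof.
move=> l0 H; apply: contrapT => /forallNP K.
have {}K i j : 0 <= i <= l / 2 -> 0 <= j <= l / 2 ->
    `|box_increment W (a + i) (b + j) (l / 2)| <= e * (l / 2) ^+ 2.
  move=> /andP[i0 i1] /andP[j0 j1]; rewrite leNgt; apply/negP => Hij.
  by apply: (K (a + i, b + j)); split => //=; lra.
have h0 : 0 <= (0 : R) <= l / 2 by lra.
have h1 : 0 <= l / 2 <= l / 2 by lra.
move: H; rewrite box_increment_split ltNge => /negP; apply.
have := K _ _ h0 h0; have := K _ _ h0 h1; have := K _ _ h1 h0; have := K _ _ h1 h1.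
rewrite !addr0 !ler_norml => /andP[? ?] /andP[? ?] /andP[? ?] /andP[? ?].
by apply/andP; split; lra.
Qed.

(** A nonzero increment keeps its ratio to the area bounded below along nested squares, and these
    shrink to a point where the hypothesis makes the ratio small. The limit point may lie anywhere
    in the squares, so the hypothesis speaks of all small squares containing [(x, y)]. *)
Lemma box_increment_eq0 W :
  (forall x y e : R, 0 < e -> exists2 d : R, 0 < d &
    forall a b l : R, 0 < l -> l < d -> a <= x <= a + l -> b <= y <= b + l ->
      `|box_increment W a b l| <= e * l ^+ 2) ->
  forall a b l : R, 0 < l -> box_increment W a b l = 0.
Proof.
move=> Wsmall a b l l0; apply/eqP; apply: contrapT => /negP W0.
(* Half of the actual ratio, so that the strict inequality in [ok] holds for the initial square. *)
pose e := `|box_increment W a b l| / (2 * l ^+ 2).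
have l20 : 0 < l ^+ 2 by rewrite exprn_gt0.
have e0 : 0 < e by rewrite divr_gt0 ?normr_gt0 ?mulr_gt0.
pose len n : R := l / 2 ^+ n.
have len0 n : 0 < len n by rewrite divr_gt0 ?exprn_gt0.
have lenS n : len n / 2 = len n.+1 by rewrite /len exprSr invfM mulrA.
pose ok (p : R * R) n := e * (len n) ^+ 2 < `|box_increment W p.1 p.2 (len n)|.
pose next (p : R * R) n (q : R * R) := [/\ p.1 <= q.1, q.1 + len n.+1 <= p.1 + len n,
    p.2 <= q.2, q.2 + len n.+1 <= p.2 + len n & ok q n.+1].
(* The default [(0, 0)] is never taken: [sok] shows that a suitable quarter exists at every
   stage. *)
pose fix s n := if n is m.+1 then xget (0, 0) (next (s m) m) else (a, b).
have sok n : ok (s n) n /\ next (s n) n (s n.+1).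
  have step m : ok (s m) m -> next (s m) m (s m.+1).
    by move=> /(bisect_step (len0 m))[q]; rewrite lenS => Hq; apply: xgetPex; exists q.
  suff h : ok (s n) n by split => //; exact: step.
  elim: n => [|n /step[]//]; rewrite /ok /= /len expr0 divr1 /e.
  have -> : `|box_increment W a b l| / (2 * l ^+ 2) * l ^+ 2 = `|box_increment W a b l| / 2.
    by field; rewrite gt_eqF.
  have : 0 < `|box_increment W a b l| by rewrite normr_gt0.
  lra.
(* Nested intervals for one coordinate [f]; the common point is the supremum of the left
   endpoints. *)
have mono (f : R * R -> R) : (forall n, f (s n) <= f (s n.+1)) ->
    (forall n, f (s n.+1) + len n.+1 <= f (s n) + len n) ->
    exists x, forall n, f (s n) <= x <= f (s n) + len n.
  move=> f1 f2.
  have g1 n k : f (s n) <= f (s (k + n)%N).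
    by elim: k => // k IH; apply: le_trans IH _; rewrite addSn.
  have g2 n k : f (s (k + n)%N) + len (k + n)%N <= f (s n) + len n.
    by elim: k => // k; apply: le_trans; rewrite addSn.
  have g3 n k : f (s k) <= f (s n) + len n.
    apply: le_trans (g2 n k); rewrite addnC; apply: le_trans (g1 k n) _.
    by rewrite lerDl ltW.
  have ub : has_ubound (range (f \o s)).
    by exists (f (s 0%N) + len 0%N) => _ [k _ <-]; exact: g3.
  exists (sup (range (f \o s))) => n; apply/andP; split.
    by apply: ub_le_sup => //; exists n.
  by apply: sup_le_ub => [|_ [k _ <-]]; [exists (f (s 0%N)), 0%N|exact: g3].
have [x xP] := mono fst (fun n => let: conj _ (And5 h _ _ _ _) := sok n in h)
  (fun n => let: conj _ (And5 _ h _ _ _) := sok n in h).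
have [y yP] := mono snd (fun n => let: conj _ (And5 _ _ h _ _) := sok n in h)
  (fun n => let: conj _ (And5 _ _ _ h _) := sok n in h).
have [d d0 Hd] := Wsmall x y e e0.
have [n nd] : exists n, len n < d.
  have : (fun n => l * (1 / 2) ^+ n) @ \oo --> (l * 0 : R).
    by apply: cvgMr; apply: cvg_expr; rewrite ger0_norm; lra.
  rewrite mulr0 => /cvgrPdist_lt /(_ d d0)[n _ /(_ n (leqnn n))].
  rewrite sub0r normrN => h; exists n.
  apply: le_lt_trans h; rewrite /len div1r exprVn; exact: ler_norm.
have := Hd _ _ _ (len0 n) nd (xP n) (yP n).
by rewrite leNgt => /negP; apply; case: (sok n).
Qed.

End Bisection.

Section PlaneDivergence.
Context {R : realType}.
Implicit Types (f : R -> R) (U V g : R -> R -> R).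
Local Notation mu := (@lebesgue_measure R).

Lemma support_integrable f (M : R) (D : set R) : measurable D ->
  continuous f -> (forall x, ~ (`|x| <= M) -> f x = 0) ->
  mu.-integrable D (EFin \o f).
Proof.
move=> mD cf f0; apply: (@integrableS _ _ _ mu setT) => //.
have -> : EFin \o f = (EFin \o f) \_ `[- M, M].
  apply/funext => x; rewrite patchE; case: ifPn => //= /negP xM.
  by rewrite f0// ler_norml => xM'; apply: xM; rewrite inE /= in_itv.
apply/(integrable_mkcond _ _).1 => //.
apply: continuous_compact_integrable; first exact: segment_compact.
exact: continuous_subspaceT.
Qed.

Lemma is_derive_primitive f (M x : R) :
  continuous f -> (forall x, ~ (`|x| <= M) -> f x = 0) ->
  is_derive x (1 : R) (fun x : R => \int[mu]_(t in `]-oo, x]) f t : R) (f x).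
Proof.
move=> cf f0.
have x1 : x < x + 1 by rewrite ltrDl.
have fi := @support_integrable f M `]-oo, (x + 1)] (measurable_itv _) cf f0.
have /(_ _ (cf x))[|dF dE] := continuous_FTC1 x1 fi _; first by rewrite ltNyr.
by rewrite -dE derive1E; exact: derivableP.
Qed.

(** Frechet differentiability in curried form, the error measured in the l1 norm. The flux estimate
    compares values at different points of a small square, for which the existence of partial
    derivatives alone would be too weak. *)
Definition fdiff U (x y a b : R) := forall e : R, 0 < e -> exists2 d : R, 0 < d &
  forall s t : R, `|s| < d -> `|t| < d ->
    `|U (x + s) (y + t) - U x y - a * s - b * t| <= e * (`|s| + `|t|).

Definition cont2 g := forall x y e : R, 0 < e -> exists2 d : R, 0 < d &
  forall s t : R, `|s| < d -> `|t| < d -> `|g (x + s) (y + t) - g x y| <= e.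

Lemma fdiff_cont2 U : (forall x y, exists a b, fdiff U x y a b) -> cont2 U.
Proof.
move=> dU x y e e0; have [a [b /(_ 1 ltr01)[d d0 H]]] := dU x y.
pose B := `|a| + `|b| + 2.
have a0 := normr_ge0 a; have b0 := normr_ge0 b.
have B0 : 0 < B + B by rewrite /B; lra.
exists (Num.min d (e / (B + B))); first by rewrite lt_min d0 divr_gt0.
move=> s t; rewrite !lt_min => /andP[sd se] /andP[td te].
have := H _ _ sd td; rewrite ltr_pdivlMr// in se.
rewrite ltr_pdivlMr// in te.
set w := U _ _ - _ => Hw.
have -> : w = (w - a * s - b * t) + a * s + b * t by ring.
apply: le_trans (ler_normD _ _) _; apply: le_trans (lerD (ler_normD _ _) (lexx _)) _.
rewrite !normrM; have s0 := normr_ge0 s; have t0 := normr_ge0 t.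
move: Hw se te; rewrite /B; nra.
Qed.

Lemma cont2_left g y : cont2 g -> continuous (g^~ y).
Proof.
move=> cg x; apply/cvgrPdist_le => e e0; have [d d0 H] := cg x y e e0.
apply/nbhs_ballP; exists d => //= z; rewrite /ball /= distrC => xz.
have := H (z - x) 0; have -> : x + (z - x) = z by ring.
by rewrite addr0 normr0 [`|g x y - _|]distrC; exact.
Qed.

Lemma cont2_right g x : cont2 g -> continuous (g x).
Proof.
move=> cg; apply: (@cont2_left (fun y x => g x y)) => {}x y e e0.
by have [d d0 H] := cg y x e e0; exists d => // s t sd td; exact: H.
Qed.

Lemma segment_dist (a l x u : R) :
  a <= x -> x <= a + l -> a <= u -> u <= a + l -> `|u - x| <= l.
Proof. by move=> *; rewrite ler_norml; apply/andP; split; lra. Qed.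

(** The linear parts leave exactly [l ^+ 2 * (a + d)]. The 9 counts error units [e / 9 * l ^+ 2]:
    each of the four linearisation errors counts twice, the displacement being at most [l] in both
    coordinates, and the error of [G] counts once. *)
Lemma increment_bound (a b c d e l x y x' y' p q G U0 U1 U2 V0 V1 V2 : R) : 0 < l ->
  `|G - (a + d)| <= e / 9 ->
  `|V2 - V0 - c * (p - x) - d * (y' - y)| <= e / 9 * (l + l) ->
  `|V1 - V0 - c * (p - x) - d * (y' + l - y)| <= e / 9 * (l + l) ->
  `|U2 - U0 - a * (x' - x) - b * (q - y)| <= e / 9 * (l + l) ->
  `|U1 - U0 - a * (x' + l - x) - b * (q - y)| <= e / 9 * (l + l) ->
  `|l * (U1 - U2) + l * (V1 - V2) - l ^+ 2 * G| <= e * l ^+ 2.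
Proof.
move=> l0; rewrite !ler_norml.
move=> /andP[g1 g2] /andP[v1 v2] /andP[v3 v4] /andP[u1 u2] /andP[u3 u4].
have w1 : - (e * l) <= U1 - U2 + (V1 - V2) - l * G by nra.
have w2 : U1 - U2 + (V1 - V2) - l * G <= e * l by nra.
apply/andP; split; nra.
Qed.

(* g is continuous but the partial derivatives of U and V need not be: on each
   small box the integral of g equals the flux of (U, V) up to o(area), and
   bisection, as in Goursat's theorem, turns this into an equality. *)
Lemma divergence_integral_eq0 U V g (M B : R) : 0 <= M ->
  (forall x y, exists a b c d,
     [/\ fdiff U x y a b, fdiff V x y c d & g x y = a + d]) ->
  cont2 g -> (forall x y, `|g x y| <= B) ->
  (forall x y, ~ (`|x| <= M /\ `|y| <= M) -> [/\ U x y = 0, V x y = 0 & g x y = 0]) ->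
  \int[mu]_y (\int[mu]_x g x y) = 0.
Proof.
move=> M0 dUV cg gB supp.
have cU : cont2 U by apply: fdiff_cont2 => x y; have [a [b [c [d []]]]] := dUV x y; exists a, b.
have cV : cont2 V by apply: fdiff_cont2 => x y; have [a [b [c [d []]]]] := dUV x y; exists c, d.
pose P f x := \int[mu]_(t in `]-oo, x]) f t.
have dP1 h y x : cont2 h -> (forall x y, ~ (`|x| <= M /\ `|y| <= M) -> h x y = 0) ->
    is_derive x (1 : R) (P (h^~ y)) (h x y).
  move=> ch h0; apply: (@is_derive_primitive (h^~ y) M); first exact: cont2_left.
  by move=> z zM; apply: h0 => -[].
have dP2 h y x : cont2 h -> (forall x y, ~ (`|x| <= M /\ `|y| <= M) -> h x y = 0) ->
    is_derive y (1 : R) (P (h x)) (h x y).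
  move=> ch h0; apply: (@is_derive_primitive (h x) M); first exact: cont2_right.
  by move=> z zM; apply: h0 => -[].
pose I x s := P (g^~ s) x.
have I0 x s : ~ (`|s| <= M) -> I x s = 0.
  move=> sM; rewrite /I /P.
  under eq_Rintegral do
    rewrite (fun t => let: And3 _ _ h := supp t s (fun k => sM k.2) in h).
  by rewrite Rintegral_cst// mul0r.
have cI x : continuous (I x).
  move=> s; rewrite /I /P.
  apply: (@continuity_under_integral R _ _ mu (fun l t => g t l) `]-oo, x] _ (s - 1) (s + 1) _ _
     (fun t => B * \1_`[- M, M] t)) => //.
  - move=> l _; apply: (@support_integrable (g^~ l) M) => //; first exact: cont2_left.
    by move=> z zM; case: (supp z l) => [[]|].
  - by apply: aeW => t _ l _; exact: cont2_right.
  - apply: (@integrableZl _ _ _ mu `]-oo, x] (measurable_itv _) B (EFin \o \1_`[- M, M])).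
    by apply: integrableS (integrable_indic_itv _ _ _ _).
  - move=> l _; apply: aeW => t _; rewrite indicE.
    have [tM|tM] := boolP (t \in `[- M, M]%classic); first by rewrite mulr1.
    rewrite mulr0; have [|_ _ ->] := supp t l; last by rewrite normr0.
    by case=> tM' _; move/negP: tM; apply; rewrite inE /= in_itv /= -ler_norml.
  - by rewrite inE/= in_itv/= ltrBlDr ltrDl ltr01.
have mvt (f df : R -> R) (a l : R) : 0 < l -> (forall x, is_derive x (1 : R) f (df x)) ->
    exists2 c, a <= c <= a + l & f (a + l) - f a = l * df c.
  move=> l0 fdf.
  have [||c] := @MVT_segment R f df a (a + l).
  - by rewrite lerDl ltW.
  - by apply: derivable_within_continuous => x _; exact: ex_derive.
  by rewrite in_itv /= addrAC subrr add0r mulrC; exists c.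
have U0 x y : ~ (`|x| <= M /\ `|y| <= M) -> U x y = 0 by case/supp.
have V0 x y : ~ (`|x| <= M /\ `|y| <= M) -> V x y = 0 by case/supp.
have g0 x y : ~ (`|x| <= M /\ `|y| <= M) -> g x y = 0 by case/supp.
(* The increment of [W] over a square is the flux of [(U, V)] through its boundary minus the
   integral of [g] over it. *)
pose W x y := P (U x) y + P (V^~ y) x - P (I x) y.
(* The mean value theorem replaces the integrals by values at points of the square, where [fdiff]
   and [cont2] apply directly. *)
have key (a b l : R) : 0 < l -> exists p q r : R,
    [/\ a <= p <= a + l, b <= q <= b + l, a <= r <= a + l &
    box_increment W a b l =
    l * (U (a + l) q - U a q) + l * (V r (b + l) - V r b) - l ^+ 2 * g p q].
  move=> l0.
  have dI x y : is_derive y (1 : R) (P (I x)) (I x y).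
    exact: (is_derive_primitive y (cI x) (I0 x)).
  clear I0 cI; clearbody P.
  have [q qP qE] := mvt (P (U (a + l)) - P (U a) - (P (I (a + l)) - P (I a)))
    (fun y => U (a + l) y - U a y - (I (a + l) y - I a y)) b l l0
    (fun y => is_deriveB (is_deriveB (dP2 _ _ _ cU U0) (dP2 _ _ _ cU U0))
      (is_deriveB (dI _ _) (dI _ _))).
  have [p pP pE] := mvt (P (g^~ q)) (g^~ q) a l l0 (fun x => dP1 _ _ _ cg g0).
  have [r rP rE] := mvt (P (V^~ (b + l)) - P (V^~ b)) (fun x => V x (b + l) - V x b) a l l0
    (fun y => is_deriveB (dP1 _ _ _ cV V0) (dP1 _ _ _ cV V0)).
  exists p, q, r; split=> //.
  rewrite -rE -[l ^+ 2 * _]mulrA -pE -/(I _ _) -/(I _ _).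
  transitivity (l * (U (a + l) q - U a q - (I (a + l) q - I a q)) + l * (V r (b + l) - V r b)).
    rewrite -rE -qE /box_increment /W /= !fctE; ring.
  rewrite rE; ring.
have PT f : (forall x, ~ (`|x| <= M) -> f x = 0) -> P f (M + 1) = \int[mu]_x f x.
  move=> f0; rewrite /P Rintegral_mkcond; congr Rintegral; apply/funext => x.
  rewrite patchE; case: ifPn => //= /negP xM; rewrite f0// ler_norml => /andP[_ xM'].
  by apply: xM; rewrite inE /= in_itv /=; lra.
have P0 f : (forall x, ~ (`|x| <= M) -> f x = 0) -> P f (- (M + 1)) = 0.
  move=> f0; rewrite /P Rintegral_mkcond -[RHS](mul0r (fine (mu setT))) -Rintegral_cst//.
  apply: eq_Rintegral => x _; rewrite patchE; case: ifPn => //=; rewrite inE/= in_itv/= => xM.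
  by rewrite f0// ler_norml => /andP[xM' _]; lra.
have Pz f x : (forall x, f x = 0) -> P f x = 0.
  move=> f0; rewrite /P -[RHS](mul0r (fine (mu `]-oo, x]))) -Rintegral_cst//.
  exact: eq_Rintegral.
have N1 : ~ `|M + 1| <= M by rewrite ger0_norm; lra.
have N2 : ~ `|- (M + 1)| <= M by rewrite normrN.
(* The margin 1 puts the border of the square strictly outside the support, so there is no flux and
   the increment is minus the whole integral of [g]. *)
have : box_increment W (- (M + 1)) (- (M + 1)) (2 * (M + 1)) = 0.
  apply: box_increment_eq0; last by lra.
  move=> x y e e0; have [a [b [c [d [dU dV gad]]]]] := dUV x y.
  have e9 : 0 < e / 9 by rewrite divr_gt0.
  have [d1 d10 H1] := dU _ e9; have [d2 d20 H2] := dV _ e9.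
  have [d3 d30 H3] := cg x y _ e9.
  exists (Num.min d1 (Num.min d2 d3)); first by rewrite !lt_min d10 d20.
  move=> a' b' l l0; rewrite !lt_min => /and3P[l1 l2 l3] /andP[xa xb] /andP[ya yb].
  have [p [q [r [/andP[p1 p2] /andP[q1 q2] /andP[r1 r2] ->]]]] := key a' b' l l0.
  have est F a0 b0 d0 u v : fdiff F x y a0 b0 -> l < d0 -> 
      (forall s t : R, `|s| < d0 -> `|t| < d0 ->
        `|F (x + s) (y + t) - F x y - a0 * s - b0 * t| <= e / 9 * (`|s| + `|t|)) ->
      a' <= u -> u <= a' + l -> b' <= v -> v <= b' + l ->
      `|F u v - F x y - a0 * (u - x) - b0 * (v - y)| <= e / 9 * (l + l).
    move=> _ ld H u1 u2 v1 v2.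
    have hu := segment_dist xa xb u1 u2; have hv := segment_dist ya yb v1 v2.
    have := H (u - x) (v - y) (le_lt_trans hu ld) (le_lt_trans hv ld).
    have -> : x + (u - x) = u by ring.
    have -> : y + (v - y) = v by ring.
    by move=> /le_trans; apply; rewrite ler_pM2l// lerD.
  have aa : a' <= a' + l by lra.
  have bb : b' <= b' + l by lra.
  have := est _ _ _ _ (a' + l) q dU l1 H1 aa (lexx _) q1 q2.
  have := est _ _ _ _ a' q dU l1 H1 (lexx _) aa q1 q2.
  have := est _ _ _ _ r (b' + l) dV l2 H2 r1 r2 bb (lexx _).
  have := est _ _ _ _ r b' dV l2 H2 r1 r2 (lexx _) bb.
  have := H3 (p - x) (q - y) (le_lt_trans (segment_dist xa xb p1 p2) l3)
    (le_lt_trans (segment_dist ya yb q1 q2) l3).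
  have -> : x + (p - x) = p by ring.
  have -> : y + (q - y) = q by ring.
  rewrite gad; exact: increment_bound.
rewrite /box_increment.
have -> : - (M + 1) + 2 * (M + 1) = M + 1 by ring.
rewrite /W.
rewrite !(@Pz (U _)); [|by move=> z; apply: U0 => -[]..].
rewrite !(@Pz (V^~ _)); [|by move=> z; apply: V0 => -[]..].
rewrite (@Pz (I (- (M + 1)))); last by move=> z; apply: P0 => ? ?; apply: g0 => -[].
rewrite (@Pz (I (- (M + 1)))); last by move=> z; apply: P0 => ? ?; apply: g0 => -[].
rewrite (PT (I _)); last by move=> z zM; apply: I0.
rewrite (P0 (I _)); last by move=> z zM; apply: I0.
rewrite !addr0 !subr0 ?sub0r ?addr0 ?oppr0 => /eqP; rewrite oppr_eq0 => /eqP <-.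
by apply: eq_Rintegral => y _; rewrite /I PT// => x xM; apply: g0 => -[].
Qed.
End PlaneDivergence.

(** * Measure and topology of C^n *)

Section BoundedIntegrable.
Context d (T : measurableType d) (R : realType) (mu : {measure set T -> \bar R}).

Lemma bounded_integrable (D : set T) (f : T -> R) (B : R) : measurable D ->
  (mu D < +oo)%E -> measurable_fun D f -> (forall x, D x -> `|f x| <= B) ->
  mu.-integrable D (EFin \o f).
Proof.
move=> mD muD mf fB; apply: measurable_bounded_integrable => //.
by exists B; split; [exact: num_real|move=> M BM x Dx; apply: le_trans (fB _ Dx) (ltW BM)].
Qed.

Lemma bounded_support_integrable (A : set T) (f : T -> R) (B : R) : measurable A ->
  (mu A < +oo)%E -> measurable_fun setT f -> (forall x, `|f x| <= B) ->
  (forall x, ~ A x -> f x = 0) -> mu.-integrable setT (EFin \o f).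
Proof.
move=> mA muA mf fB f0.
have -> : EFin \o f = (EFin \o f) \_ A.
  by apply/funext => x; rewrite patchE; case: ifPn => // /negP; rewrite inE => /f0 /= ->.
apply/(integrable_mkcond _ _).1 => //; apply: bounded_integrable => //.
exact: measurable_funTS.
Qed.

Lemma integrable_bounded_mul (D : set T) (F k : T -> R) (B : R) :
  measurable D -> measurable_fun D F -> (forall w, D w -> `|F w| <= B) ->
  mu.-integrable D (EFin \o k) -> mu.-integrable D (EFin \o (fun w => F w * k w)).
Proof.
move=> mD mF FB ik; have mk := (measurable_EFinP _ _).1 (measurable_int _ ik).
have iBk := integrableZl mD B (integrable_abse ik).
apply: le_integrable iBk => //; first by apply/measurable_EFinP; exact: measurable_funM.
move=> w Dw /=; rewrite lee_fin !normrM normr_id; apply: ler_wpM2r => //.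
by apply: le_trans (FB w Dw) (ler_norm _).
Qed.

End BoundedIntegrable.

(** * Boxes and slices for product measures on tuples *)

Section PowerMeasure.
Context d (T : measurableType d) (R : realType).
Variable m : {sigma_finite_measure set T -> \bar R}.

Definition tuple_box n (Q : set T) : set (n.-tuple T) :=
  [set t | forall j, Q (tnth t j)].

Lemma measurable_tuple_box n Q : measurable Q -> measurable (@tuple_box n Q).
Proof.
move=> mQ; have -> : @tuple_box n Q = \bigcap_(j in setT) ((@tnth n T)^~ j @^-1` Q).
  by apply/seteqP; split => t /= H j => [_|]; exact: H.
apply: fin_bigcap_measurable => // j _; rewrite -[X in measurable X]setTI.
exact: measurable_tnth.
Qed.

Lemma tuple_box_cons n Q x (t : n.-tuple T) :
  tuple_box Q [tuple of x :: t] <-> Q x /\ tuple_box Q t.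
Proof.
split=> [H|[Qx Qt] j].
  split; first by have := H ord0; rewrite tnth0.
  by move=> j; have := H (lift ord0 j); rewrite tnthS.
by case: (unliftP ord0 j) => [k|] ->; rewrite ?tnthS ?tnth0.
Qed.

Lemma power_measure_box n Q : measurable Q ->
  power_measure m n (tuple_box Q) = ((m Q) ^+ n)%E.
Proof.
move=> mQ; elim: n => [|n IH].
  by rewrite /= diracE mem_set//; case.
rewrite expeS -IH -[LHS]/(power_step m (power_measure m n) (tuple_box Q)).
rewrite /power_step /pushforward -product_measure1E//; last exact: measurable_tuple_box.
by congr (_ _); apply/seteqP; split => -[x t] /= /tuple_box_cons.
Qed.

Lemma power_measure_box_lty n Q : measurable Q -> (m Q < +oo)%E ->
  (power_measure m n (tuple_box Q) < +oo)%E.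
Proof.
move=> mQ mQoo; rewrite power_measure_box//.
have /fineK <- : m Q \is a fin_num by rewrite ge0_fin_numE.
by rewrite -EFin_expe ltry.
Qed.

Definition set_tnth n (t : n.-tuple T) (j : 'I_n) (x : T) : n.-tuple T :=
  [tuple if i == j then x else tnth t i | i < n].

Lemma set_tnth_cons0 n y (t : n.-tuple T) x :
  set_tnth [tuple of y :: t] ord0 x = [tuple of x :: t].
Proof.
apply: eq_from_tnth => i; rewrite tnth_mktuple.
by case: (unliftP ord0 i) => [k|] ->; rewrite ?tnthS ?tnth0.
Qed.

Lemma set_tnth_consS n y (t : n.-tuple T) j x :
  set_tnth [tuple of y :: t] (lift ord0 j) x = [tuple of y :: set_tnth t j x].
Proof.
apply: eq_from_tnth => i; rewrite tnth_mktuple.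
by case: (unliftP ord0 i) => [k|] ->; rewrite ?tnthS ?tnth0 ?tnth_mktuple.
Qed.

(** Fubini with coordinate [j] integrated first. The induction peels off the head: if [j] lies in
    the tail the head is integrated last, otherwise first. Boundedness and a support in a box of
    finite measure provide the integrability. *)
Lemma power_measure_slice n (j : 'I_n) (G : n.-tuple T -> R) (Q : set T) (B : R) :
  measurable Q -> (m Q < +oo)%E -> measurable_fun setT G ->
  (forall t, `|G t| <= B) -> (forall t, ~ tuple_box Q t -> G t = 0) ->
  (forall t, \int[m]_x (G (set_tnth t j x))%:E = 0)%E ->
  (\int[power_measure m n]_t (G t)%:E = 0)%E.
Proof.
move=> mQ mQoo; elim: n => [[]//|n IH] in j G *.
move=> mG GB G0 Gj /=.
have mc : measurable_fun setT (fun p : T * n.-tuple T => [tuple of p.1 :: p.2]).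
  exact: measurable_cons.
have iG : (product_measure1 m (power_measure m n)).-integrable setT
    (EFin \o (fun p : T * n.-tuple T => G [tuple of p.1 :: p.2])).
  apply: (@bounded_support_integrable _ _ _ _ (Q `*` tuple_box Q) _ B) => //.
  - by apply: measurableX => //; exact: measurable_tuple_box.
  - have mB := measurable_tuple_box (n := n) mQ.
    rewrite [X in (X < _)%E](_ : _ = m Q * power_measure m n (tuple_box Q))%E.
      by rewrite lte_mul_pinfty// ?power_measure_box_lty// ge0_fin_numE.
    exact: product_measure1E.
  - exact: (measurableT_comp mG mc).
  - by move=> [x t] /= H; apply: G0 => /tuple_box_cons.
rewrite (integral_pushforward mc (D := setT)) //; last exact/measurable_EFinP.
rewrite preimage_setT; have [k jk|j0] := unliftP ord0 j.
  rewrite -(integral12_prod_meas1 iG).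
  rewrite -[RHS](integral0 m setT); apply: eq_integral => x _.
  apply: (IH k (fun t => G [tuple of x :: t])) => //.
  - apply: (measurableT_comp mG); exact: measurable_cons.
  - by move=> t Qt; apply: G0 => /tuple_box_cons[].
  - move=> t; rewrite -[RHS](Gj [tuple of x :: t]) jk.
    by under [RHS]eq_integral do rewrite set_tnth_consS.
rewrite -(integral21_prod_meas1 iG).
rewrite -[RHS](integral0 (power_measure m n) setT); apply: eq_integral => t _.
(* The head [point] is arbitrary, since [set_tnth] overwrites it. *)
rewrite -[RHS](Gj [tuple of point :: t]) j0.
by under [RHS]eq_integral do rewrite set_tnth_cons0.
Qed.

End PowerMeasure.

(** * Euclidean topology and Borel sets of C^n *)

Section ComplexSpace.
Context {R : realType} {n : nat}.
Local Notation Cn := 'rV[C R]_n.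
Implicit Types (z w : Cn) (F G : Cn -> R) (f g : Cn -> C R).
Local Notation re := (@complex.Re R).
Local Notation im := (@complex.Im R).
Local Notation normc := Normc.normc.

(** The squared Euclidean norm, as a real number: the norm of ['rV[C R]_n] is a maximum norm with
    values in [C R], neither smooth nor real-valued. *)
Definition nsq z : R := \sum_j (re (z 0 j) ^+ 2 + im (z 0 j) ^+ 2).

Lemma normCE (x : C R) : `|x| = (normc x)%:C%C.
Proof. by []. Qed.

Lemma normc_sqr (x : C R) : normc x ^+ 2 = re x ^+ 2 + im x ^+ 2.
Proof. by case: x => a b /=; rewrite sqr_sqrtr// addr_ge0// sqr_ge0. Qed.

Lemma normc_ge0 (x : C R) : 0 <= normc x.
Proof. by case: x => a b /=; rewrite sqrtr_ge0. Qed.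

Lemma re_le_normc (x : C R) : `|re x| <= normc x.
Proof.
rewrite -(@ler_pXn2r _ 2)// ?nnegrE ?normc_ge0// normc_sqr real_normK ?num_real//.
by rewrite lerDl sqr_ge0.
Qed.

Lemma im_le_normc (x : C R) : `|im x| <= normc x.
Proof.
rewrite -(@ler_pXn2r _ 2)// ?nnegrE ?normc_ge0// normc_sqr real_normK ?num_real//.
by rewrite lerDr sqr_ge0.
Qed.

Lemma normc_le_re_im (x : C R) : normc x <= `|re x| + `|im x|.
Proof.
rewrite -(@ler_pXn2r _ 2)// ?nnegrE ?normc_ge0// ?addr_ge0// normc_sqr.
rewrite sqrrD !real_normK ?num_real//.
by rewrite -addrA [in leRHS](addrC (_ *+ 2)) addrA lerDl mulrn_wge0// mulr_ge0.
Qed.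

Lemma gt0_C (e : C R) : 0 < e -> exists2 r : R, 0 < r & e = r%:C%C.
Proof.
by case: e => a b; rewrite ltcE /= => /andP[/eqP -> a0]; exists a.
Qed.

Lemma nsq_ge0 z : 0 <= nsq z.
Proof. by apply: sumr_ge0 => j _; rewrite addr_ge0// sqr_ge0. Qed.

Lemma nsqN z : nsq (- z) = nsq z.
Proof. by apply: eq_bigr => j _; rewrite mxE !raddfN /= !sqrrN. Qed.

Lemma nsqC z w : nsq (z - w) = nsq (w - z).
Proof. by rewrite -nsqN opprB. Qed.

Lemma nsq0 : nsq 0 = 0.
Proof. by rewrite /nsq big1// => j _; rewrite mxE /= expr0n addr0. Qed.

Lemma nsq_coord z j : re (z 0 j) ^+ 2 + im (z 0 j) ^+ 2 <= nsq z.
Proof.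
rewrite /nsq (bigD1 j)//= lerDl; apply: sumr_ge0 => k _.
by rewrite addr_ge0// sqr_ge0.
Qed.

Lemma nsqD z w : nsq (z + w) <= 2 * nsq z + 2 * nsq w.
Proof.
rewrite /nsq !mulr_sumr -big_split /=; apply: ler_sum => j _.
rewrite mxE !raddfD /=; move: (re _) (im _) (re _) (im _) => a b c d.
have := sqr_ge0 (a - c); have := sqr_ge0 (b - d); nra.
Qed.

Lemma nbhs_nsqP z (U : set Cn) :
  nbhs z U <-> exists2 r : R, 0 < r & forall w, nsq (w - z) < r -> U w.
Proof.
split=> [/nbhs_ballP[_ /gt0_C[e e0 ->]] H|[r r0 H]].
  exists (e ^+ 2); first by rewrite exprn_gt0.
  move=> w Hw; apply: H; split=> [|i j]; rewrite ?ord1 ?ltcR//.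
  rewrite -ball_normE /= normCE ltcR -(@ltr_pXn2r _ 2)// ?nnegrE ?normc_ge0// ?ltW//.
  apply: le_lt_trans Hw; rewrite normc_sqr nsqC.
  by have := nsq_coord (z - w) j; rewrite !mxE.
(* [e <= 1] gives [e ^ 2 <= e] in each coordinate; [n.+1] instead of [n] makes [n * e < r] strict
   and covers [n = 0]. *)
pose e := Num.min 1 (r / n.+1%:R).
have e0 : 0 < e by rewrite lt_min ltr01 divr_gt0.
apply/nbhs_ballP; exists e%:C%C; first by rewrite /= ltcR.
move=> w [_ Hw]; apply: H.
have : nsq (w - z) <= n%:R * e.
  rewrite -[X in X%:R]card_ord -sum1_card natr_sum mulr_suml; apply: ler_sum => j _.
  have := Hw 0 j; rewrite -ball_normE /= normCE ltcR !mxE mul1r -normc_sqr.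
  rewrite -[normc (z 0 j - w 0 j)]normcN opprB => h.
  have h0 := normc_ge0 (w 0 j - z 0 j).
  have e1 : e <= 1 by rewrite /e ge_min lexx.
  by rewrite expr2; nra.
move=> /le_lt_trans; apply.
have : e <= r / n.+1%:R by rewrite /e ge_min lexx orbT.
rewrite ler_pdivlMr// => h; apply: lt_le_trans h.
by rewrite mulrC ltr_pM2l// ltr_nat.
Qed.

Lemma continuous_nsqP (F : Cn -> R) z : {for z, continuous F} <->
  forall e : R, 0 < e -> exists2 r : R, 0 < r & forall w, nsq (w - z) < r -> `|F w - F z| < e.
Proof.
split=> [/cvgrPdist_lt cF e e0|H].
  have /nbhs_nsqP[r r0 h] := cF e e0; exists r => // w /h; by rewrite distrC.
apply/(@cvgrPdist_lt _ _ _ _ (nbhs_filter z)) => e e0; apply/nbhs_nsqP; have [r r0 h] := H e e0.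
by exists r => // w /h; rewrite distrC.
Qed.

Lemma continuous_re : continuous (re : C R -> R).
Proof.
move=> x; apply/(@cvgrPdist_lt _ _ _ _ (nbhs_filter x)) => e e0.
apply/nbhs_ballP; exists e%:C%C; first by rewrite /= ltcR.
move=> y; rewrite -ball_normE /= normCE ltcR; apply: le_lt_trans.
by rewrite -raddfB; exact: re_le_normc.
Qed.

Lemma continuous_im : continuous (im : C R -> R).
Proof.
move=> x; apply/(@cvgrPdist_lt _ _ _ _ (nbhs_filter x)) => e e0.
apply/nbhs_ballP; exists e%:C%C; first by rewrite /= ltcR.
move=> y; rewrite -ball_normE /= normCE ltcR; apply: le_lt_trans.
by rewrite -raddfB; exact: im_le_normc.
Qed.

Lemma continuous_reim f z : {for z, continuous (Re_part f)} ->
  {for z, continuous (Im_part f)} -> {for z, continuous f}.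
Proof.
move=> /cvgrPdist_lt cr /cvgrPdist_lt ci.
apply/(@cvgrPdist_lt _ _ _ _ (nbhs_filter z)) => _ /gt0_C[e e0 ->].
have e2 : 0 < e / 2 by rewrite divr_gt0.
near=> w; rewrite normCE ltcR; apply: le_lt_trans (normc_le_re_im _) _.
rewrite !raddfB [e]splitr ltrD//; near: w; [exact: cr|exact: ci].
Unshelve. all: by end_near.
Qed.

Lemma continuous_coord j : continuous (fun z => z 0 j).
Proof.
move=> z; apply: continuous_reim; apply/continuous_nsqP => e e0.
  exists (e ^+ 2); first by rewrite exprn_gt0.
  move=> w Hw; rewrite /Re_part -raddfB; apply: le_lt_trans (re_le_normc _) _.
  rewrite -(@ltr_pXn2r _ 2)// ?nnegrE ?normc_ge0// ?ltW//; apply: le_lt_trans Hw.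
  by rewrite normc_sqr; have := nsq_coord (w - z) j; rewrite !mxE.
exists (e ^+ 2); first by rewrite exprn_gt0.
move=> w Hw; rewrite /Im_part -raddfB; apply: le_lt_trans (im_le_normc _) _.
rewrite -(@ltr_pXn2r _ 2)// ?nnegrE ?normc_ge0// ?ltW//; apply: le_lt_trans Hw.
by rewrite normc_sqr; have := nsq_coord (w - z) j; rewrite !mxE.
Qed.

Lemma continuous_nsq : continuous nsq.
Proof.
apply: (@continuous_big R 'I_n +%R 0 xpredT) => [|j _ z /=]; first exact: add_continuous.
have hr : {for z, continuous (fun w : Cn => re (w 0 j))}.
  by apply: continuous_comp; [exact: continuous_coord|exact: continuous_re].
have hi : {for z, continuous (fun w : Cn => im (w 0 j))}.
  by apply: continuous_comp; [exact: continuous_coord|exact: continuous_im].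
have -> : (fun w : Cn => re (w 0 j) ^+ 2 + im (w 0 j) ^+ 2) =
    (fun w => re (w 0 j) * re (w 0 j) + im (w 0 j) * im (w 0 j)).
  by apply/funext => w; rewrite !expr2.
exact: (cvgD (cvgM hr hr) (cvgM hi hi)).
Qed.

Lemma rat_dense (x e : R) : 0 < e -> exists q : rat, (x - ratr q) ^+ 2 < e.
Proof.
move=> e0; pose d := Num.min 1 e; have d0 : 0 < d by rewrite lt_min ltr01.
have xd : x - d < x by rewrite ltrBlDr ltrDl.
have [q] := rat_in_itvoo xd.
rewrite in_itv /= => /andP[q1 q2]; exists q.
have : d <= 1 by rewrite /d ge_min lexx.
have : d <= e by rewrite /d ge_min lexx orbT.
by move=> *; nra.
Qed.

(** Balls with rational centres and squared radii [1 / (k + 1)]. The factor 16 is the room that the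
    mean value argument needs: a point at squared distance less than [4 * s] from the centre still
    has its closed ball of squared radius [s] inside [U]. *)
Lemma open_ball_cover (U : set Cn) : open U -> exists (c : nat -> Cn) (s : nat -> R),
  U = \bigcup_i [set w | nsq (w - c i) < s i] /\
  forall i w, nsq (w - c i) < 16 * s i -> U w.
Proof.
move=> oU; pose T := (n.-tuple (rat * rat) * nat)%type.
pose ctr (q : n.-tuple (rat * rat)) : Cn :=
  \row_j (ratr (tnth q j).1 +i* ratr (tnth q j).2)%C.
pose ok (p : T) := `[< forall w, nsq (w - ctr p.1) < 16 / p.2.+1%:R -> U w >].
pose c i := if unpickle i is Some p then ctr (p : T).1 else 0.
(* Squared radius 0 makes the ball empty, so rejected indices contribute nothing to the union. *)
pose s i : R := if unpickle i is Some p then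
  if ok p then p.2.+1%:R^-1 else 0 else 0.
exists c, s; have cs i w : nsq (w - c i) < 16 * s i -> U w.
  rewrite /c /s; case: (unpickle i) => [p|]; last by rewrite mulr0 ltNge nsq_ge0.
  case: ifPn => [/asboolP|_]; last by rewrite mulr0 ltNge nsq_ge0.
  by apply.
split=> //; apply/seteqP; split=> [z Uz|w [i _] /= H]; last first.
  by apply: (cs i); have := nsq_ge0 (w - c i); lra.
have /nbhs_nsqP[r r0 Hr] : nbhs z U by exact: open_nbhs_nbhs.
(* 34 = 2 * 16 + 2, from [nsqD] applied to a point of the enlarged ball, its centre and [z]. *)
have r34 : 0 < r / 34 by rewrite divr_gt0.
have [k] := ltr_add_invr r34; rewrite add0r => kr.
pose e : R := k.+1%:R^-1 / n.+1%:R / 2.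
have e0 : 0 < e by rewrite !divr_gt0// invr_gt0.
have /choice[q Hq] : forall j, exists q : rat * rat,
    (re (z 0 j) - ratr q.1) ^+ 2 < e /\ (im (z 0 j) - ratr q.2) ^+ 2 < e.
  move=> j; have [q1 H1] := rat_dense (re (z 0 j)) e0.
  by have [q2 H2] := rat_dense (im (z 0 j)) e0; exists (q1, q2).
pose t : n.-tuple (rat * rat) := [tuple q j | j < n].
have zt : nsq (z - ctr t) < k.+1%:R^-1.
  have : nsq (z - ctr t) <= n%:R * (2 * e).
    rewrite -[X in X%:R]card_ord -sum1_card natr_sum mulr_suml; apply: ler_sum => j _.
    rewrite !mxE !raddfB /= tnth_mktuple mul1r; have [h1 h2] := Hq j.
    by rewrite mulr_natl mulr2n lerD// ltW.
  move=> /le_lt_trans; apply.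
  have -> : n%:R * (2 * e) = k.+1%:R^-1 * (n%:R / n.+1%:R) 
    by rewrite /e; move: (k.+1%:R^-1) (n.+1%:R^-1) => a b; field.
  by rewrite gtr_pMr ?invr_gt0// ltr_pdivrMr// mul1r ltr_nat.
have okt : ok (t, k).
  apply/asboolP => w /= H; apply: Hr.
  have -> : w - z = (w - ctr t) + (ctr t - z) by rewrite addrA subrK.
  apply: le_lt_trans (nsqD _ _) _; rewrite [nsq (ctr t - z)]nsqC.
  by move: zt H kr; move: (k.+1%:R^-1) => K *; lra.
by exists (pickle (t, k)) => //=; rewrite /c /s pickleK okt.
Qed.

Lemma measurable_to_reals : measurable_fun setT (@to_reals R n).
Proof. by move=> _ Y mY; rewrite setTI; exists Y => //; rewrite setTI. Qed.

Lemma measurable_re_coord j : measurable_fun setT (fun z : Cn => re (z 0 j)).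
Proof.
have -> : (fun z : Cn => re (z 0 j)) = fst \o (@tnth _ _)^~ j \o @to_reals R n.
  by apply/funext => z /=; rewrite tnth_mktuple.
exact: (measurableT_comp (measurableT_comp measurable_fst (measurable_tnth j)) measurable_to_reals).
Qed.

Lemma measurable_im_coord j : measurable_fun setT (fun z : Cn => im (z 0 j)).
Proof.
have -> : (fun z : Cn => im (z 0 j)) = snd \o (@tnth _ _)^~ j \o @to_reals R n.
  by apply/funext => z /=; rewrite tnth_mktuple.
exact: (measurableT_comp (measurableT_comp measurable_snd (measurable_tnth j)) measurable_to_reals).
Qed.

Lemma measurable_nsqB c : measurable_fun setT (fun z => nsq (z - c)).
Proof.
rewrite /nsq; apply: measurable_sum => j.
under eq_fun do rewrite !mxE !raddfD /=.
apply: measurable_funD; apply: measurable_funX; apply: measurable_funD => //.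
  exact: measurable_re_coord.
exact: measurable_im_coord.
Qed.

Lemma open_measurable_Cn (U : set Cn) : open U -> measurable U.
Proof.
move=> /open_ball_cover[c [s [-> _]]]; apply: bigcup_measurable => i _.
rewrite -[X in measurable X]setTI.
exact: (measurable_nsqB (c i) measurableT (measurable_itv `]-oo, (s i)[)).
Qed.

Lemma continuous_measurable_Cn (D : set Cn) F : open D ->
  (forall z, D z -> {for z, continuous F}) -> measurable_fun D F.
Proof.
move=> oD cF; apply: (measurability _ (RGenOInfty.measurableE R)) => _ [_ [x ->] <-].
apply: open_measurable_Cn; rewrite openE => z [Dz Fz].
rewrite /interior; apply: filterI; first exact: open_nbhs_nbhs.
apply: cF => //; apply: open_nbhs_nbhs; split => //.
Qed.

End ComplexSpace.

(** * Finiteness of Lebesgue measure on boxes, and the divergence theorem on complex lines *)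

Section LebesgueCn.
Context {R : realType} {n : nat}.
Local Notation Cn := 'rV[C R]_n.
Local Notation lambda := (@lebesgue_Cn R n).
Local Notation re := (@complex.Re R).
Local Notation im := (@complex.Im R).
Implicit Types (z w : Cn) (F G : Cn -> R).

Definition Cn_box (M : R) : set Cn :=
  [set z | forall j, `|re (z 0 j)| <= M /\ `|im (z 0 j)| <= M].

Let square (M : R) : set (measurableTypeR R * measurableTypeR R) := `[- M, M] `*` `[- M, M].

Let measurable_square M : measurable (square M).
Proof. by apply: measurableX; exact: measurable_itv. Qed.

Let of_reals_box M : of_reals @^-1` (Cn_box M) = tuple_box (n := n) (square M).
Proof.
apply/seteqP; split=> t H j; have := H j; rewrite /= ?mxE /square /= !in_itv /= -!ler_norml;
  by [].
Qed.

Lemma measurable_Cn_box M : measurable (Cn_box M).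
Proof.
have -> : Cn_box M = to_reals @^-1` (tuple_box (n := n) (square M)).
  by rewrite -of_reals_box -comp_preimage; apply/seteqP; split => z /=; rewrite to_realsK.
rewrite -[X in measurable X]setTI; apply: measurable_to_reals => //.
exact: measurable_tuple_box.
Qed.

Lemma lebesgue_R2_square_lty M : (@lebesgue_R2 R (square M) < +oo)%E.
Proof.
rewrite /lebesgue_R2 [X in (X < _)%E](_ : _ =
  lebesgue_measure [set` `[- M, M]%R] * lebesgue_measure [set` `[- M, M]%R])%E.
  by rewrite lebesgue_measure_itv /=; case: ifP => _; rewrite ?mul0e// -?EFinB -?EFinM ltry.
exact: product_measure1E.
Qed.

Lemma lebesgue_Cn_box M : (lambda (Cn_box M) < +oo)%E.
Proof.
rewrite /lebesgue_Cn /pushforward of_reals_box.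
by apply: power_measure_box_lty => //; exact: lebesgue_R2_square_lty.
Qed.

Lemma lebesgue_Cn_sigma_finite : sigma_finite setT lambda.
Proof.
exists (fun k => Cn_box k%:R).
  apply/esym/seteqP; split => // z _.
  have [k Hk] : exists k : nat, forall j, `|re (z 0 j)| + `|im (z 0 j)| <= k%:R.
    pose S := \sum_i (`|re (z 0 i)| + `|im (z 0 i)|).
    exists (Num.bound S) => j; apply: le_trans (ltW (archi_boundP _)); last first.
      by apply: sumr_ge0 => i _; rewrite addr_ge0.
    by rewrite /S (bigD1 j)//= lerDl; apply: sumr_ge0 => i _; rewrite addr_ge0.
  by exists k => // j; split; apply: le_trans (Hk j); rewrite (lerDl, lerDr).
by move=> k; split; [exact: measurable_Cn_box|exact: lebesgue_Cn_box].
Qed.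

HB.instance Definition _ := Measure_isSigmaFinite.Build _ _ _ lambda lebesgue_Cn_sigma_finite.

Lemma bounded_setE (Om : set Cn) : bounded_set Om -> exists M, 0 <= M /\ Om `<=` Cn_box M.
Proof.
move=> [M0 [M0r H]]; pose K := Num.max 0 (re M0) + 1.
have K1 : re M0 < K by rewrite /K ltr_pwDr// le_max lexx orbT.
have K0 : 0 <= K by rewrite /K addr_ge0// le_max lexx.
exists (K + 1); split; first by rewrite addr_ge0.
move=> z Omz j.
have zK : `|z| <= K%:C%C.
  have M0E : M0 = (re M0)%:C%C.
    by move: M0r {H K K1 K0}; case: M0 => a b; rewrite complex_real => /eqP ->.
  suff h : M0 < K%:C%C by exact: (H _ h z Omz).
  by rewrite M0E ltcR.
have : ball (0 : Cn) (K + 1)%:C%C z.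
  rewrite -ball_normE /= sub0r normrN; apply: le_lt_trans zK _.
  by rewrite ltcR ltrDl.
move=> [_ /(_ 0 j)]; rewrite -ball_normE /= mxE sub0r normrN normCE ltcR => /ltW h.
by split; apply: le_trans h; [exact: re_le_normc|exact: im_le_normc].
Qed.

Definition axis (j : 'I_n) (x y : R) : Cn := (x +i* y)%C *: delta_mx 0 j.

Definition fdiffC F (j : 'I_n) z (a b : R) := fdiff (fun x y => F (z + axis j x y)) 0 0 a b.

Lemma axisD j x y s t : axis j (x + s) (y + t) = axis j x y + axis j s t.
Proof. by rewrite /axis -scalerDl. Qed.

Lemma nsq_axis j s t : nsq (axis j s t) = s ^+ 2 + t ^+ 2.
Proof.
rewrite /nsq (bigD1 j)//= big1 => [|i /negbTE ij].
  by rewrite !mxE !eqxx mulr1 addr0.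
by rewrite !mxE ij mulr0 /= expr0n addr0.
Qed.

Lemma fdiffC_slice F j z x y a b : fdiffC F j (z + axis j x y) a b ->
  fdiff (fun x y => F (z + axis j x y)) x y a b.
Proof.
move=> dF e e0; have [r r0 H] := dF e e0; exists r; first exact: r0.
move=> s u sr ur; have := H s u sr ur.
by rewrite !add0r axisD addrA [axis j 0 0]/axis scale0r addr0.
Qed.

(** By Fubini it suffices that [g] integrates to 0 on every complex line in direction [j]; there the
    plane divergence theorem applies. *)
Lemma divergence_Cn_eq0 (j : 'I_n) (U V g : Cn -> R) (M B : R) : 0 <= M ->
  (forall z, exists a b c d, [/\ fdiffC U j z a b, fdiffC V j z c d & g z = a + d]) ->
  continuous g -> (forall z, `|g z| <= B) ->
  (forall z, ~ Cn_box M z -> [/\ U z = 0, V z = 0 & g z = 0]) ->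
  \int[lambda]_z g z = 0.
Proof.
move=> M0 dUV cg gB supp.
have mg : measurable_fun setT g.
  by apply: continuous_measurable_Cn => [|z _]; [exact: openT|exact: cg].
have mo := @measurable_of_reals R n.
have mgo : measurable_fun setT (g \o of_reals) by exact: measurableT_comp mg mo.
have supp' t : ~ tuple_box (square M) t -> g (of_reals t) = 0.
  by rewrite -of_reals_box => /supp[].
rewrite /Rintegral /lebesgue_Cn (integral_pushforward mo)//; last 2 first.
- exact/measurable_EFinP.
- apply: (@bounded_support_integrable _ _ _ _ (tuple_box (square M)) _ B) => //.
  + exact: measurable_tuple_box.
  + by apply: power_measure_box_lty => //; exact: lebesgue_R2_square_lty.
rewrite preimage_setT (@power_measure_slice _ _ _ _ n j _ (square M) B)//.
  exact: lebesgue_R2_square_lty.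
(* Base point of the line: with coordinate [j] set to 0, the parameters of the line are the real
   coordinates themselves. *)
move=> t; pose z := \row_i (if i == j then 0 else of_reals t 0 i).
have zE p : of_reals (set_tnth t j p) = z + axis j p.1 p.2.
  apply/rowP => i; rewrite !mxE tnth_mktuple; have [_|_] := eqVneq i j.
    by rewrite add0r mulr1.
  by rewrite mulr0 addr0.
under eq_integral do rewrite zE.
pose h x y := g (z + axis j x y).
have hB p : `|h p.1 p.2| <= B by exact: gB.
have h0 x y : ~ (`|x| <= M /\ `|y| <= M) -> ~ Cn_box M (z + axis j x y).
  by move=> xy /(_ j); rewrite !mxE eqxx add0r mulr1.
have ih : (product_measure1 (@lebesgue_measure R) (@lebesgue_measure R)).-integrable setT
    (EFin \o (fun p : R * R => h p.1 p.2)).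
  apply: (@bounded_support_integrable _ _ _ _ (square M) _ B) => //.
  - exact: lebesgue_R2_square_lty.
  - rewrite [X in measurable_fun _ X](_ : _ = (g \o of_reals) \o (set_tnth t j)).
      apply: (measurableT_comp mgo); apply/measurable_fun_tnthP => i.
      have [ij|ij] := eqVneq i j.
        rewrite [X in measurable_fun _ X](_ : _ = id) //.
        by apply/funext => p; rewrite /= tnth_mktuple ij eqxx.
      rewrite [X in measurable_fun _ X](_ : _ = cst (tnth t i)) //.
      by apply/funext => p; rewrite /= tnth_mktuple (negbTE ij).
    by apply/funext => p /=; rewrite zE.
  - move=> -[x y] /= xy; have [] // := supp (z + axis j x y); apply: h0 => -[xM yM].
    by apply: xy; rewrite /square /= !in_itv /= -!ler_norml.
rewrite -[LHS](integral21_prod_meas1 ih).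
have ch : cont2 h.
  move=> x y e e0; have /continuous_nsqP/(_ e e0)[r r0 H] := cg (z + axis j x y).
  exists (Num.min 1 (r / 2)); first by rewrite lt_min ltr01 divr_gt0.
  move=> s u; rewrite !lt_min => /andP[s1 s2] /andP[u1 u2].
  have su : z + axis j (x + s) (y + u) - (z + axis j x y) = axis j s u.
    by apply/eqP; rewrite subr_eq axisD addrA [axis j s u + _]addrC.
  apply/ltW/H; rewrite su nsq_axis.
  rewrite -[s ^+ 2]real_normK ?num_real// -[u ^+ 2]real_normK ?num_real//.
  by move: s1 s2 u1 u2 (normr_ge0 s) (normr_ge0 u); move: `|s| `|u| => a b *; nra.
have slice x y : exists a b c d, [/\ fdiff (fun x y => U (z + axis j x y)) x y a b,
    fdiff (fun x y => V (z + axis j x y)) x y c d & h x y = a + d].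
  have [a [b [c [d [dU dV gad]]]]] := dUV (z + axis j x y).
  by exists a, b, c, d; split; [exact: fdiffC_slice|exact: fdiffC_slice|exact: gad].
have h00 x y : ~ (`|x| <= M /\ `|y| <= M) -> h x y = 0.
  by move=> xy; have [] := supp _ (h0 _ _ xy).
have D0 := divergence_integral_eq0 M0 slice ch (fun x y => hB (x, y))
  (fun x y xy => supp _ (h0 x y xy)).
have E y : (\int[lebesgue_measure]_x (h x y)%:E)%E = (\int[lebesgue_measure]_x h x y)%:E.
  rewrite /Rintegral fineK//; apply: (integrable_fin_num measurableT).
  apply: (@support_integrable _ (h^~ y) M _ measurableT); first exact: cont2_left.
  by move=> x xM; apply: h00 => -[].
have fin := integrable_fin_num measurableT ih.
rewrite -(integral21_prod_meas1 ih) in fin *.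
by rewrite -(fineK fin); congr EFin; rewrite -[RHS]D0 /Rintegral; congr fine;
  apply: eq_integral => y _; rewrite -E.
Qed.

End LebesgueCn.

(** * Smooth test functions *)

Section Flat.
Context {R : realType}.
Implicit Types x y : R.

Lemma is_derive_epsP (f : R -> R) x l : is_derive x (1 : R) f l <->
  forall e : R, 0 < e -> exists2 d : R, 0 < d & forall h, `|h| < d ->
    `|f (x + h) - f x - l * h| <= e * `|h|.
Proof.
have quotE h : h != 0 -> forall e : R,
    (`|l - h^-1 *: (f (h *: (1 : R) + x) - f x)| <= e) =
    (`|f (x + h) - f x - l * h| <= e * `|h|).
  move=> h0 e; rewrite [h *: 1]mulr1 [h + x]addrC [_ *: _]mulrC.
  rewrite -ler_pdivrMr ?normr_gt0// -normf_div distrC.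
  by rewrite [X in _ = (`|X| <= _)]mulrBl mulfK.
split=> [[df dl] e e0|H].
  have /cvgrPdist_le/(_ e e0) : h^-1 *: (f (h *: (1 : R) + x) - f x) @[h --> 0^'] --> l.
    by rewrite -dl; exact: df.
  move=> /nbhs_ballP[d d0 Hd]; exists d => // h hd.
  have [->|h0] := eqVneq h 0; first by rewrite addr0 subrr mulr0 subr0 !normr0 mulr0.
  by rewrite -quotE//; apply: Hd => //; rewrite -ball_normE /= sub0r normrN.
have fl : h^-1 *: (f (h *: (1 : R) + x) - f x) @[h --> 0^'] --> l.
  apply/cvgrPdist_le => e e0; have [d d0 Hd] := H e e0.
  apply/nbhs_ballP; exists d => // h; rewrite -ball_normE /= sub0r normrN => hd h0.
  by rewrite quotE//; exact: Hd.
split; first by apply/cvg_ex; exists l; exact: fl.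
exact: (cvg_lim _ fl).
Qed.

(* The factor x^-k makes the family closed under differentiation:
   flat k' = flat k.+2 - k * flat k.+1. *)
Definition flat (k : nat) x : R := if 0 < x then x ^- k * expR (- x^-1) else 0.

(** [1 + t <= exp t] at [t = y / (m + 1)], raised to the power [m + 1]. *)
Lemma exprn_le_expR (m : nat) y : 0 <= y -> y ^+ m.+1 <= m.+1%:R ^+ m.+1 * expR y.
Proof.
move=> y0; have -> : expR y = expR (y / m.+1%:R) ^+ m.+1.
  by rewrite -expRM_natl; congr expR; rewrite mulrC divfK.
rewrite -exprMn; apply: lerXn2r; rewrite ?nnegrE ?mulr_ge0 ?expR_ge0//.
apply: le_trans (_ : m.+1%:R * (1 + y / m.+1%:R) <= _).
  by rewrite mulrDr mulr1 mulrCA divff// mulr1 lerDr.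
by rewrite ler_pM2l// expR_ge1Dx.
Qed.

(** The previous bound at [y = 1 / x], with exponent [k + 2]. A quadratic bound is what makes the
    derivative at 0 exist and vanish. *)
Lemma flat_le k : exists2 c : R, 0 <= c & forall x, `|flat k x| <= c * x ^+ 2.
Proof.
exists (k.+2%:R ^+ k.+2); first by rewrite exprn_ge0.
move=> x; rewrite /flat; case: ifPn => x0; last first.
  by rewrite normr0 mulr_ge0 ?sqr_ge0// exprn_ge0.
rewrite ger0_norm; last by rewrite mulr_ge0 ?expR_ge0// invr_ge0 exprn_ge0// ltW.
have y0 : 0 < x^-1 by rewrite invr_gt0.
rewrite -{3}[x]invrK -exprVn; move: x^-1 y0 => y y0.
rewrite exprVn -[leRHS]/(_ / _) ler_pdivlMr ?exprn_gt0// expRN mulrAC -exprD addn2.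
by rewrite ler_pdivrMr ?expR_gt0// exprn_le_expR// ltW.
Qed.

Lemma flat0 k : flat k 0 = 0.
Proof. by rewrite /flat ltxx. Qed.

Lemma flat_ge0 k x : 0 <= flat k x.
Proof.
by rewrite /flat; case: ifPn => // x0; rewrite mulr_ge0 ?expR_ge0 ?invr_ge0 ?exprn_ge0 ?ltW.
Qed.

Lemma flat0_gt0 x : 0 < x -> 0 < flat 0 x.
Proof. by move=> x0; rewrite /flat x0 expr0 invr1 mul1r expR_gt0. Qed.

Lemma flat_le0 k x : x <= 0 -> flat k x = 0.
Proof. by move=> x0; rewrite /flat ltNge x0. Qed.

Lemma is_derive_flat k x : is_derive x 1 (flat k) (flat k.+2 x - k%:R * flat k.+1 x).
Proof.
have [x0|x0|x0] := ltrgt0P x.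
- pose f y : R := y ^- k * expR (- y^-1).
  apply: (@near_eq_is_derive _ _ _ f).
    near=> y; rewrite /flat ifT//; near: y; exact: lt_nbhsr.
  have xn : x != 0 by rewrite gt_eqF.
  have dg : is_derive x (1 : R) (fun y : R => y^-1) (- x^-1 ^+ 2).
    by have := is_deriveV xn (is_derive_id x 1); rewrite exprVn [_ *: _]mulr1.
  have dp : is_derive x (1 : R) (fun y : R => y^-1 ^+ k) (- (k%:R * x^-1 ^+ k.+1)).
    have -> : (fun y : R => y^-1 ^+ k) = (fun y : R => y^-1) ^+ k.
      by apply/funext => y; rewrite exprfctE.
    apply: (is_derive_eq (is_deriveX k dg)); rewrite [_ *: _]mulrN -mulrA -exprD.
    by case: (k) => [|m]; rewrite ?mul0r// addn2.
  have de : is_derive x (1 : R) (fun y : R => expR (- y^-1)) (x^-1 ^+ 2 * expR (- x^-1)).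
    have := @is_derive1_comp R expR (fun y : R => - y^-1) x _ _
      (is_derive_expR (- x^-1)) (is_deriveN dg).
    by move=> h; apply: (is_derive_eq h); rewrite opprK [LHS]mulrC.
  rewrite /flat x0; have -> : f = (fun y : R => y^-1 ^+ k) * (fun y => expR (- y^-1)).
    by apply/funext => y; rewrite /f -exprVn.
  apply: (is_derive_eq (is_deriveM dp de)).
  rewrite -!exprVn; set E := expR (- x^-1); set u := x^-1.
  rewrite -[u ^+ k *: _]/(_ * _) -[E *: _]/(_ * _) !exprS; ring.
- apply: (@near_eq_is_derive _ _ _ (cst 0 : R -> R)).
    by have := lt_nbhsl x0; apply: filterS => y y0; rewrite flat_le0// ltW.
  by rewrite !flat_le0 ?ltW// mulr0 subr0; exact: is_derive_cst.
- rewrite x0; apply/is_derive_epsP => e e0; have [c c0 H] := flat_le k.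
  exists (e / (c + 1)); first by rewrite divr_gt0// ltr_wpDl.
  move=> h; rewrite !flat0 mulr0 !subr0 mul0r subr0 add0r ltr_pdivlMr ?ltr_wpDl// => hc.
  apply: le_trans (H h) _; rewrite -real_normK ?num_real// expr2 mulrA.
  apply: ler_wpM2r => //; rewrite mulrC.
  by apply: le_trans (ltW hc); rewrite ler_wpM2l// lerDl.
Unshelve. all: by end_near.
Qed.

Lemma MVT_between (f df : R -> R) x y : (forall x, is_derive x (1 : R) f (df x)) ->
  exists2 c, Num.min x y <= c <= Num.max x y & f y - f x = df c * (y - x).
Proof.
move=> fdf; have [xy|yx] := leP x y.
  have [|c] := @MVT_segment R f df x y xy.
    by apply: derivable_within_continuous => t _; exact: ex_derive.
  by rewrite in_itv /= => cxy ->; exists c.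
have [|c] := @MVT_segment R f df y x (ltW yx).
  by apply: derivable_within_continuous => t _; exact: ex_derive.
by rewrite in_itv /= => cxy fE; exists c => //; rewrite -opprB fE; ring.
Qed.

(** Two applications of the mean value theorem; the factor 1/2 of Taylor's formula is given up. *)
Lemma taylor1_bound (f df ddf : R -> R) (M : R) x y :
  (forall x, is_derive x (1 : R) f (df x)) ->
  (forall x, is_derive x (1 : R) df (ddf x)) ->
  (forall c, Num.min x y <= c <= Num.max x y -> `|ddf c| <= M) ->
  `|f y - f x - df x * (y - x)| <= M * (y - x) ^+ 2.
Proof.
move=> f1 f2 ddM; have [c cxy ->] := MVT_between x y f1.
have [d dxc dE] := MVT_between x c f2.
rewrite -mulrBl dE -mulrA normrM -[_ ^+ 2]real_normK ?num_real//.
have cxy' : `|c - x| <= `|y - x|.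
  move: cxy; have [xy|yx] := leP x y => /andP[h1 h2].
    by rewrite !ger0_norm; lra.
  by rewrite !ler0_norm; lra.
apply: ler_pM => //; last by rewrite normrM expr2 ler_wpM2r.
apply: ddM; move: cxy dxc; case: (leP x y) => xy /andP[c1 c2];
  case: (leP x c) => xc /andP[d1 d2]; apply/andP; split; lra.
Qed.

Lemma flat_bound k : exists2 c : R, 0 <= c & forall x, x <= 1 -> `|flat k x| <= c.
Proof.
have [c c0 H] := flat_le k; exists c => // x x1.
have [x0|x0] := leP x 0; first by rewrite flat_le0// normr0.
by apply: le_trans (H x) _; rewrite ler_piMr// exprn_ile1// ltW.
Qed.

Lemma is_derive_flat0 x : is_derive x 1 (flat 0) (flat 2 x).
Proof. by apply: is_derive_eq (is_derive_flat 0 x) _; rewrite mul0r subr0. Qed.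

Lemma flat0_taylor : exists2 M : R, 0 <= M & forall x y, x <= 1 -> y <= 1 ->
  `|flat 0 y - flat 0 x - flat 2 x * (y - x)| <= M * (y - x) ^+ 2.
Proof.
have [c3 c30 H3] := flat_bound 3; have [c4 c40 H4] := flat_bound 4.
(* The second derivative of [flat 0] is [flat 4 - 2 * flat 3]. *)
exists (c4 + 2 * c3); first by rewrite addr_ge0// mulr_ge0.
move=> x y x1 y1; apply: taylor1_bound is_derive_flat0 (is_derive_flat 2) _.
move=> c /andP[_ cm]; have c1 : c <= 1 by apply: le_trans cm _; rewrite ge_max x1 y1.
by apply: le_trans (ler_normB _ _) _; rewrite normrM normr_nat lerD ?H4// ler_wpM2l ?H3.
Qed.

Lemma continuous_flat k : continuous (flat k).
Proof.
move=> x; apply: differentiable_continuous; apply/derivable1_diffP.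
by have := is_derive_flat k x; move=> /(@ex_derive _ _ _ _ _ _ _).
Qed.

Lemma fdiff_cst (c : R) x y : fdiff (fun _ _ => c) x y 0 0.
Proof.
by move=> e e0; exists 1 => // s t _ _; rewrite subrr !mul0r !subr0 normr0 mulr_ge0 ?addr_ge0// ltW.
Qed.

Lemma fdiffD U V x y a b c d : fdiff U x y a b -> fdiff V x y c d ->
  fdiff (fun x y => U x y + V x y : R) x y (a + c) (b + d).
Proof.
move=> dU dV e e0; have e2 : 0 < e / 2 by rewrite divr_gt0.
have [r r0 HU] := dU _ e2; have [q q0 HV] := dV _ e2.
exists (Num.min r q); first by rewrite lt_min r0.
move=> s t; rewrite !lt_min => /andP[s1 s2] /andP[t1 t2].
have := lerD (HU _ _ s1 t1) (HV _ _ s2 t2); rewrite -mulrDl -splitr => h.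
apply: le_trans h; apply: le_trans (ler_normD _ _).
by rewrite le_eqVlt; apply/orP; left; apply/eqP; congr `|_|; ring.
Qed.

Lemma fdiff_lip U x y a b : fdiff U x y a b -> exists K d : R, [/\ 0 < d, 0 < K &
  forall s t, `|s| < d -> `|t| < d -> `|U (x + s) (y + t) - U x y| <= K * (`|s| + `|t|)].
Proof.
move=> /(_ 1 ltr01)[d d0 H]; exists (`|a| + `|b| + 1), d; split => //.
move=> s t sd td; have := H _ _ sd td; set w := U _ _ - _ => Hw.
have -> : w = (w - a * s - b * t) + a * s + b * t by ring.
apply: le_trans (ler_normD _ _) _; apply: le_trans (lerD (ler_normD _ _) (lexx _)) _.
rewrite !normrM; move: Hw; have := normr_ge0 a; have := normr_ge0 b.
have := normr_ge0 s; have := normr_ge0 t; nra.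
Qed.

Lemma fdiff_comp (f : R -> R) df U x y a b : is_derive (U x y) (1 : R) f df ->
  fdiff U x y a b -> fdiff (fun x y => f (U x y)) x y (df * a) (df * b).
Proof.
move=> /is_derive_epsP Hf dU e e0; have [K [r [r0 K0 HK]]] := fdiff_lip dU.
have e1 : 0 < e / (2 * K) by rewrite divr_gt0// mulr_gt0.
have [q q0 Hq] := Hf _ e1.
have e2 : 0 < e / (2 * (`|df| + 1)) by rewrite divr_gt0// mulr_gt0// ltr_wpDl.
have [p p0 Hp] := dU _ e2.
have qK : 0 < q / (2 * K) by rewrite divr_gt0// mulr_gt0.
exists (Num.min r (Num.min p (q / (2 * K)))); first by rewrite !lt_min r0 p0.
move=> s t; rewrite !lt_min => /and3P[s1 s2 s3] /and3P[t1 t2 t3].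
have st : 0 <= `|s| + `|t| by rewrite addr_ge0.
have hK := HK _ _ s1 t1; have hp := Hp _ _ s2 t2.
set D := U (x + s) (y + t) - U x y in hK hp.
have Dq : `|D| < q.
  apply: le_lt_trans hK _; rewrite ltr_pdivlMr ?mulr_gt0// in s3.
  rewrite ltr_pdivlMr ?mulr_gt0// in t3; lra.
have := Hq _ Dq; have -> : U x y + D = U (x + s) (y + t) by rewrite /D addrC subrK.
move=> h1.
have -> : f (U (x + s) (y + t)) - f (U x y) - df * a * s - df * b * t =
  (f (U (x + s) (y + t)) - f (U x y) - df * D) + df * (D - a * s - b * t) by ring.
apply: le_trans (ler_normD _ _) _.
have -> : e * (`|s| + `|t|) = e / (2 * K) * (K * (`|s| + `|t|)) +
    (`|df| + 1) * (e / (2 * (`|df| + 1)) * (`|s| + `|t|)).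
  field; rewrite !gt_eqF// ltr_wpDl//.
apply: lerD; first by apply: le_trans h1 _; rewrite ler_pM2l.
by rewrite normrM; apply: ler_pM => //; rewrite lerDl.
Qed.

(** Polarisation: [U V = ((U + V) ^ 2 - (U - V) ^ 2) / 4] reduces the product rule to sums and to
    the chain rule for squares and multiples. *)
Lemma fdiffM U V x y a b c d : fdiff U x y a b -> fdiff V x y c d ->
  fdiff (fun x y => U x y * V x y : R) x y (a * V x y + U x y * c) (b * V x y + U x y * d).
Proof.
move=> dU dV.
have sq W a' b' : fdiff W x y a' b' ->
    fdiff (fun x y => W x y ^+ 2) x y (2 * W x y * a') (2 * W x y * b').
  move=> dW; apply: (@fdiff_comp (fun w => w ^+ 2) _ W) dW.
  by apply: is_derive_eq (is_deriveX 2 (is_derive_id (W x y) 1)) _; rewrite expr1 [_ *: _]mulr1.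
have scale W k a' b' : fdiff W x y a' b' -> fdiff (fun x y => k * W x y) x y (k * a') (k * b').
  move=> dW; apply: (@fdiff_comp ( *%R k) _ W) dW.
  by apply: is_derive_eq (is_deriveZ k (is_derive_id (W x y) 1)) _; rewrite [_ *: _]mulr1.
have := fdiffD (scale _ 4^-1 _ _ (sq _ _ _ (fdiffD dU dV)))
  (scale _ (- 4^-1) _ _ (sq _ _ _ (fdiffD dU (scale _ (-1) _ _ dV)))).
congr fdiff; first (apply/funext => x'; apply/funext => y'); by field.
Qed.

End Flat.

Section PlaneDerivatives.
Context {R : realType}.

Lemma fdiff_is_derive (U : R -> R -> R) a b : fdiff U 0 0 a b ->
  is_derive (0 : R) (1 : R) (fun t : R => U t 0) a /\
  is_derive (0 : R) (1 : R) (fun t : R => U 0 t) b.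
Proof.
move=> dU; split; apply/is_derive_epsP => e e0; have [d d0 H] := dU e e0; exists d => // h hd.
  have := H h 0 hd; rewrite normr0 mulr0 subr0 !addr0 => /(_ d0).
  by rewrite !add0r.
have := H 0 h; rewrite normr0 mulr0 subr0 !add0r => /(_ d0 hd).
by [].
Qed.

Lemma fdiff_linear1 (u c e s t : R) : 0 < e ->
  `|u + c * (0 + s) - (u + c * 0) - c * s - 0 * t| <= e * (`|s| + `|t|).
Proof.
move=> e0; rewrite [X in `|X|](_ : _ = 0); last by ring.
by rewrite normr0 mulr_ge0 ?addr_ge0// ltW.
Qed.

Lemma fdiff_linear2 (u c e s t : R) : 0 < e ->
  `|u + c * (0 + t) - (u + c * 0) - 0 * s - c * t| <= e * (`|s| + `|t|).
Proof.
move=> e0; rewrite [X in `|X|](_ : _ = 0); last by ring.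
by rewrite normr0 mulr_ge0 ?addr_ge0// ltW.
Qed.

End PlaneDerivatives.

(** * A class of smooth functions closed under partial derivatives *)

Section SmoothClass.
Context {R : realType} {n : nat}.
Local Notation Cn := 'rV[C R]_n.
Local Notation re := (@complex.Re R).
Local Notation im := (@complex.Im R).
Implicit Types (z w : Cn) (F G : Cn -> R) (phi f : Cn -> C R).

(* A class closed under partial derivatives, so that its members are smooth
   without any computation of iterated derivatives. *)
Inductive elementary : (Cn -> R) -> Prop :=
| elementary_cst c : elementary (fun _ => c)
| elementary_re j : elementary (fun z => re (z 0 j))
| elementary_im j : elementary (fun z => im (z 0 j))
| elementaryD F G : elementary F -> elementary G -> elementary (fun z => F z + G z)
| elementaryM F G : elementary F -> elementary G -> elementary (fun z => F z * G z)
| elementary_flat k F : elementary F -> elementary (fun z => flat k (F z)).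

Lemma elementary_continuous F : elementary F -> continuous F.
Proof.
elim=> {F} [c|j|j|F G _ cF _ cG|F G _ cF _ cG|k F _ cF] z.
- exact: cst_continuous.
- by apply: continuous_comp; [exact: continuous_coord|exact: continuous_re].
- by apply: continuous_comp; [exact: continuous_coord|exact: continuous_im].
- exact: (cvgD (cF z) (cG z)).
- exact: (cvgM (cF z) (cG z)).
- by apply: continuous_comp; [exact: cF|exact: continuous_flat].
Qed.

Lemma re_axisD z i j s t :
  re ((z + axis j s t) 0 i) = re (z 0 i) + (i == j)%:R * s.
Proof.
rewrite !mxE eqxx /= raddfD /=; case: eqVneq => _; first by rewrite mulr1 mul1r.
by rewrite mulr0 mul0r.
Qed.

Lemma im_axisD z i j s t :
  im ((z + axis j s t) 0 i) = im (z 0 i) + (i == j)%:R * t.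
Proof.
rewrite !mxE eqxx /= raddfD /=; case: eqVneq => _; first by rewrite mulr1 mul1r.
by rewrite mulr0 mul0r.
Qed.

Lemma fdiffC_re k j z : fdiffC (fun z : Cn => re (z 0 k)) j z (k == j)%:R 0.
Proof.
move=> e e0; exists 1; first exact: ltr01.
move=> s t _ _; rewrite (re_axisD z k j (0 + s) (0 + t)) (re_axisD z k j 0 0).
exact: fdiff_linear1.
Qed.

Lemma fdiffC_im k j z : fdiffC (fun z : Cn => im (z 0 k)) j z 0 (k == j)%:R.
Proof.
move=> e e0; exists 1; first exact: ltr01.
move=> s t _ _; rewrite (im_axisD z k j (0 + s) (0 + t)) (im_axisD z k j 0 0).
exact: fdiff_linear2.
Qed.

Lemma elementary_fdiff F j : elementary F -> exists Fx Fy,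
  [/\ elementary Fx, elementary Fy & forall z, fdiffC F j z (Fx z) (Fy z)].
Proof.
elim=> {F} [c|i|i|F G sF [Fx [Fy [sFx sFy dF]]] sG [Gx [Gy [sGx sGy dG]]]|
  F G sF [Fx [Fy [sFx sFy dF]]] sG [Gx [Gy [sGx sGy dG]]]|k F sF [Fx [Fy [sFx sFy dF]]]].
- exists (fun=> 0), (fun=> 0); split; [exact: elementary_cst..|] => z.
  exact: fdiff_cst.
- exists (fun=> (i == j)%:R), (fun=> 0); split; [exact: elementary_cst..|] => z.
  exact: fdiffC_re.
- exists (fun=> 0), (fun=> (i == j)%:R); split; [exact: elementary_cst..|] => z.
  exact: fdiffC_im.
- exists (fun z => Fx z + Gx z), (fun z => Fy z + Gy z).
  by split; [exact: elementaryD..|] => z; exact: (fdiffD (dF z) (dG z)).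
- exists (fun z => Fx z * G z + F z * Gx z), (fun z => Fy z * G z + F z * Gy z).
  split; [by apply: elementaryD; exact: elementaryM..|] => z.
  by have := fdiffM (dF z) (dG z); rewrite /axis scale0r addr0.
- pose D z := flat k.+2 (F z) + - k%:R * flat k.+1 (F z).
  have sD : elementary D.
    apply: elementaryD; first exact: elementary_flat.
    by apply: elementaryM; [exact: elementary_cst|exact: elementary_flat].
  exists (fun z => D z * Fx z), (fun z => D z * Fy z).
  split; [exact: elementaryM..|] => z; apply: (fdiff_comp _ (dF z)).
  rewrite /axis scale0r addr0; apply: is_derive_eq (is_derive_flat k _) _.
  by rewrite /D mulNr.
Qed.

Lemma fdiffC_is_derive F j z a b : fdiffC F j z a b ->
  is_derive (0 : R) (1 : R) (fun t : R => F (z + (t%:C%C : C R) *: direction (j, false))) a /\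
  is_derive (0 : R) (1 : R) (fun t : R => F (z + (t%:C%C : C R) *: direction (j, true))) b.
Proof.
move=> dF.
have E1 t : (t%:C%C : C R) *: direction (j, false) = axis j t 0 :> Cn by [].
have E2 t : (t%:C%C : C R) *: direction (j, true) = axis j 0 t :> Cn.
  rewrite /direction /= /axis scalerA; congr (_ *: _).
  by rewrite -complexiE; apply/eqP; rewrite eq_complex /=; apply/andP; split; apply/eqP; ring.
have [d1 d2] := fdiff_is_derive dF.
have F1 : (fun t : R => F (z + (t%:C%C : C R) *: direction (j, false))) =
    (fun t => F (z + axis j t 0)) by apply/funext => t; rewrite E1.
have F2 : (fun t : R => F (z + (t%:C%C : C R) *: direction (j, true))) =
    (fun t => F (z + axis j 0 t)) by apply/funext => t; rewrite E2.
by split; [exact: (eq_ind_r (fun f : R -> R => is_derive (0 : R) (1 : R) f a) d1 F1)|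
  exact: (eq_ind_r (fun f : R -> R => is_derive (0 : R) (1 : R) f b) d2 F2)].
Qed.

Lemma fdiffC_pderive phi j z a b c d :
  fdiffC (Re_part phi) j z a b -> fdiffC (Im_part phi) j z c d ->
  pderive (j, false) phi z = (a +i* c)%C /\ pderive (j, true) phi z = (b +i* d)%C.
Proof.
move=> /fdiffC_is_derive[Rx Ry] /fdiffC_is_derive[Ix Iy].
have E1 := @derive_val _ _ _ _ _ _ _ Rx; have E2 := @derive_val _ _ _ _ _ _ _ Ry.
have E3 := @derive_val _ _ _ _ _ _ _ Ix; have E4 := @derive_val _ _ _ _ _ _ _ Iy.
split.
  exact: (f_equal2 (@Complex R) (etrans (derive1E _ _) E1) (etrans (derive1E _ _) E3)).
exact: (f_equal2 (@Complex R) (etrans (derive1E _ _) E2) (etrans (derive1E _ _) E4)).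
Qed.

Lemma fdiffC_dbar phi j z a b c d :
  fdiffC (Re_part phi) j z a b -> fdiffC (Im_part phi) j z c d ->
  dbar j phi z = ((a - d) / 2 +i* ((c + b) / 2))%C.
Proof.
move=> dR dI; rewrite /dbar; have [-> ->] := fdiffC_pderive dR dI.
rewrite -complexiE; apply/eqP; rewrite eq_complex.
have -> : (2%:R : C R) = ((2 : R) +i* 0)%C by rewrite -[LHS](rmorph_nat (real_complex R)).
by apply/andP; split; apply/eqP; rewrite /=; field.
Qed.

Definition elementaryC phi := elementary (Re_part phi) /\ elementary (Im_part phi).

Lemma elementaryC_pderive phi c : elementaryC phi -> elementaryC (pderive c phi).
Proof.
move=> [sR sI]; case: c => j b.
have [Rx [Ry [sRx sRy dR]]] := elementary_fdiff j sR.
have [Ix [Iy [sIx sIy dI]]] := elementary_fdiff j sI.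
have E z := fdiffC_pderive (dR z) (dI z).
case: b; split.
- by rewrite (_ : Re_part _ = Ry)//; apply/funext => z; rewrite /Re_part (E z).2.
- by rewrite (_ : Im_part _ = Iy)//; apply/funext => z; rewrite /Im_part (E z).2.
- by rewrite (_ : Re_part _ = Rx)//; apply/funext => z; rewrite /Re_part (E z).1.
- by rewrite (_ : Im_part _ = Ix)//; apply/funext => z; rewrite /Im_part (E z).1.
Qed.

Lemma elementaryC_continuous phi : elementaryC phi -> continuous phi.
Proof.
move=> [sR sI] z.
by apply: continuous_reim; [exact: elementary_continuous sR z|exact: elementary_continuous sI z].
Qed.

Lemma elementaryC_smooth phi : elementaryC phi -> smooth phi.
Proof.
move=> sphi s.
have {sphi} [sR sI] : elementaryC (foldr pderive phi s).
  by elim: s => //= c s IH; exact: elementaryC_pderive.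
split; first exact: elementaryC_continuous.
move=> [j b] z; have [Rx [Ry [_ _ /(_ z)/fdiffC_is_derive[Rx' Ry']]]] := elementary_fdiff j sR.
have [Ix [Iy [_ _ /(_ z)/fdiffC_is_derive[Ix' Iy']]]] := elementary_fdiff j sI.
by case: b; split; [case: Ry'|case: Iy'|case: Rx'|case: Ix'].
Qed.

Lemma elementaryC_test (Om K : set Cn) phi : elementaryC phi -> compact K -> K `<=` Om ->
  (forall z, ~ K z -> phi z = 0) -> test_function Om phi.
Proof. by move=> sphi cK KOm phi0; split; [exact: elementaryC_smooth|exists K]. Qed.

End SmoothClass.

(** * Square integrable functions and weakly closed functions *)

Section L2Space.
Context {R : realType} {n : nat}.
Local Notation Cn := 'rV[C R]_n.
Local Notation lambda := (@lebesgue_Cn R n).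
Local Notation re := (@complex.Re R).
Local Notation im := (@complex.Im R).
Local Notation normc := Normc.normc.
Implicit Types (z w : Cn) (f g : Cn -> C R).
Variable Om : set Cn.
Hypothesis mOm : measurable Om.

Definition Cmeasurable f := measurable_fun Om (Re_part f) /\ measurable_fun Om (Im_part f).

Lemma reD (x y : C R) : re (x + y) = re x + re y. Proof. by case: x y => a b [c d]. Qed.
Lemma imD (x y : C R) : im (x + y) = im x + im y. Proof. by case: x y => a b [c d]. Qed.
Lemma reN (x : C R) : re (- x) = - re x. Proof. by case: x. Qed.
Lemma imN (x : C R) : im (- x) = - im x. Proof. by case: x. Qed.
Lemma reM (x y : C R) : re (x * y) = re x * re y - im x * im y.
Proof. by case: x y => a b [c d]. Qed.
Lemma imM (x y : C R) : im (x * y) = re x * im y + im x * re y.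
Proof. by case: x y => a b [c d]. Qed.
Lemma reJ (x : C R) : re (x^*)%C = re x. Proof. by case: x. Qed.
Lemma imJ (x : C R) : im (x^*)%C = - im x. Proof. by case: x. Qed.

Lemma eqC (x y : C R) : re x = re y -> im x = im y -> x = y.
Proof. by case: x y => a b [c d] /= -> ->. Qed.

Lemma conjCE (x : C R) : x^* = (x^*)%C.
Proof. by []. Qed.

Lemma Re_partD f g : Re_part (f \+ g) = Re_part f \+ Re_part g.
Proof. by apply/funext => z; exact: reD. Qed.
Lemma Im_partD f g : Im_part (f \+ g) = Im_part f \+ Im_part g.
Proof. by apply/funext => z; exact: imD. Qed.
Lemma Re_partN f : Re_part (\- f) = \- Re_part f.
Proof. by apply/funext => z; exact: reN. Qed.
Lemma Im_partN f : Im_part (\- f) = \- Im_part f.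
Proof. by apply/funext => z; exact: imN. Qed.
Lemma Re_partM f g : Re_part (f \* g) = (Re_part f \* Re_part g) \- (Im_part f \* Im_part g).
Proof. by apply/funext => z; exact: reM. Qed.
Lemma Im_partM f g : Im_part (f \* g) = (Re_part f \* Im_part g) \+ (Im_part f \* Re_part g).
Proof. by apply/funext => z; exact: imM. Qed.
Lemma Re_partJ f : Re_part (fun z => (f z)^*) = Re_part f.
Proof. by apply/funext => z; exact: reJ. Qed.
Lemma Im_partJ f : Im_part (fun z => (f z)^*) = \- Im_part f.
Proof. by apply/funext => z; exact: imJ. Qed.

Lemma Re_partZ c f :
  Re_part (fun z => c * f z) = (fun z => re c * Re_part f z + - im c * Im_part f z).
Proof. by apply/funext => z; rewrite /Re_part reM mulNr. Qed.
Lemma Im_partZ c f :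
  Im_part (fun z => c * f z) = (fun z => re c * Im_part f z + im c * Re_part f z).
Proof. by apply/funext => z; rewrite /Im_part imM. Qed.

Lemma CmeasurableD f g : Cmeasurable f -> Cmeasurable g -> Cmeasurable (f \+ g).
Proof.
by move=> [f1 f2] [g1 g2]; split; rewrite ?Re_partD ?Im_partD; exact: measurable_funD.
Qed.

Lemma CmeasurableN f : Cmeasurable f -> Cmeasurable (\- f).
Proof.
by move=> [f1 f2]; split; rewrite ?Re_partN ?Im_partN; exact: measurableT_comp.
Qed.

Lemma CmeasurableM f g : Cmeasurable f -> Cmeasurable g -> Cmeasurable (f \* g).
Proof.
move=> [f1 f2] [g1 g2]; split; rewrite ?Re_partM ?Im_partM.
  by apply: measurable_funB; exact: measurable_funM.
by apply: measurable_funD; exact: measurable_funM.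
Qed.

Lemma CmeasurableJ f : Cmeasurable f -> Cmeasurable (fun z => (f z)^*).
Proof.
by move=> [f1 f2]; split; rewrite ?Re_partJ ?Im_partJ//; exact: measurableT_comp.
Qed.

Lemma measurable_normc2 f : Cmeasurable f -> measurable_fun Om (fun z => normc (f z) ^+ 2).
Proof.
move=> [f1 f2].
have -> : (fun z => normc (f z) ^+ 2) = (fun z => Re_part f z ^+ 2 + Im_part f z ^+ 2).
  by apply/funext => z; exact: normc_sqr.
by apply: measurable_funD; exact: measurable_funX.
Qed.

Lemma L2P f : L2 Om f <->
  Cmeasurable f /\ lambda.-integrable Om (fun z => (normc (f z) ^+ 2)%:E).
Proof.
split=> [[f1 f2 f3]|[[f1 f2] /integrableP[f3 f4]]]; last first.
  split => //; rewrite /finite_L2norm; move: f4.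
  by under eq_integral do rewrite gee0_abs ?lee_fin ?sqr_ge0//.
split => //; apply/integrableP; split.
  by apply/measurable_EFinP; exact: measurable_normc2.
by under eq_integral do rewrite gee0_abs ?lee_fin ?sqr_ge0//.
Qed.

Lemma L2_le f (G : Cn -> R) : Cmeasurable f -> lambda.-integrable Om (EFin \o G) ->
  (forall z, Om z -> normc (f z) ^+ 2 <= G z) -> L2 Om f.
Proof.
move=> mf iG fG; apply/L2P; split => //.
apply: le_integrable iG => //; first by apply/measurable_EFinP; exact: measurable_normc2.
move=> z Omz /=; rewrite lee_fin ger0_norm ?sqr_ge0//.
by apply: le_trans (fG z Omz) (ler_norm _).
Qed.

Lemma Cintegrable_le f (G : Cn -> R) : Cmeasurable f -> lambda.-integrable Om (EFin \o G) ->
  (forall z, Om z -> normc (f z) <= G z) -> Cintegrable Om f.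
Proof.
move=> [f1 f2] iG fG; split; apply: le_integrable iG => //; try exact/measurable_EFinP;
  move=> z Omz /=; rewrite lee_fin; apply: le_trans (le_trans (fG z Omz) (ler_norm _)).
  exact: re_le_normc.
exact: im_le_normc.
Qed.

Lemma L2M_integrable f g : L2 Om f -> L2 Om g -> Cintegrable Om (f \* g).
Proof.
move=> /L2P[mf If] /L2P[mg Ig].
apply: (@Cintegrable_le _ (fun z => normc (f z) ^+ 2 + normc (g z) ^+ 2)).
- exact: CmeasurableM.
- rewrite (_ : EFin \o _ = (fun z => (normc (f z) ^+ 2)%:E) \+
      (fun z => (normc (g z) ^+ 2)%:E))%E//.
  exact: integrableD.
move=> z _ /=; rewrite Normc.normcM; move: (normc (f z)) (normc (g z)) => a b.
by have := sqr_ge0 (a - b); nra.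
Qed.

Lemma L2D f g : L2 Om f -> L2 Om g -> L2 Om (f \+ g).
Proof.
move=> /L2P[mf If] /L2P[mg Ig].
apply: (@L2_le _ (fun z => 2 * normc (f z) ^+ 2 + 2 * normc (g z) ^+ 2)).
- exact: CmeasurableD.
- rewrite (_ : EFin \o _ = (fun z => 2%:E * (normc (f z) ^+ 2)%:E)%E \+
      (fun z => 2%:E * (normc (g z) ^+ 2)%:E)%E)%E//.
  by apply: integrableD => //; exact: integrableZl.
move=> z _ /=; rewrite !normc_sqr reD imD.
move: (re _) (im _) (re _) (im _) => a b c d.
by have := sqr_ge0 (a - c); have := sqr_ge0 (b - d); nra.
Qed.

Lemma L2_bounded_mul f g (B : R) : Cmeasurable g -> (forall z, Om z -> normc (g z) <= B) ->
  L2 Om f -> L2 Om (g \* f).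
Proof.
move=> mg gB /L2P[mf If].
apply: (@L2_le _ (fun z => B ^+ 2 * normc (f z) ^+ 2)); first exact: CmeasurableM.
  exact: (integrableZl mOm (B ^+ 2) If).
move=> z Omz /=; rewrite Normc.normcM exprMn ler_wpM2r ?sqr_ge0//.
by apply: lerXn2r (gB z Omz); rewrite nnegrE ?(le_trans (normc_ge0 _) (gB z Omz))// normc_ge0.
Qed.

Lemma L2N f : L2 Om f -> L2 Om (\- f).
Proof.
move=> /L2P[mf If]; apply/L2P; split; first exact: CmeasurableN.
by apply: eq_integrable If => // z _ /=; rewrite !normc_sqr reN imN !sqrrN.
Qed.

Lemma L2J f : L2 Om f -> L2 Om (fun z => (f z)^*).
Proof.
move=> /L2P[mf If]; apply/L2P; split; first exact: CmeasurableJ.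
by apply: eq_integrable If => // z _ /=; rewrite !normc_sqr conjCE reJ imJ sqrrN.
Qed.

Lemma L2_bounded g (B : R) : (lambda Om < +oo)%E -> Cmeasurable g ->
  (forall z, Om z -> normc (g z) <= B) -> L2 Om g.
Proof.
move=> Omoo mg gB; apply: (@L2_le _ (fun=> B ^+ 2)) => //.
  by apply: (@bounded_integrable _ _ _ _ _ _ `|B ^+ 2|).
move=> z Omz; apply: lerXn2r (gB z Omz).
  by rewrite nnegrE normc_ge0.
by rewrite nnegrE (le_trans (normc_ge0 _) (gB z Omz)).
Qed.

Lemma CintegralD f g : Cintegrable Om f -> Cintegrable Om g ->
  Cintegral Om (f \+ g) = Cintegral Om f + Cintegral Om g.
Proof.
move=> [f1 f2] [g1 g2]; rewrite /Cintegral Re_partD Im_partD.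
by rewrite !RintegralD.
Qed.

Lemma CintegrableD f g : Cintegrable Om f -> Cintegrable Om g -> Cintegrable Om (f \+ g).
Proof.
move=> [f1 f2] [g1 g2]; split; rewrite ?Re_partD ?Im_partD.
  exact: (integrableD mOm f1 g1).
exact: (integrableD mOm f2 g2).
Qed.

Lemma CintegrableZ (c : C R) f : Cintegrable Om f -> Cintegrable Om (fun z => c * f z).
Proof.
move=> [f1 f2]; split; rewrite ?Re_partZ ?Im_partZ.
  exact: (integrableD mOm (integrableZl mOm (re c) f1) (integrableZl mOm (- im c) f2)).
exact: (integrableD mOm (integrableZl mOm (re c) f2) (integrableZl mOm (im c) f1)).
Qed.

Lemma CintegralZ (c : C R) f : Cintegrable Om f ->
  Cintegral Om (fun z => c * f z) = c * Cintegral Om f.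
Proof.
move=> [f1 f2]; rewrite /Cintegral Re_partZ Im_partZ.
have I1 k := integrableZl mOm k f1; have I2 k := integrableZl mOm k f2.
rewrite (RintegralD mOm (I1 (re c)) (I2 (- im c))) (RintegralD mOm (I2 (re c)) (I1 (im c))).
by rewrite !RintegralZl//; apply: eqC; rewrite ?reM ?imM /= ?mulNr.
Qed.

Lemma eq_Cintegral f g : (forall z, Om z -> f z = g z) -> Cintegral Om f = Cintegral Om g.
Proof.
by move=> fg; rewrite /Cintegral; congr (_ +i* _)%C; apply: eq_Rintegral => z;
  rewrite inE => Omz; rewrite /Re_part /Im_part fg.
Qed.

Lemma eq_Cintegrable f g : (forall z, Om z -> f z = g z) ->
  Cintegrable Om f -> Cintegrable Om g.
Proof.
move=> fg [f1 f2]; split; [apply: eq_integrable f1|apply: eq_integrable f2] => // z;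
  rewrite inE => Omz; by rewrite /= /Re_part /Im_part fg.
Qed.

Lemma Cintegral0 : Cintegral Om (fun=> 0) = 0.
Proof. by rewrite /Cintegral !Rintegral_cst// !mul0r. Qed.

Lemma Cintegrable0 : Cintegrable Om (fun=> 0).
Proof. by split; exact: integrable0. Qed.

Lemma Cintegral_sum (I : Type) (s : seq I) (F : I -> Cn -> C R) :
  (forall i, Cintegrable Om (F i)) -> Cintegrable Om (fun z => \sum_(i <- s) F i z) /\
  Cintegral Om (fun z => \sum_(i <- s) F i z) = \sum_(i <- s) Cintegral Om (F i).
Proof.
move=> IF; elim: s => [|i s [IH1 IH2]].
  under eq_fun do rewrite big_nil; rewrite big_nil; split; [exact: Cintegrable0|exact: Cintegral0].
under eq_fun do rewrite big_cons; rewrite big_cons; split; first exact: (CintegrableD (IF i) IH1).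
by rewrite -IH2 -(CintegralD (IF i) IH1).
Qed.

Lemma eq_ae_Cintegral f g : Cmeasurable f -> Cmeasurable g ->
  {ae lambda, forall z, Om z -> f z = g z} -> Cintegral Om f = Cintegral Om g.
Proof.
move=> [f1 f2] [g1 g2] fg; rewrite /Cintegral /Rintegral; congr (fine _ +i* fine _)%C;
  apply: ae_eq_integral => //; try exact/measurable_EFinP;
  by apply: filterS fg => z /= fg Omz; rewrite /Re_part /Im_part fg.
Qed.

End L2Space.

Lemma fdiffN {R : realType} (U : R -> R -> R) x y a b : fdiff U x y a b ->
  fdiff (fun x y => - U x y) x y (- a) (- b).
Proof.
move=> dU e e0; have [d d0 H] := dU e e0; exists d; first exact: d0.
move=> s t sd td; have := H s t sd td; move: (U (x + s) (y + t)) => u.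
have -> : - u - - U x y - - a * s - - b * t = - (u - U x y - a * s - b * t) by ring.
by rewrite normrN.
Qed.

(** * Holomorphic functions are weakly dbar-closed *)

Section WeaklyClosed.
Context {R : realType} {n : nat}.
Local Notation Cn := 'rV[C R]_n.
Local Notation lambda := (@lebesgue_Cn R n).
Local Notation re := (@complex.Re R).
Local Notation im := (@complex.Im R).
Local Notation normc := Normc.normc.
Implicit Types (z w : Cn) (F G : Cn -> R) (f phi : Cn -> C R).

Lemma axis0 j : axis j 0 0 = 0 :> Cn.
Proof. by rewrite /axis scale0r. Qed.

Lemma fdiffCD F G j z a b c d : fdiffC F j z a b -> fdiffC G j z c d ->
  fdiffC (fun z => F z + G z) j z (a + c) (b + d).
Proof. exact: fdiffD. Qed.

Lemma fdiffCM F G j z a b c d : fdiffC F j z a b -> fdiffC G j z c d ->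
  fdiffC (fun z => F z * G z) j z (a * G z + F z * c) (b * G z + F z * d).
Proof. by move=> dF dG; have := fdiffM dF dG; rewrite axis0 addr0. Qed.

Lemma fdiffCN F j z a b : fdiffC F j z a b -> fdiffC (fun z => - F z) j z (- a) (- b).
Proof. exact: fdiffN. Qed.

Lemma fdiffC_locally0 F j z : (\near z, F z = 0) -> fdiffC F j z 0 0.
Proof.
move=> /nbhs_nsqP[r r0 H] e e0.
exists (Num.min 1 (r / 2)); first by rewrite lt_min ltr01 divr_gt0.
move=> s t; rewrite !lt_min => /andP[s1 s2] /andP[t1 t2].
rewrite axis0 addr0 !add0r !H.
- by rewrite subrr !mul0r !subr0 normr0 mulr_ge0 ?addr_ge0// ltW.
- by rewrite subrr nsq0.
rewrite addrC addKr nsq_axis -[s ^+ 2]real_normK ?num_real// -[t ^+ 2]real_normK ?num_real//.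
by move: s1 s2 t1 t2 (normr_ge0 s) (normr_ge0 t); move: `|s| `|t| => a b *; nra.
Qed.

Lemma fdiffC_unique F j z a b c d : fdiffC F j z a b -> fdiffC F j z c d -> a = c /\ b = d.
Proof.
move=> /fdiffC_is_derive[d1 d2] /fdiffC_is_derive[d3 d4]; split.
  by have := @derive_val _ _ _ _ _ _ _ d1; rewrite (@derive_val _ _ _ _ _ _ _ d3).
by have := @derive_val _ _ _ _ _ _ _ d2; rewrite (@derive_val _ _ _ _ _ _ _ d4).
Qed.

(** Along the complex line in direction [j] the differential is multiplication by a complex number
    [l]; its real matrix gives the Cauchy-Riemann equations. *)
Lemma differentiable_fdiffC f j z : differentiable f z -> exists l : C R,
  fdiffC (Re_part f) j z (re l) (- im l) /\ fdiffC (Im_part f) j z (im l) (re l).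
Proof.
move=> df; pose v : Cn := delta_mx 0 j.
have fl : h^-1 *: ((f \o shift z) (h *: v) - f z) @[h --> 0^'] --> 'D_v f z.
  exact: (diff_derivable df).
move: ('D_v f z) fl => l fl; exists l.
have est (e : R) : 0 < e -> exists2 d : R, 0 < d & forall s t : R, `|s| < d -> `|t| < d ->
    normc (f (z + axis j s t) - f z - l * (s +i* t)%C) <= e * (`|s| + `|t|).
  move=> e0; have eC : 0 < (e%:C%C : C R) by rewrite ltcR.
  have /cvgrPdist_le/(_ _ eC)/nbhs_ballP[_ /gt0_C[d d0 ->] H] := fl.
  exists (d / 2); first by rewrite divr_gt0.
  move=> s t sd td; pose h : C R := (s +i* t)%C.
  have nh : normc h <= `|s| + `|t| by exact: normc_le_re_im.
  have [h0|h0] := eqVneq h 0.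
    have [-> ->] : s = 0 /\ t = 0 by split; [exact: (congr1 re h0)|exact: (congr1 im h0)].
    rewrite axis0 addr0 subrr sub0r mulr0 oppr0 Normc.normc0 mulr_ge0 ?addr_ge0//.
    exact: ltW.
  have := H h; rewrite -ball_normE /= sub0r normrN normCE ltcR => /(_ _ h0).
  have hd : normc h < d by apply: le_lt_trans nh _; lra.
  move=> /(_ hd); rewrite normCE lecR -/(axis j s t) => He.
  have -> : f (z + axis j s t) - f z - l * h = - (h * (l - h^-1 *: (f (axis j s t + z) - f z))).
    by rewrite mulrBr [h * (_ *: _)]mulrA mulfV// mul1r opprB [axis j s t + z]addrC [h * l]mulrC.
  rewrite normcN Normc.normcM mulrC; apply: ler_pM => //; exact: normc_ge0.
split=> e e0; have [d d0 H] := est e e0; exists d => // s t sd td;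
  apply: le_trans (H s t sd td); rewrite !add0r axis0 addr0.
  apply: le_trans (re_le_normc _).
  rewrite !reD !reN reM /= /Re_part; move: (re (f _)) (re (f _)) => p q.
  by rewrite le_eqVlt; apply/orP; left; apply/eqP; congr `|_|; ring.
apply: le_trans (im_le_normc _).
rewrite !imD !imN imM /= /Im_part; move: (im (f _)) (im (f _)) => p q.
by rewrite le_eqVlt; apply/orP; left; apply/eqP; congr `|_|; ring.
Qed.

Lemma near_eq_continuous F G z : (\near z, F z = G z) -> {for z, continuous F} ->
  {for z, continuous G}.
Proof.
move=> /nbhs_nsqP[r r0 H] /continuous_nsqP cF; apply/continuous_nsqP => e e0.
have [d d0 Hd] := cF e e0; exists (Num.min r d); first by rewrite lt_min r0.
move=> w; rewrite lt_min => /andP[wr wd].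
by rewrite -!H ?Hd// subrr nsq0.
Qed.

Variables (Om : set Cn) (f : Cn -> C R).
Hypotheses (oOm : open Om) (bOm : bounded_set Om) (hf : holomorphic Om f).

Lemma holomorphic_continuous z : Om z -> {for z, continuous f}.
Proof. by move=> /hf /differentiable_continuous. Qed.

Let continuousR z : Om z -> {for z, continuous (Re_part f)}.
Proof.
by move=> Omz; apply: continuous_comp; [exact: holomorphic_continuous|exact: continuous_re].
Qed.

Let continuousI z : Om z -> {for z, continuous (Im_part f)}.
Proof.
by move=> Omz; apply: continuous_comp; [exact: holomorphic_continuous|exact: continuous_im].
Qed.

Lemma compact_support_bounded (K : set Cn) F : compact K -> continuous F ->
  (forall z, ~ K z -> F z = 0) -> exists B, forall z, `|F z| <= B.
Proof.
move=> cK cF F0.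
have /compact_bounded[M [_ HM]] : compact (F @` K).
  by apply: continuous_compact => //; exact: continuous_subspaceT.
exists (`|M| + 1) => z; have [Kz|/F0 ->] := pselect (K z); last by rewrite normr0 addr_ge0.
by apply: HM; [rewrite (le_lt_trans (ler_norm _))// ltrDl|exists z].
Qed.

Lemma integral_Re_dbar_eq0 (K : set Cn) phi (j : 'I_n) :
  elementaryC phi -> compact K -> K `<=` Om -> (forall z, ~ K z -> phi z = 0) ->
  \int[lambda]_(z in Om) Re_part (fun z => f z * dbar j phi z) z = 0.
Proof.
move=> [sP sQ] cK KOm phi0.
set P := Re_part phi in sP *; set Q := Im_part phi in sQ *.
have [Px [Py [sPx sPy dP]]] := elementary_fdiff j sP.
have [Qx [Qy [sQx sQy dQ]]] := elementary_fdiff j sQ.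
pose A := Re_part f; pose B := Im_part f.
(* [g] is twice the real part of f dbar phi; it involves derivatives of [phi] only, whence its
   continuity. Below, [U] and [V] are Re (f phi) and - Im (f phi). *)
pose g z := A z * (Px z - Qy z) - B z * (Qx z + Py z).
pose U z := A z * P z - B z * Q z; pose V z := - (A z * Q z + B z * P z).
have gE z : Re_part (fun z => f z * dbar j phi z) z = 2^-1 * g z.
  by rewrite /Re_part (fdiffC_dbar (dP z) (dQ z)) reM /g /A /B /Re_part /Im_part /=; field.
have clK : closed K by apply: compact_closed => //; exact: norm_hausdorff.
have near0 z : ~ K z -> \forall w \near z, phi w = 0.
  move=> Kz; have : nbhs z (~` K) by apply: open_nbhs_nbhs; split => //; exact: closed_openC.
  by apply: filterS => w; exact: phi0.
have nearP z : ~ K z -> \near z, P z = 0.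
  by move=> /near0; apply: filterS => w w0; rewrite /P /Re_part w0.
have nearQ z : ~ K z -> \near z, Q z = 0.
  by move=> /near0; apply: filterS => w w0; rewrite /Q /Im_part w0.
have P0 z : ~ K z -> [/\ Px z = 0, Py z = 0, Qx z = 0 & Qy z = 0].
  move=> Kz; have [] := fdiffC_unique (dP z) (fdiffC_locally0 j (nearP z Kz)).
  by have [] := fdiffC_unique (dQ z) (fdiffC_locally0 j (nearQ z Kz)).
have g0 z : ~ K z -> g z = 0 by move=> /P0[Px0 Py0 Qx0 Qy0]; rewrite /g Px0 Py0 Qx0 Qy0; ring.
have dUV z : exists a b c d, [/\ fdiffC U j z a b, fdiffC V j z c d & g z = a + d].
  (* Off [K] the function [f] need not be differentiable, but [phi] vanishes in a neighbourhood and
     all the derivatives are 0. *)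
  have [Kz|Kz] := pselect (K z); last first.
    exists 0, 0, 0, 0; split; last by rewrite g0// addr0.
      apply: fdiffC_locally0; near=> w.
      rewrite /U; have -> : P w = 0 by near: w; exact: nearP.
      have -> : Q w = 0 by near: w; exact: nearQ.
      by ring.
    apply: fdiffC_locally0; near=> w.
    rewrite /V; have -> : P w = 0 by near: w; exact: nearP.
    have -> : Q w = 0 by near: w; exact: nearQ.
    by ring.
  have [l [dA dB]] := differentiable_fdiffC j (hf (KOm _ Kz)).
  do 4 eexists; split.
  - exact: (fdiffCD (fdiffCM dA (dP z)) (fdiffCN (fdiffCM dB (dQ z)))).
  - exact: (fdiffCN (fdiffCD (fdiffCM dA (dQ z)) (fdiffCM dB (dP z)))).
  - by rewrite /g -/A -/B; ring.
have cg : continuous g.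
  move=> z; have [Kz|Kz] := pselect (K z); last first.
    apply: (@near_eq_continuous (fun=> 0)); last exact: cst_continuous.
    have : nbhs z (~` K) by apply: open_nbhs_nbhs; split => //; exact: closed_openC.
    by apply: filterS => w Kw; rewrite g0.
  have cA := continuousR (KOm _ Kz); have cB := continuousI (KOm _ Kz).
  have e1 : continuous Px := elementary_continuous sPx.
  have e2 : continuous Py := elementary_continuous sPy.
  have e3 : continuous Qx := elementary_continuous sQx.
  have e4 : continuous Qy := elementary_continuous sQy.
  exact: (cvgB (cvgM cA (cvgB (e1 z) (e4 z))) (cvgM cB (cvgD (e3 z) (e2 z)))).
have [M [M0 OmM]] := bounded_setE bOm.
have [Bd gB] := compact_support_bounded cK cg g0.
have supp z : ~ Cn_box M z -> [/\ U z = 0, V z = 0 & g z = 0].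
  move=> Mz; have Kz : ~ K z by move=> /KOm/OmM.
  rewrite g0// /U /V /P /Q /Re_part /Im_part phi0//=.
  by split=> //; ring.
have D0 := divergence_Cn_eq0 M0 dUV cg gB supp.
rewrite (funext gE) Rintegral_mkcond (_ : _ \_ _ = fun z => 2^-1 * g z); last first.
  apply/funext => z; rewrite patchE; case: ifPn => // /negP; rewrite inE => Omz.
  by rewrite g0 ?mulr0// => /KOm.
rewrite RintegralZl ?D0 ?mulr0//.
apply: (@bounded_support_integrable _ _ _ _ (Cn_box M) _ Bd) => //.
- exact: measurable_Cn_box.
- exact: lebesgue_Cn_box.
- by apply: continuous_measurable_Cn => [|z _]; [exact: openT|exact: cg].
- by move=> z /supp[].
Unshelve. all: by end_near.
Qed.

End WeaklyClosed.

Lemma integral_dbar_eq0 (R : realType) (n : nat) (Om K : set 'rV[C R]_n)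
    (f phi : 'rV[C R]_n -> C R) (j : 'I_n) :
  open Om -> bounded_set Om -> holomorphic Om f ->
  elementaryC phi -> compact K -> K `<=` Om -> (forall z, ~ K z -> phi z = 0) ->
  Cintegral Om (fun z => f z * dbar j phi z) = 0.
Proof.
move=> oOm bOm hf sphi cK KOm phi0.
(* The imaginary part of the integral is the real part of the integral for [- 'i * f]. *)
have hif : holomorphic Om ((- 'i : C R) \*: f).
  by move=> z /hf df; exact: differentiableZ.
have E1 := integral_Re_dbar_eq0 bOm hf j sphi cK KOm phi0.
have E2 := integral_Re_dbar_eq0 bOm hif j sphi cK KOm phi0.
apply: eqC; first exact: E1.
rewrite /= -[RHS]E2; congr Rintegral; apply/funext => z.
rewrite /Re_part /Im_part -[(_ \*: _) z]/(- 'i * f z) -complexiE -mulrA reM reN imN /=.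
by rewrite oppr0 mul0r sub0r mulN1r opprK.
Qed.

(** * The mollifying kernel *)

Section Kernel.
Context {R : realType} {n : nat}.
Local Notation Cn := 'rV[C R]_n.
Local Notation re := (@complex.Re R).
Local Notation im := (@complex.Im R).
Implicit Types (z w v : Cn) (F G : Cn -> R) (f phi : Cn -> C R) (a : R).

Lemma compact_square (M : R) :
  compact [set x : C R | `|re x| <= M /\ `|im x| <= M].
Proof.
have -> : [set x : C R | `|re x| <= M /\ `|im x| <= M] =
    (fun p : R * R => (p.1 +i* p.2)%C : C R) @` (`[- M, M] `*` `[- M, M]).
  apply/seteqP; split=> [x [h1 h2]|_ [[x y] [h1 h2] <-]] /=.
    exists (re x, im x); last by case: (x).
    by rewrite /= !in_itv /= -!ler_norml.
  by move: h1 h2; rewrite /= !in_itv /= -!ler_norml.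
apply: continuous_compact; last by apply: compact_setX; exact: segment_compact.
apply: continuous_subspaceT => p.
apply/(@cvgrPdist_lt _ _ _ _ (nbhs_filter p)) => _ /gt0_C[e e0 ->].
have e2 : 0 < e / 2 by rewrite divr_gt0.
have c1 : {for p, continuous (fst : R * R -> R)} by exact: cvg_fst.
have c2 : {for p, continuous (snd : R * R -> R)} by exact: cvg_snd.
have h1 := (@cvgrPdist_lt _ _ _ _ (nbhs_filter p) _ _).1 c1 _ e2.
have h2 := (@cvgrPdist_lt _ _ _ _ (nbhs_filter p) _ _).1 c2 _ e2.
apply: filterS2 h1 h2 => q h1 h2.
rewrite normCE ltcR; apply: le_lt_trans (normc_le_re_im _) _.
by rewrite !raddfB /= [e]splitr ltrD.
Qed.

Lemma abs_le_sqr_dist (s t r : R) : (s - t) ^+ 2 <= r -> `|t| <= `|s| + (`|r| + 1).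
Proof.
move=> st; have st1 : `|s - t| <= `|r| + 1.
  rewrite -(@ler_pXn2r _ 2)// ?nnegrE ?addr_ge0// real_normK ?num_real//.
  by have := ler_norm r; have := normr_ge0 r; nra.
apply: le_trans (lerD (lexx _) st1).
by have := ler_normB s (s - t); rewrite opprB addrC subrK.
Qed.

Lemma compact_nsq_ball z (r : R) : compact [set w : Cn | nsq (z - w) <= r].
Proof.
pose M := \sum_j (`|re (z 0 j)| + `|im (z 0 j)|) + (`|r| + 1).
apply: (@subclosed_compact _ _ [set w : Cn | forall j,
    [set x : C R | `|re x| <= M /\ `|im x| <= M] (w 0 j)]).
- have -> : [set w : Cn | nsq (z - w) <= r] = (fun w => nsq (w - z)) @^-1` [set x | x <= r].
    by apply/seteqP; split => w /=; rewrite nsqC.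
  apply: closed_comp => [w _|]; last exact: closed_le.
  apply: (@continuous_comp _ _ _ (fun w : Cn => w - z) nsq); last exact: continuous_nsq.
  exact: (cvgB cvg_id (cvg_cst _)).
- have H := (@rV_compact (C R) n (fun=> [set x : C R | `|re x| <= M /\ `|im x| <= M])
    (fun=> @compact_square M)).
  exact H.
move=> w /= Hw j; have := nsq_coord (z - w) j => /le_trans/(_ Hw).
rewrite !mxE !raddfB /=; set x := re (z 0 j); set y := im (z 0 j) => h.
have zM : `|x| + `|y| <= \sum_j (`|re (z 0 j)| + `|im (z 0 j)|).
  by rewrite (bigD1 j)//= lerDl; apply: sumr_ge0 => i _; rewrite addr_ge0.
have hx : (x - re (w 0 j)) ^+ 2 <= r by apply: le_trans h; rewrite lerDl sqr_ge0.
have hy : (y - im (w 0 j)) ^+ 2 <= r by apply: le_trans h; rewrite lerDr sqr_ge0.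
by split; [apply: le_trans (abs_le_sqr_dist hx) _|apply: le_trans (abs_le_sqr_dist hy) _];
  rewrite lerD2r; apply: le_trans zM; rewrite (lerDl, lerDr).
Qed.

Lemma elementary_sum (I : Type) (s : seq I) (F : I -> Cn -> R) :
  (forall i, elementary (F i)) -> elementary (fun z => \sum_(i <- s) F i z).
Proof.
move=> sF; elim: s => [|i s IH].
  by under eq_fun do rewrite big_nil; exact: elementary_cst.
by under eq_fun do rewrite big_cons; exact: elementaryD.
Qed.

Definition dre z j w : R := re (z 0 j) - re (w 0 j).
Definition dim z j w : R := im (z 0 j) - im (w 0 j).

Lemma elementary_dre z j : elementary (dre z j).
Proof.
have -> : dre z j = fun w => re (z 0 j) + - 1 * re (w 0 j).
  by apply/funext => w; rewrite mulN1r.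
apply: elementaryD; first exact: elementary_cst.
by apply: elementaryM; [exact: elementary_cst|exact: elementary_re].
Qed.

Lemma elementary_dim z j : elementary (dim z j).
Proof.
have -> : dim z j = fun w => im (z 0 j) + - 1 * im (w 0 j).
  by apply/funext => w; rewrite mulN1r.
apply: elementaryD; first exact: elementary_cst.
by apply: elementaryM; [exact: elementary_cst|exact: elementary_im].
Qed.

Lemma nsqE z w : nsq (z - w) = \sum_j (dre z j w * dre z j w + dim z j w * dim z j w).
Proof. by apply: eq_bigr => j _; rewrite !mxE !raddfB /= !expr2. Qed.

Definition qker a z w : R := 1 - a * nsq (z - w).

Lemma elementary_qker a z : elementary (qker a z).
Proof.
have -> : qker a z = fun w => 1 + - a * (\sum_j (dre z j w * dre z j w + dim z j w * dim z j w)).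
  by apply/funext => w; rewrite /qker nsqE mulNr.
apply: elementaryD; first exact: elementary_cst.
apply: elementaryM; first exact: elementary_cst.
apply: elementary_sum => j; apply: elementaryD; apply: elementaryM;
  by [exact: elementary_dre|exact: elementary_dim].
Qed.

Lemma fdiffC_dre z j w : fdiffC (dre z j) j w (- 1) 0.
Proof.
move=> e e0; exists 1; first exact: ltr01.
move=> s t _ _; rewrite /dre (re_axisD w j j (0 + s) (0 + t)) (re_axisD w j j 0 0) eqxx mulr1n.
move: (re (z 0 j)) (re (w 0 j)) => x y.
rewrite [X in `|X|](_ : _ = 0); last by ring.
by rewrite normr0 mulr_ge0 ?addr_ge0// ltW.
Qed.

Lemma fdiffC_dim z j w : fdiffC (dim z j) j w 0 (- 1).
Proof.
move=> e e0; exists 1; first exact: ltr01.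
move=> s t _ _; rewrite /dim (im_axisD w j j (0 + s) (0 + t)) (im_axisD w j j 0 0) eqxx mulr1n.
move: (im (z 0 j)) (im (w 0 j)) => x y.
rewrite [X in `|X|](_ : _ = 0); last by ring.
by rewrite normr0 mulr_ge0 ?addr_ge0// ltW.
Qed.

Lemma nsq_axisB z w j s t : nsq (z - (w + axis j s t)) =
  nsq (z - w) - 2 * dre z j w * s - 2 * dim z j w * t + (s ^+ 2 + t ^+ 2).
Proof.
rewrite !nsqE (bigD1 j)//= [in RHS](bigD1 j)//= /dre /dim re_axisD im_axisD eqxx mulr1n.
rewrite (eq_bigr (fun i => (re (z 0 i) - re (w 0 i)) * (re (z 0 i) - re (w 0 i)) +
   (im (z 0 i) - im (w 0 i)) * (im (z 0 i) - im (w 0 i)))) => [|i /negbTE ij].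
  move: (\sum_(i < n | _) _) (re (z 0 j)) (re (w 0 j)) (im (z 0 j)) (im (w 0 j)).
  by move=> S x x' y y'; ring.
by rewrite re_axisD im_axisD ij !mul0r !addr0.
Qed.

Lemma fdiffC_qker a z w j : fdiffC (qker a z) j w (2 * a * dre z j w) (2 * a * dim z j w).
Proof.
move=> e e0; exists (e / (`|a| + 1)); first by rewrite divr_gt0// ltr_wpDl.
move=> s t; rewrite !ltr_pdivlMr ?ltr_wpDl// => se te; rewrite axis0 addr0 !add0r /qker nsq_axisB.
move: (nsq _) (dre _ _ _) (dim _ _ _) => N x y.
rewrite [X in `|X|](_ : _ = - a * (s ^+ 2 + t ^+ 2)); last by ring.
rewrite normrM normrN [X in _ * X]ger0_norm ?addr_ge0 ?sqr_ge0//.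
rewrite -[s ^+ 2]real_normK ?num_real// -[t ^+ 2]real_normK ?num_real//.
by move: (normr_ge0 s) (normr_ge0 t) (normr_ge0 a) se te; move: `|s| `|t| `|a| => p q r *; nra.
Qed.

(* The d/dbar w_j of test1 is the kernel in the dbar-derivative at z of moll h a,
   and sum_j d/dbar w_j of test2 is the kernel in its a-derivative, both up to a
   factor depending on a: weak closedness makes moll h a holomorphic and independent of a. *)
Definition test1 a z w : C R := (flat 0 (qker a z w))%:C%C.
Definition test2 a z j w : C R :=
  (dre z j w * flat 0 (qker a z w) +i* (- dim z j w * flat 0 (qker a z w)))%C.

Lemma elementary_test1 a z : elementaryC (test1 a z).
Proof.
by split; [exact: (elementary_flat 0 (elementary_qker a z))|exact: elementary_cst].
Qed.

Lemma elementary_test2 a z j : elementaryC (test2 a z j).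
Proof.
split.
  by apply: elementaryM; [exact: elementary_dre|exact: (elementary_flat 0 (elementary_qker a z))].
rewrite (_ : Im_part _ = fun w => - 1 * dim z j w * flat 0 (qker a z w)); last first.
  by apply/funext => w; rewrite mulN1r.
apply: elementaryM; last exact: (elementary_flat 0 (elementary_qker a z)).
by apply: elementaryM; [exact: elementary_cst|exact: elementary_dim].
Qed.

Lemma fdiffC_flat_qker a z w j : fdiffC (fun w => flat 0 (qker a z w)) j w
  (flat 2 (qker a z w) * (2 * a * dre z j w)) (flat 2 (qker a z w) * (2 * a * dim z j w)).
Proof.
by apply: fdiff_comp (fdiffC_qker a z w j); rewrite axis0 addr0; exact: is_derive_flat0.
Qed.

Lemma dbar_test1 a z w j : dbar j (test1 a z) w =
  (a * flat 2 (qker a z w))%:C%C * (dre z j w +i* dim z j w)%C.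
Proof.
have dR : fdiffC (Re_part (test1 a z)) j w _ _ := fdiffC_flat_qker a z w j.
have dI : fdiffC (Im_part (test1 a z)) j w 0 0 := fdiff_cst 0 0 0.
by rewrite (fdiffC_dbar dR dI); apply: eqC; rewrite ?reM ?imM /=; field.
Qed.

Lemma dbar_test2 a z w j : dbar j (test2 a z j) w =
  (- flat 0 (qker a z w) +
   a * flat 2 (qker a z w) * (dre z j w * dre z j w + dim z j w * dim z j w))%:C%C.
Proof.
have dE := fdiffC_flat_qker a z w j.
have dR : fdiffC (Re_part (test2 a z j)) j w _ _ := fdiffCM (fdiffC_dre z j w) dE.
have dI : fdiffC (Im_part (test2 a z j)) j w _ _ := fdiffCM (fdiffCN (fdiffC_dim z j w)) dE.
by rewrite (fdiffC_dbar dR dI); apply: eqC; rewrite /=; field.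
Qed.

Lemma qker_out a z w : 0 < a -> ~ (nsq (z - w) <= a^-1) -> qker a z w <= 0.
Proof.
move=> a0 /negP; rewrite -ltNge => h; rewrite /qker subr_le0.
by rewrite -ler_pdivrMl// mulr1 ltW.
Qed.

Lemma test1_out a z w : 0 < a -> ~ (nsq (z - w) <= a^-1) -> test1 a z w = 0.
Proof. by move=> a0 h; rewrite /test1 flat_le0// qker_out. Qed.

Lemma test2_out a z j w : 0 < a -> ~ (nsq (z - w) <= a^-1) -> test2 a z j w = 0.
Proof. by move=> a0 h; rewrite /test2 flat_le0 ?qker_out// !mulr0. Qed.

End Kernel.

(** * The kernel as a function of its scale *)

Section Mollifier.
Context {R : realType} {n : nat}.
Local Notation Cn := 'rV[C R]_n.
Local Notation lambda := (@lebesgue_Cn R n).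
Local Notation re := (@complex.Re R).
Local Notation im := (@complex.Im R).
Implicit Types (z w v : Cn) (a : R).

(* Not normalised: a constant mass would require the translation invariance of
   lebesgue_Cn, so the mollification of 1 is divided out instead. *)
Definition kern a z w : R := a ^+ n * flat 0 (qker a z w).

Definition dkern a z w : R :=
  n%:R * a ^+ n.-1 * flat 0 (qker a z w) - a ^+ n * nsq (z - w) * flat 2 (qker a z w).

Lemma is_derive_kern a z w : is_derive a (1 : R) (fun a => kern a z w) (dkern a z w).
Proof.
have d1 : is_derive a (1 : R) (fun a : R => a ^+ n) (n%:R * a ^+ n.-1).
  have -> : (fun a : R => a ^+ n) = (id : R -> R) ^+ n by apply/funext => x; rewrite exprfctE.
  by apply: (is_derive_eq (is_deriveX n (is_derive_id a (1 : R)))); rewrite [_ *: _]mulr1.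
have d2 : is_derive a (1 : R) (fun a => qker a z w) (- nsq (z - w)).
  apply/is_derive_epsP => e e0; exists 1; first exact: ltr01.
  move=> s _; rewrite /qker; move: (nsq (z - w)) => N.
  rewrite [X in `|X|](_ : _ = 0); last by ring.
  by rewrite normr0 mulr_ge0// ltW.
have d3 := @is_derive1_comp R (flat 0) _ a _ _ (is_derive_flat0 (qker a z w)) d2.
apply: (is_derive_eq (is_deriveM d1 d3)).
rewrite /dkern /= -[_ *: _]/(_ * _) -[X in _ + X]/(_ * _).
by move: (flat 0 _) (flat 2 _) (nsq _) (_ ^+ n) (_ ^+ n.-1) => A B c d e; ring.
Qed.

Lemma qker_le1 a z w : 0 <= a -> qker a z w <= 1.
Proof. by move=> a0; rewrite /qker lerBlDr lerDl mulr_ge0// nsq_ge0. Qed.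

Lemma kern_ge0 a z w : 0 <= a -> 0 <= kern a z w.
Proof. by move=> a0; rewrite mulr_ge0 ?exprn_ge0 ?flat_ge0. Qed.

Lemma kernC a z w : kern a z w = kern a w z.
Proof. by rewrite /kern /qker nsqC. Qed.

Lemma kern_out a z w : 0 < a -> ~ (nsq (z - w) <= a^-1) -> kern a z w = 0.
Proof. by move=> a0 h; rewrite /kern flat_le0 ?mulr0// qker_out. Qed.

Lemma continuous_flat_qker k a z : continuous (fun w => flat k (qker a z w)).
Proof. exact: (elementary_continuous (elementary_flat k (elementary_qker a z))). Qed.

Variable Om : set Cn.
Hypotheses (oOm : open Om) (bOm : bounded_set Om).

Let mOm : measurable Om := open_measurable_Cn oOm.

Lemma nsq_bounded z : exists2 S : R, 0 <= S & forall w, Om w -> nsq (z - w) <= S.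
Proof.
have [M [M0 H]] := bounded_setE bOm.
pose S := 2 * nsq z + 2 * \sum_(j < n) (M ^+ 2 + M ^+ 2).
have S0 : 0 <= S.
  rewrite addr_ge0 ?mulr_ge0 ?nsq_ge0//; apply: sumr_ge0 => j _.
  by rewrite addr_ge0// sqr_ge0.
exists S => // w /H Hw; apply: le_trans (nsqD _ _) _; rewrite nsqN lerD2l ler_wpM2l//.
apply: ler_sum => j _; have [h1 h2] := Hw j.
by rewrite -[re _ ^+ 2]real_normK ?num_real// -[im _ ^+ 2]real_normK ?num_real// lerD//;
  apply: lerXn2r => //; rewrite nnegrE.
Qed.

Lemma measurable_flat_qker k a z : measurable_fun Om (fun w => flat k (qker a z w)).
Proof.
by apply: continuous_measurable_Cn => // w _; exact: continuous_flat_qker.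
Qed.

Lemma measurable_kern a z : measurable_fun Om (kern a z).
Proof.
by apply: measurable_funM; [exact: measurable_cst|exact: measurable_flat_qker].
Qed.

Lemma kern_bound a : 0 <= a -> exists2 B : R, 0 <= B & forall z w, `|kern a z w| <= B.
Proof.
move=> a0; have [c c0 H] := @flat_bound R 0; exists (a ^+ n * c).
  by rewrite mulr_ge0// exprn_ge0.
by move=> z w; rewrite normrM ger0_norm ?exprn_ge0// ler_wpM2l ?exprn_ge0// H// qker_le1.
Qed.

(** Uniformity in [a] is the point: it dominates the derivative when differentiating under the
    integral. *)
Lemma dkern_bound z (b : R) : 0 <= b -> exists2 B : R, 0 <= B &
  forall a w, 0 <= a -> a <= b -> Om w -> `|dkern a z w| <= B.
Proof.
move=> b0; have [c c0 H] := @flat_bound R 0; have [c' c'0 H'] := @flat_bound R 2.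
have [S S0 HS] := nsq_bounded z.
exists (n%:R * b ^+ n.-1 * c + b ^+ n * S * c').
  by rewrite addr_ge0 ?mulr_ge0 ?exprn_ge0.
move=> a w a0 ab Omw; apply: le_trans (ler_normB _ _) _; apply: lerD.
  rewrite !normrM normr_nat [`|a ^+ _|]ger0_norm ?exprn_ge0//.
  apply: ler_pM; rewrite ?mulr_ge0 ?exprn_ge0 ?H ?qker_le1//.
  by rewrite ler_wpM2l//; apply: lerXn2r.
rewrite !normrM [`|a ^+ _|]ger0_norm ?exprn_ge0// [`|nsq _|]ger0_norm ?nsq_ge0//.
apply: ler_pM; rewrite ?mulr_ge0 ?exprn_ge0 ?nsq_ge0 ?H' ?qker_le1//.
by apply: ler_pM; rewrite ?exprn_ge0 ?nsq_ge0 ?HS//; apply: lerXn2r.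
Qed.

(** Differentiation under the integral, dominated on []a0, a + 1[] by a multiple of [|k|], shows
    that the derivative in [a] is 0 beyond [a0]; the mean value theorem concludes. *)
Lemma integral_kern_const (k : Cn -> R) z (a0 b c : R) : 0 < a0 ->
  lambda.-integrable Om (EFin \o k) ->
  (forall a, a0 < a -> \int[lambda]_(w in Om) (dkern a z w * k w) = 0) ->
  a0 < b -> a0 < c ->
  \int[lambda]_(w in Om) (kern b z w * k w) = \int[lambda]_(w in Om) (kern c z w * k w).
Proof.
move=> a00 ik D0.
pose F a := \int[lambda]_(w in Om) (kern a z w * k w).
have dF a : a0 < a -> is_derive a (1 : R) F 0.
  move=> a1; have a_gt0 : 0 < a by exact: lt_trans a1.
  have [Bd Bd0 HB] : exists2 B : R, 0 <= B &
      forall a' w, 0 <= a' -> a' <= a + 1 -> Om w -> `|dkern a' z w| <= B.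
    by apply: dkern_bound; lra.
  have aI : `]a0, (a + 1)[%classic a by rewrite /= in_itv /= a1 ltrDl ltr01.
  have intf x : `]a0, (a + 1)[%classic x ->
      lambda.-integrable Om (EFin \o (fun w => kern x z w * k w)).
    rewrite /= in_itv /= => /andP[x1 x2]; have [B B0 HB'] := kern_bound (ltW (lt_trans a00 x1)).
    by apply: (integrable_bounded_mul (B := B)) => //; exact: measurable_kern.
  have dkk x w : is_derive x (1 : R) (fun a => kern a z w * k w) (dkern x z w * k w).
    apply: (is_derive_eq (is_deriveM (is_derive_kern x z w) (is_derive_cst (k w) x (1 : R)))).
    by rewrite scaler0 add0r -[_ *: _]/(_ * _) mulrC.
  have par x w : partial1of2 (fun a w => kern a z w * k w) x w = dkern x z w * k w.
    by rewrite /partial1of2 derive1E; exact: (@derive_val _ _ _ _ _ _ _ (dkk x w)).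
  have G0 w : 0 <= Bd * `|k w| by rewrite mulr_ge0.
  have iG : lambda.-integrable Om (EFin \o (fun w => Bd * `|k w|)).
    exact: (integrableZl mOm Bd (integrable_abse ik)).
  have dom x w : `]a0, (a + 1)[%classic x -> Om w ->
      `|partial1of2 (fun a w => kern a z w * k w) x w| <= Bd * `|k w|.
    rewrite /= in_itv /= => /andP[x1 x2] Omw; rewrite par normrM ler_wpM2r//.
    by apply: HB => //; apply: ltW => //; exact: lt_trans x1.
  have dd x w : `]a0, (a + 1)[%classic x -> Om w -> derivable (fun a => kern a z w * k w) x 1.
    by move=> _ _; case: (dkk x w).
  have df := derivable_under_integral mOm aI intf dd G0 iG dom.
  have dv := differentiation_under_integral mOm aI intf dd G0 iG dom.
  apply: (is_derive_eq (derivableP df)); rewrite -derive1E.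
  rewrite [LHS]dv -[RHS](D0 a a1); apply: eq_Rintegral => w _; exact: par.
have main x y : a0 < x -> x <= y -> F x = F y.
  move=> x1 xy; have [||c' _ E] := @MVT_segment R F (fun=> 0) x y xy.
  - by move=> t; rewrite in_itv /= => /andP[xt _]; apply: dF; exact: lt_trans xt.
  - apply: derivable_within_continuous => t; rewrite in_itv /= => /andP[xt _].
    by have [] := dF t (lt_le_trans x1 xt).
  - by apply/eqP; rewrite eq_sym -subr_eq0 E mul0r.
move=> b1 c1; have [bc|cb] := leP b c; first exact: main.
by apply/esym/main => //; exact: ltW.
Qed.

End Mollifier.

Section QuadraticDifferentiable.
Context {R : realType} {n : nat}.
Local Notation Cn := 'rV[C R]_n.
Local Notation re := (@complex.Re R).
Local Notation im := (@complex.Im R).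
Local Notation normc := Normc.normc.
Implicit Types (z w v : Cn).

Definition l1norm v : R := \sum_j (`|re (v 0 j)| + `|im (v 0 j)|).

Lemma l1norm_ge0 v : 0 <= l1norm v.
Proof. by apply: sumr_ge0 => j _; rewrite addr_ge0. Qed.

Lemma nsq_le_l1norm v : nsq v <= l1norm v ^+ 2.
Proof.
rewrite expr2 {1}/l1norm mulr_suml; apply: ler_sum => j _.
have h : `|re (v 0 j)| + `|im (v 0 j)| <= l1norm v.
  rewrite /l1norm (bigD1 j)//= lerDl; apply: sumr_ge0 => i _; rewrite addr_ge0//.
rewrite -[re _ ^+ 2]real_normK ?num_real// -[im _ ^+ 2]real_normK ?num_real//.
by move: (normr_ge0 (re (v 0 j))) (normr_ge0 (im (v 0 j))) h; move: `|_| `|_| => p q *; nra.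
Qed.

Lemma norm_rowE v : `|v| = (re `|v|)%:C%C.
Proof.
have : 0 <= `|v| by rewrite normr_ge0.
by case: `|v| => x y; rewrite lecE /= => /andP[/eqP -> _].
Qed.

Lemma coord_le_norm v j : normc (v 0 j) <= re `|v|.
Proof.
apply/ler_addgt0Pr => e e0.
have : ball (0 : Cn) (re `|v| + e)%:C%C v.
  by rewrite -ball_normE /= sub0r normrN norm_rowE ltcR /= ltrDl.
by move=> [_ /(_ 0 j)]; rewrite -ball_normE /= mxE sub0r normrN normCE ltcR => /ltW.
Qed.

Lemma l1norm_le v : l1norm v <= n%:R * 2 * re `|v|.
Proof.
rewrite -[X in X%:R]card_ord -sum1_card natr_sum !mulr_suml; apply: ler_sum => j _.
rewrite mul1r mulr_natl mulr2n; apply: lerD; apply: le_trans (coord_le_norm v j).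
  exact: re_le_normc.
exact: im_le_normc.
Qed.

(** The differential is 0. Complex differentiability of a function is obtained from this after its
    complex linear part has been removed. *)
Lemma quadratic_differentiable (f : Cn -> C R) z (K : R) : 0 <= K ->
  (forall v, l1norm v <= 1 -> normc (f (z + v) - f z) <= K * l1norm v ^+ 2) ->
  differentiable f z.
Proof.
move=> K0 H; pose df : {linear Cn -> C R} := \0.
have E : f \o shift z = cst (f z) + df +o_ 0 id.
  apply/eqaddoP => _ /gt0_C[e e0 ->].
  pose N : R := n%:R * 2 + 1; have N0 : 0 < N by rewrite ltr_wpDl// mulr_ge0.
  (* [N] compares [l1norm] with the norm; the first bound then gives [l1norm v <= 1], the second
     makes the quadratic bound at most [e] times the norm of [v]. *)
  pose d : R := Num.min (N^-1) (e / (K + 1) / (N * N)).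
  have d0 : 0 < d by rewrite lt_min invr_gt0 N0 !divr_gt0 ?mulr_gt0// ltr_wpDl.
  have dC : 0 < (d%:C%C : C R) by rewrite ltcR.
  apply/nbhs_ballP; exists d%:C%C; first exact: dC.
  move=> v; rewrite -ball_normE /= sub0r normrN => hv.
  have m0 : 0 <= re `|v|.
    have : 0 <= `|v| by rewrite normr_ge0.
    by rewrite norm_rowE lecR.
  move: hv; rewrite norm_rowE ltcR => hv.
  have lN : l1norm v <= N * re `|v|.
    by apply: le_trans (l1norm_le v) _; rewrite ler_wpM2r// /N lerDl.
  move: hv; rewrite lt_min => /andP[h1 h2].
  have l1 : l1norm v <= 1.
    by apply: le_trans lN _; rewrite -ler_pdivlMl// mulr1 ltW.
  rewrite [X in `|X|](_ : _ = f (z + v) - f z); last first.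
    by rewrite /= !fctE addr0 [v + z]addrC.
  rewrite !normCE -/(re _) norm_rowE -rmorphM lecR /=.
  apply: le_trans (H v l1) _.
  have l0 := l1norm_ge0 v.
  rewrite ltr_pdivlMr ?mulr_gt0// ltr_pdivlMr ?ltr_wpDl// in h2.
  have q : l1norm v ^+ 2 <= N * re `|v| * (N * re `|v|).
    by rewrite expr2; apply: ler_pM.
  apply: le_trans (ler_wpM2l K0 q) _.
  by move: h2 m0; move: (re `|v|) => m; nra.
apply/diff_locallyP; have cdf : continuous df by exact: cst_continuous.
have D := diff_unique cdf E.
by rewrite D; split.
Qed.

Lemma differentiable_linear (L : 'I_n -> C R) z0 z :
  differentiable (fun w : Cn => \sum_j (w - z0) 0 j * L j) z.
Proof.
have -> : (fun w : Cn => \sum_j (w - z0) 0 j * L j) =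
    \sum_j (fun w : Cn => L j *: (w 0 j - z0 0 j)).
  apply/funext => w; rewrite fct_sumE; apply: eq_bigr => j _.
  by rewrite !mxE [RHS]mulrC.
apply: differentiable_sum => j; apply: differentiableZ; apply: differentiableB => //.
exact: differentiable_coord.
Qed.

End QuadraticDifferentiable.

(** * Mollifications of weakly closed functions *)

Section Moll.
Context {R : realType} {n : nat}.
Local Notation Cn := 'rV[C R]_n.
Local Notation lambda := (@lebesgue_Cn R n).
Local Notation re := (@complex.Re R).
Local Notation im := (@complex.Im R).
Local Notation normc := Normc.normc.
Implicit Types (z w v : Cn) (a : R).

Variable Om : set Cn.
Hypotheses (oOm : open Om) (bOm : bounded_set Om).
Let mOm : measurable Om := open_measurable_Cn oOm.

(** Testing against [elementaryC] functions is enough here: they include the kernels [test1] and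
    [test2], and they have explicit partial derivatives. *)
Definition weakly_closed (h : Cn -> C R) := forall j phi (K : set Cn),
  elementaryC phi -> compact K -> K `<=` Om -> (forall z, ~ K z -> phi z = 0) ->
  Cintegral Om (fun w => h w * dbar j phi w) = 0.

Definition moll (h : Cn -> C R) a z : C R :=
  Cintegral Om (fun w => (kern a z w)%:C%C * h w).

(** The closed ball outside which [kern a z] vanishes lies in [Om], so that [test1] and [test2] have
    compact support in [Om]. *)
Definition ball_in z a := forall w, nsq (z - w) <= a^-1 -> Om w.

Lemma ball_in_le z a b : 0 < a -> a <= b -> ball_in z a -> ball_in z b.
Proof.
move=> a0 ab H w Hw; apply: H; apply: le_trans Hw _.
by rewrite lef_pV2// posrE// (lt_le_trans a0).
Qed.

Lemma re_scale (r : R) (x : C R) : re (r%:C%C * x) = r * re x.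
Proof. by case: x => p q /=; rewrite mul0r subr0. Qed.

Lemma im_scale (r : R) (x : C R) : im (r%:C%C * x) = r * im x.
Proof. by case: x => p q /=; rewrite mul0r addr0. Qed.

Lemma Cintegrable_scale (F : Cn -> R) (h : Cn -> C R) (B : R) : Cintegrable Om h ->
  measurable_fun Om F -> (forall w, Om w -> `|F w| <= B) ->
  Cintegrable Om (fun w => (F w)%:C%C * h w).
Proof.
move=> [h1 h2] mF FB; split.
  rewrite (_ : Re_part _ = fun w => F w * Re_part h w); last first.
    by apply/funext => w; rewrite /Re_part re_scale.
  exact: (integrable_bounded_mul mOm mF FB h1).
rewrite (_ : Im_part _ = fun w => F w * Im_part h w); last first.
  by apply/funext => w; rewrite /Im_part im_scale.
exact: (integrable_bounded_mul mOm mF FB h2).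
Qed.

Lemma mollE h a z : moll h a z =
  ((\int[lambda]_(w in Om) (kern a z w * Re_part h w)) +i*
   (\int[lambda]_(w in Om) (kern a z w * Im_part h w)))%C.
Proof.
rewrite /moll /Cintegral; congr (_ +i* _)%C; apply: eq_Rintegral => w _.
  by rewrite /Re_part re_scale.
by rewrite /Im_part im_scale.
Qed.

Variable h : Cn -> C R.
Hypotheses (ih : Cintegrable Om h) (wh : weakly_closed h).

Lemma weakly_closed_test1 z a j : 0 < a -> ball_in z a ->
  Cintegral Om (fun w => h w * ((a * flat 2 (qker a z w))%:C%C * (dre z j w +i* dim z j w)%C)) = 0.
Proof.
move=> a0 zOm; rewrite -[RHS](wh j (elementary_test1 a z) (@compact_nsq_ball _ _ z a^-1)) //.
- by apply: eq_Cintegral => // w _; rewrite dbar_test1.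
- by move=> w Hw; exact: test1_out.
Qed.

Lemma weakly_closed_test2 z a j : 0 < a -> ball_in z a ->
  Cintegral Om (fun w => h w * (- flat 0 (qker a z w) +
   a * flat 2 (qker a z w) * (dre z j w * dre z j w + dim z j w * dim z j w))%:C%C) = 0.
Proof.
move=> a0 zOm; rewrite -[RHS](wh j (elementary_test2 a z j) (@compact_nsq_ball _ _ z a^-1)) //.
- by apply: eq_Cintegral => // w _; rewrite dbar_test2.
- by move=> w Hw; exact: test2_out.
Qed.

Lemma dre_bound z : exists2 T : R, 0 <= T &
  forall w j, Om w -> `|dre z j w| <= T /\ `|dim z j w| <= T.
Proof.
have [S S0 HS] := nsq_bounded bOm z; exists (S + 1); first by rewrite addr_ge0.
have sq (x y : R) : x ^+ 2 + y ^+ 2 <= S -> `|x| <= S + 1.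
  move=> xy; rewrite -(@ler_pXn2r _ 2)// ?nnegrE ?addr_ge0// real_normK ?num_real//.
  by have := sqr_ge0 x; have := sqr_ge0 y; nra.
move=> w j /HS Hw; have := le_trans (nsq_coord (z - w) j) Hw.
by rewrite !mxE !raddfB /= -/(dre z j w) -/(dim z j w) => Hj; split;
  [exact: sq Hj|apply: sq; rewrite addrC; exact: Hj].
Qed.

Lemma measurable_dre z j : measurable_fun Om (dre z j).
Proof.
apply: continuous_measurable_Cn => // w _.
exact: (elementary_continuous (elementary_dre z j)).
Qed.

Lemma measurable_dim z j : measurable_fun Om (dim z j).
Proof.
apply: continuous_measurable_Cn => // w _.
exact: (elementary_continuous (elementary_dim z j)).
Qed.

Lemma integral_dkern z a : 0 < a -> ball_in z a ->
  Cintegral Om (fun w => (dkern a z w)%:C%C * h w) = 0.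
Proof.
move=> a0 zOm.
pose G j w := - flat 0 (qker a z w) +
   a * flat 2 (qker a z w) * (dre z j w * dre z j w + dim z j w * dim z j w).
(* [G j] is the dbar-derivative of [test2] in direction [j]: the [n] terms [- flat 0] match the
   derivative of [a ^+ n], and the squares add up to [nsq (z - w)]. Because of [n.-1] the case
   [n = 0], where both sides vanish, is separate. *)
have GE w : dkern a z w = - a ^+ n.-1 * \sum_j G j w.
  rewrite /G big_split /= sumr_const card_ord -mulr_sumr -nsqE /dkern -[(- flat 0 _) *+ n]mulr_natr.
  case: (posnP n) => [n0|n0].
    have -> : nsq (z - w) = 0.
      by rewrite /nsq big1// => -[j jn]; exfalso; move: jn; rewrite [X in (_ < X)%N]n0.
    by move: (n%:R : R) => N; ring.
  have -> : a ^+ n = a * a ^+ n.-1 by rewrite -exprS prednK.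
  by move: (n%:R : R) (a ^+ n.-1) => N A; ring.
have iG j : Cintegrable Om (fun w => (G j w)%:C%C * h w).
  have [T T0 HT] := dre_bound z; have [c c0 Hc] := @flat_bound R 0.
  have [c' c'0 Hc'] := @flat_bound R 2.
  apply: (@Cintegrable_scale _ _ (c + a * c' * (T * T + T * T))) => //.
    apply: measurable_funD; first by apply: measurableT_comp => //; exact: measurable_flat_qker.
    apply: measurable_funM.
      by apply: measurable_funM => //; exact: measurable_flat_qker.
    by apply: measurable_funD; apply: measurable_funM;
      (exact: measurable_dre || exact: measurable_dim).
  move=> w Omw; have [h1 h2] := HT w j Omw; have q1 := qker_le1 z w (ltW a0).
  rewrite /G; apply: le_trans (ler_normD _ _) _; rewrite normrN; apply: lerD; first exact: Hc.
  rewrite !normrM [`|a|]gtr0_norm//; apply: ler_pM; rewrite ?mulr_ge0 ?(ltW a0)//.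
    by rewrite ler_pM2l// Hc'.
  by apply: le_trans (ler_normD _ _) _; rewrite !normrM; apply: lerD; exact: ler_pM.
have G0 j : Cintegral Om (fun w => (G j w)%:C%C * h w) = 0.
  by rewrite -[RHS](weakly_closed_test2 j a0 zOm); apply: eq_Cintegral => // w _; rewrite mulrC.
have [iS ES] := Cintegral_sum mOm (index_enum 'I_n) iG.
rewrite (eq_Cintegral (g := fun w => (- a ^+ n.-1)%:C%C * \sum_j (G j w)%:C%C * h w)).
  by rewrite CintegralZ// ES big1 ?mulr0// => j _; exact: G0.
by move=> w _; rewrite GE rmorphM -mulrA rmorph_sum mulr_suml.
Qed.

Lemma moll_const z (a0 b c : R) : 0 < a0 -> ball_in z a0 -> a0 < b -> a0 < c ->
  moll h b z = moll h c z.
Proof.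
move=> a00 zOm b1 c1; have [i1 i2] := ih.
have D0 a : a0 < a -> Cintegral Om (fun w => (dkern a z w)%:C%C * h w) = 0.
  move=> a1; apply: integral_dkern; first exact: lt_trans a1.
  exact: ball_in_le a00 (ltW a1) zOm.
have E1 : \int[lambda]_(w in Om) (kern b z w * Re_part h w) =
    \int[lambda]_(w in Om) (kern c z w * Re_part h w).
  apply: (integral_kern_const oOm bOm a00 i1 _ b1 c1) => a a1.
  rewrite -[RHS](congr1 re (D0 a a1)); apply: eq_Rintegral => w _.
  by rewrite /Re_part re_scale.
have E2 : \int[lambda]_(w in Om) (kern b z w * Im_part h w) =
    \int[lambda]_(w in Om) (kern c z w * Im_part h w).
  apply: (integral_kern_const oOm bOm a00 i2 _ b1 c1) => a a1.
  rewrite -[RHS](congr1 im (D0 a a1)); apply: eq_Rintegral => w _.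
  by rewrite /Im_part im_scale.
by rewrite !mollE; exact: (f_equal2 (@Complex R) E1 E2).
Qed.

Lemma nsqDE z v w : nsq (z + v - w) =
  nsq (z - w) + 2 * \sum_j (dre z j w * re (v 0 j) + dim z j w * im (v 0 j)) + nsq v.
Proof.
rewrite /nsq mulr_sumr -!big_split /=; apply: eq_bigr => j _.
rewrite !mxE !raddfB !raddfD /= /dre /dim.
by move: (re (z 0 j)) (re (v 0 j)) (re (w 0 j)) (im (z 0 j)) (im (v 0 j)) (im (w 0 j))
  => x x1 x2 y y1 y2; ring.
Qed.

(** First-order Taylor expansion of the kernel in [z], with a remainder uniform in [w], so that it
    can be integrated against [h]. *)
Lemma kern_taylor z a : 0 < a -> exists2 K : R, 0 <= K & forall v w, Om w -> l1norm v <= 1 ->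
  `|kern a (z + v) w - kern a z w + a ^+ n * (a * flat 2 (qker a z w)) *
     (2 * \sum_j (dre z j w * re (v 0 j) + dim z j w * im (v 0 j)))| <= K * l1norm v ^+ 2.
Proof.
move=> a0; have [M M0 HM] := @flat0_taylor R; have [c c0 Hc] := @flat_bound R 2.
have [T T0 HT] := dre_bound z.
(* [a * (2 * T + 1) * l1norm v] bounds the change of [qker], whose square enters the Taylor
   remainder of [flat 0]; [a * c] accounts for the term in [nsq v], which is not part of the linear
   form. *)
exists (a ^+ n * (M * (a ^+ 2 * (2 * T + 1) ^+ 2) + a * c)).
  apply: mulr_ge0; first exact: exprn_ge0 (ltW a0).
  by apply: addr_ge0; apply: mulr_ge0 => //; [apply: mulr_ge0; exact: sqr_ge0|exact: ltW].
move=> v w Omw v1; have l0 := l1norm_ge0 v.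
set P := \sum_j _.
have PT : `|P| <= T * l1norm v.
  apply: le_trans (ler_norm_sum _ _ _) _; rewrite mulr_sumr; apply: ler_sum => j _.
  have [h1 h2] := HT w j Omw; apply: le_trans (ler_normD _ _) _.
  by rewrite !normrM mulrDr; apply: lerD; exact: ler_wpM2r.
have qE : qker a (z + v) w - qker a z w = - a * (2 * P + nsq v).
  by rewrite /qker nsqDE -/P; ring.
have := HM _ _ (qker_le1 z w (ltW a0)) (qker_le1 (z + v) w (ltW a0)).
rewrite qE /kern; have Hf := Hc _ (qker_le1 z w (ltW a0)).
have nv0 := nsq_ge0 v; have nv := nsq_le_l1norm v.
move: (flat 0 (qker a (z + v) w)) (flat 0 (qker a z w)) (flat 2 (qker a z w)) Hf => f' f f2 Hf H1.
have an : 0 <= a ^+ n by rewrite exprn_ge0// ltW.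
rewrite [X in `|X| <= _](_ : _ =
  a ^+ n * ((f' - f - f2 * (- a * (2 * P + nsq v))) - a * f2 * nsq v)); last by ring.
rewrite normrM ger0_norm// -[leRHS]mulrA ler_wpM2l//.
apply: le_trans (ler_normB _ _) _; rewrite [leRHS]mulrDl; apply: lerD.
  apply: le_trans H1 _; rewrite -[leRHS]mulrA ler_wpM2l//.
  rewrite exprMn sqrrN -[leRHS]mulrA ler_wpM2l ?sqr_ge0//.
  rewrite -exprMn -[leLHS]real_normK ?num_real//; apply: lerXn2r;
    rewrite ?nnegrE ?mulr_ge0 ?addr_ge0 ?mulr_ge0//.
  apply: le_trans (ler_normD _ _) _.
  rewrite normrM normr_nat [leRHS]mulrDl -[2 * T * _]mulrA mul1r; apply: lerD.
    by rewrite ler_wpM2l.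
  by rewrite ger0_norm//; apply: le_trans nv _; rewrite expr2 ler_piMl.
rewrite !normrM (gtr0_norm a0) [`|nsq v|]ger0_norm// -!mulrA ler_wpM2l ?(ltW a0)//.
exact: ler_pM.
Qed.

Lemma normc_scaled_integral (F : Cn -> R) (B : R) : measurable_fun Om F ->
  (forall w, Om w -> `|F w| <= B) ->
  normc (Cintegral Om (fun w => (F w)%:C%C * h w)) <=
  B * (\int[lambda]_(w in Om) `|Re_part h w| + \int[lambda]_(w in Om) `|Im_part h w|).
Proof.
move=> mF FB; have [i1 i2] := ih; have [j1 j2] := Cintegrable_scale ih mF FB.
apply: le_trans (normc_le_re_im _) _; rewrite mulrDr /=.
have est (k g : Cn -> R) : lambda.-integrable Om (EFin \o k) -> lambda.-integrable Om (EFin \o g) ->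
    (forall w, Om w -> `|g w| <= B * `|k w|) ->
    `|\int[lambda]_(w in Om) g w| <= B * \int[lambda]_(w in Om) `|k w|.
  move=> ik ig gk; apply: le_trans (le_normr_Rintegral mOm ig) _.
  rewrite -RintegralZl//; last exact: (integrable_abse ik).
  apply: le_Rintegral => //; first exact: (integrable_abse ig).
  exact: (integrableZl mOm B (integrable_abse ik)).
apply: lerD; apply: est => // w Omw.
  by rewrite /Re_part re_scale normrM ler_wpM2r// FB.
by rewrite /Im_part im_scale normrM ler_wpM2r// FB.
Qed.

Lemma mul2C_reim (x p : C R) :
  x * (2%:R * p) = (2 * re x)%:C%C * p + (2 * im x)%:C%C * ('i * p).
Proof.
have -> : (2%:R : C R) = ((2 : R) +i* 0)%C by rewrite -[LHS](rmorph_nat (real_complex R)).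
by rewrite -complexiE; apply: eqC; rewrite ?reD ?imD ?reM ?imM /= ?reM ?imM /=; ring.
Qed.

(** Integrating the expansion of the kernel gives a real-linear part with coefficients [- 2 * P j]
    and [- 2 * Q j]. Testing against [test1] yields [P j + 'i * Q j = 0], the Cauchy-Riemann
    equation, which makes this part complex linear. *)
Lemma moll_differentiable z a : 0 < a -> ball_in z a -> differentiable (moll h a) z.
Proof.
move=> a0 zOm; pose D w := a ^+ n * (a * flat 2 (qker a z w)).
have [T T0 HT] := dre_bound z; have [c c0 Hc] := @flat_bound R 2.
have mD : measurable_fun Om D.
  by do 2 apply: measurable_funM => //; exact: measurable_flat_qker.
have an : 0 <= a ^+ n by rewrite exprn_ge0// ltW.
have DB w : `|D w| <= a ^+ n * (a * c).
  rewrite !normrM (ger0_norm an) (gtr0_norm a0) ler_wpM2l// ler_pM2l//.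
  by apply: Hc; exact: qker_le1 (ltW a0).
have iD (F : Cn -> R) : measurable_fun Om F -> (forall w, Om w -> `|F w| <= T) ->
    Cintegrable Om (fun w => (D w * F w)%:C%C * h w).
  move=> mF FT; apply: (@Cintegrable_scale _ _ (a ^+ n * (a * c) * T)) => //.
    exact: measurable_funM.
  by move=> w Omw; rewrite normrM; apply: ler_pM => //; exact: FT.
have iP j := iD _ (measurable_dre z j) (fun w Omw => (HT w j Omw).1).
have iQ j := iD _ (measurable_dim z j) (fun w Omw => (HT w j Omw).2).
pose P j := Cintegral Om (fun w => (D w * dre z j w)%:C%C * h w).
pose Q j := Cintegral Om (fun w => (D w * dim z j w)%:C%C * h w).
have PQ j : P j + 'i * Q j = 0.
  rewrite /P /Q -CintegralZ// -CintegralD//; last exact: CintegrableZ.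
  rewrite (eq_Cintegral (g := fun w => (a ^+ n)%:C%C * (h w *
    ((a * flat 2 (qker a z w))%:C%C * (dre z j w +i* dim z j w)%C)))).
    have i1 : Cintegrable Om (fun w => h w *
        ((a * flat 2 (qker a z w))%:C%C * (dre z j w +i* dim z j w)%C)).
      have := CintegrableD mOm (CintegrableZ mOm (((a ^+ n)^-1)%:C%C) (iP j))
        (CintegrableZ mOm ('i * ((a ^+ n)^-1)%:C%C) (iQ j)).
      apply: eq_Cintegrable => // w _.
      have an0 : a ^+ n != 0 by rewrite expf_neq0// gt_eqF.
      rewrite -complexiE /D; apply: eqC; rewrite /= ?reD ?imD ?reM ?imM /= ?reM ?imM /=;
        move: (flat 2 _) (dre z j w) (dim z j w) (re (h w)) (im (h w)) => f2 x y p q; by field.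
    by rewrite CintegralZ// weakly_closed_test1// mulr0.
  move=> w _; rewrite -complexiE /D; apply: eqC; rewrite ?reD ?imD ?reM ?imM /= ?reM ?imM /=;
    move: (flat 2 _) (dre z j w) (dim z j w) (re (h w)) (im (h w)) => f2 x y p q; ring.
have QE j : Q j = 'i * P j.
  have -> : P j = - ('i * Q j) by apply/eqP; rewrite -addr_eq0; apply/eqP; exact: PQ.
  by rewrite mulrN mulrA -expr2 sqrCi mulN1r opprK.
have iker u : Cintegrable Om (fun w => (kern a u w)%:C%C * h w).
  have [B B0 HB] := @kern_bound R n a (ltW a0).
  by apply: (Cintegrable_scale ih (measurable_kern oOm a u)) => w _; exact: HB.
have [K K0 HK] := kern_taylor z a0.
pose rho v w := kern a (z + v) w - kern a z w + D w *
     (2 * \sum_j (dre z j w * re (v 0 j) + dim z j w * im (v 0 j))).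
pose L v : C R := \sum_j v 0 j * (2%:R * P j).
(* Adding [L] cancels the linear part, whose coefficients carry a minus sign, and leaves a quadratic
   remainder. *)
pose f z' := moll h a z' + L (z' - z).
have L0 : L 0 = 0 by rewrite /L big1// => j _; rewrite mxE mul0r.
have fz : f z = moll h a z by rewrite /f subrr L0 addr0.
have fzv v : f (z + v) = moll h a (z + v) + L v.
  by rewrite /f; congr (_ + L _); rewrite addrAC subrr add0r.
have fE v : f (z + v) - f z = Cintegral Om (fun w => (rho v w)%:C%C * h w).
  have rhoE w : (rho v w)%:C%C * h w =
      ((kern a (z + v) w)%:C%C * h w + - 1 * ((kern a z w)%:C%C * h w)) +
      \sum_j ((2 * re (v 0 j))%:C%C * ((D w * dre z j w)%:C%C * h w) +
              (2 * im (v 0 j))%:C%C * ((D w * dim z j w)%:C%C * h w)).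
    have -> : \sum_j ((2 * re (v 0 j))%:C%C * ((D w * dre z j w)%:C%C * h w) +
        (2 * im (v 0 j))%:C%C * ((D w * dim z j w)%:C%C * h w)) =
        (D w * (2 * \sum_j (dre z j w * re (v 0 j) + dim z j w * im (v 0 j))))%:C%C * h w.
      rewrite !mulr_sumr rmorph_sum mulr_suml; apply: eq_bigr => j _.
      rewrite !mulrA -!rmorphM -mulrDl -rmorphD; congr (_%:C%C * _).
      by move: (D w) (dre z j w) (dim z j w) (re (v 0 j)) (im (v 0 j)) => d x y p q; ring.
    by rewrite /rho rmorphD rmorphB mulrDl mulrBl mulN1r.
  have iS j : Cintegrable Om (fun w => (2 * re (v 0 j))%:C%C * ((D w * dre z j w)%:C%C * h w) +
              (2 * im (v 0 j))%:C%C * ((D w * dim z j w)%:C%C * h w)).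
    exact: (CintegrableD mOm (CintegrableZ mOm _ (iP j)) (CintegrableZ mOm _ (iQ j))).
  have [iSS ES] := Cintegral_sum mOm (index_enum 'I_n) iS.
  rewrite (eq_Cintegral (fun w _ => rhoE w)).
  rewrite (CintegralD mOm (CintegrableD mOm (iker (z + v)) (CintegrableZ mOm (- 1) (iker z))) iSS).
  rewrite (CintegralD mOm (iker (z + v)) (CintegrableZ mOm (- 1) (iker z))) ES.
  rewrite (CintegralZ mOm _ (iker z)) mulN1r fz fzv addrAC.
  congr (_ + _); apply: eq_bigr => j _.
  rewrite (CintegralD mOm (CintegrableZ mOm _ (iP j)) (CintegrableZ mOm _ (iQ j))).
  rewrite (CintegralZ mOm _ (iP j)) (CintegralZ mOm _ (iQ j)) -/(P j) -/(Q j) QE.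
  exact: mul2C_reim.
have df : differentiable f z.
  pose B := \int[lambda]_(w in Om) `|Re_part h w| + \int[lambda]_(w in Om) `|Im_part h w|.
  have B0 : 0 <= B by rewrite addr_ge0// Rintegral_ge0.
  apply: (@quadratic_differentiable _ _ f z (K * B)); first exact: mulr_ge0.
  move=> v v1; rewrite fE mulrAC; apply: normc_scaled_integral => [|w Omw]; last exact: HK.
  apply: measurable_funD.
    by apply: measurable_funB; exact: measurable_kern.
  apply: measurable_funM => //; apply: measurable_funM => //.
  apply: measurable_sum => j; apply: measurable_funD; apply: measurable_funM => //.
    exact: measurable_dre.
  exact: measurable_dim.
have -> : moll h a = f - (fun w => L (w - z)).
  by apply/funext => w; exact: (esym (addrK (L (w - z)) (moll h a w))).
by apply: differentiableB df _; exact: differentiable_linear.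
Qed.

End Moll.

(** * Weyl's lemma *)

Lemma power_measure_boxes d (T : measurableType d) (R : realType)
    (m : {sigma_finite_measure set T -> \bar R}) n (Q : 'I_n -> set T) :
  (forall j, measurable (Q j)) -> (forall j, 0 < m (Q j))%E ->
  measurable [set t : n.-tuple T | forall j, Q j (tnth t j)] /\
  (0 < power_measure m n [set t : n.-tuple T | forall j, Q j (tnth t j)])%E.
Proof.
move=> mQ Q0; have mB k (P : 'I_k -> set T) : (forall j, measurable (P j)) ->
    measurable [set t : k.-tuple T | forall j, P j (tnth t j)].
  move=> mP; have -> : [set t : k.-tuple T | forall j, P j (tnth t j)] =
      \bigcap_(j in setT) ((@tnth k T)^~ j @^-1` (P j)).
    by apply/seteqP; split => t /= H j => [_|]; exact: H.
  apply: fin_bigcap_measurable => // j _; rewrite -[X in measurable X]setTI.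
  exact: measurable_tnth.
split; first exact: mB.
elim: n => [|n IH] in Q mQ Q0 *.
  by rewrite /= diracE mem_set//; case.
have {}IH := IH (fun j => Q (lift ord0 j)) (fun j => mQ _) (fun j => Q0 _).
rewrite -[X in (_ < X)%E]/(power_step m (power_measure m n) _).
rewrite /power_step /pushforward.
rewrite [X in product_measure1 _ _ X](_ : _ =
    Q ord0 `*` [set t : n.-tuple T | forall j, Q (lift ord0 j) (tnth t j)]).
  rewrite [X in (_ < X)%E](_ : _ = m (Q ord0) *
      power_measure m n [set t : n.-tuple T | forall j, Q (lift ord0 j) (tnth t j)])%E.
    exact: mule_gt0.
  by apply: product_measure1E => //; exact: (mB n (fun j => Q (lift ord0 j)) (fun j => mQ _)).
apply/seteqP; split=> -[x t] /= H.
  split=> [|j]; first by have := H ord0; rewrite tnth0.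
  by have := H (lift ord0 j); rewrite tnthS.
move=> j; case: H => Qx Qt.
by case: (unliftP ord0 j) => [k|] ->; rewrite ?tnthS ?tnth0//; exact: Qt.
Qed.

(** * Positive measure of balls, and vanishing almost everywhere by continuous tests *)

Section AeZero.
Context {R : realType} {n : nat}.
Local Notation Cn := 'rV[C R]_n.
Local Notation lambda := (@lebesgue_Cn R n).
Local Notation re := (@complex.Re R).
Local Notation im := (@complex.Im R).
Implicit Types (z w v : Cn) (F b : Cn -> R).

Definition nsq_ball z (r : R) : set Cn := [set w | nsq (z - w) < r].

Definition pos_set F : set Cn := [set w | 0 < F w].

Lemma lebesgue_nsq_ball_gt0 z (r : R) : 0 < r -> (0 < lambda (nsq_ball z r))%E.
Proof.
move=> r0; pose e : R := Num.min 1 (r / (2 * n.+1%:R)).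
have e0 : 0 < e by rewrite lt_min ltr01 divr_gt0// mulr_gt0.
pose I (x : R) : set (measurableTypeR R) := [set` `](x - e), (x + e)[%R].
pose Q (j : 'I_n) := I (re (z 0 j)) `*` I (im (z 0 j)).
have I0 x : (0 < lebesgue_measure (I x))%E.
  rewrite lebesgue_measure_itv /= lte_fin ifT; last by lra.
  by rewrite -EFinB lte_fin; lra.
have mI x : measurable (I x) by exact: measurable_itv.
have mQ j : measurable (Q j) by apply: measurableX.
have Q0 j : (0 < @lebesgue_R2 R (Q j))%E.
  rewrite /Q; move: (re (z 0 j)) (im (z 0 j)) => x y.
  rewrite [X in (_ < X)%E](_ : _ = lebesgue_measure (I x) * lebesgue_measure (I y))%E.
    exact: mule_gt0.
  exact: product_measure1E.
have [mB B0] := power_measure_boxes (m := @lebesgue_R2 R) mQ Q0.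
apply: lt_le_trans B0 _; rewrite /lebesgue_Cn /pushforward.
have mo := @measurable_of_reals R n.
apply: le_measure; rewrite ?inE//.
  rewrite -[X in measurable X]setTI; apply: mo => //.
  rewrite (_ : nsq_ball z r = setT `&` (fun w => nsq (w - z)) @^-1` `]-oo, r[).
    exact: measurable_nsqB.
  by rewrite setTI; apply/seteqP; split => w /=; rewrite in_itv /= nsqC.
move=> t /= Qt; have : nsq (z - of_reals t) <= n%:R * (2 * e).
  rewrite -[X in X%:R]card_ord -sum1_card natr_sum mulr_suml; apply: ler_sum => j _.
  have [] := Qt j; rewrite /I /= !in_itv /= !mxE !raddfB /= mul1r.
  have e1 : e <= 1 by rewrite /e ge_min lexx.
  move: (re (z 0 j)) (im (z 0 j)) (tnth t j) => x y [x' y'] /= /andP[h1 h2] /andP[h3 h4].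
  have : (x - x') ^+ 2 <= e by nra.
  have : (y - y') ^+ 2 <= e by nra.
  lra.
move=> /le_lt_trans; apply.
have : e <= r / (2 * n.+1%:R) by rewrite /e ge_min lexx orbT.
rewrite ler_pdivlMr ?mulr_gt0// => h; apply: lt_le_trans h.
by rewrite mulrA [e * _]mulrC ltr_pM2r// mulrC ltr_pM2l// ltr_nat.
Qed.

Let G : set (set Cn) := [set A | exists2 F : Cn -> R, continuous F & A = pos_set F].

(* A generating pi-system adapted to integration against continuous functions. *)
Lemma measurable_continuous_supports : @measurable _ Cn = <<s G >>.
Proof.
apply/seteqP; split; last first.
  apply: smallest_sub; first exact: sigma_algebra_measurable.
  move=> _ [F cF ->]; rewrite (_ : pos_set F = setT `&` F @^-1` `]0, +oo[).
    by apply: (continuous_measurable_Cn openT (fun z _ => cF z)).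
  by rewrite setTI; apply/seteqP; split => w /=; rewrite in_itv /= andbT.
have mc (c : g_sigma_algebraType G -> R) : continuous (c : Cn -> R) -> measurable_fun setT c.
  move=> cc; apply: (measurability _ (RGenOInfty.measurableE R)) => _ [_ [x ->] <-].
  apply: sub_sigma_algebra; rewrite setTI; exists (fun w => c w - x).
    by move=> w; exact: (cvgB (cc w) (cvg_cst _)).
  by apply/seteqP; split => w; rewrite /pos_set /= in_itv /= andbT subr_gt0.
have mt : measurable_fun setT (@to_reals R n : g_sigma_algebraType G -> _).
  apply/measurable_fun_tnthP => j.
  rewrite (_ : _ \o _ = fun w : g_sigma_algebraType G =>
    (re ((w : Cn) 0 j), im ((w : Cn) 0 j))); last by apply/funext => w /=; rewrite tnth_mktuple.
  apply: measurable_fun_pair; apply: mc => w.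
    by apply: continuous_comp; [exact: continuous_coord|exact: continuous_re].
  by apply: continuous_comp; [exact: continuous_coord|exact: continuous_im].
by move=> _ [B mB <-]; rewrite setTI -[X in <<s G >> X]setTI; exact: mt.
Qed.

(** Continuous tests approximate the indicators of the sets [pos_set F]; these form a generating
    pi-system, so Dynkin's theorem gives integral 0 over every measurable part of [pos_set b]. *)
Lemma integral_continuous_eq0_ae (b k : Cn -> R) : continuous b ->
  lambda.-integrable (pos_set b) (EFin \o k) ->
  (forall psi : Cn -> R, continuous psi -> (forall w, 0 <= psi w <= 1) ->
     (forall w, ~ 0 < b w -> psi w = 0) ->
     (\int[lambda]_(w in pos_set b) (psi w * k w)%:E = 0)%E) ->
  {ae lambda, forall w, 0 < b w -> k w = 0}.
Proof.
move=> cb; set W := pos_set b => ik H.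
have mG F : continuous F -> measurable (pos_set F).
  by move=> cF; rewrite measurable_continuous_supports; apply: sub_sigma_algebra; exists F.
have mW : measurable W := mG b cb.
have mk : measurable_fun W k by apply/measurable_EFinP; exact: measurable_int ik.
have mke : measurable_fun W (EFin \o k) by apply/measurable_EFinP.
pose P (A : set Cn) := (\int[lambda]_(w in W `&` A) (k w)%:E = 0)%E.
have P0 F : continuous F -> P (pos_set F).
  (* [m] is positive exactly where both [F] and [b] are, so [psi i], the minimum of 1 and [i * m],
     is an allowed test and increases to the indicator of that set. *)
  move=> cF; pose m w : R := Num.max 0 (Num.min (F w) (b w)).
  have cm w : {for w, continuous m}.
    exact: (continuous_max (@cst_continuous _ _ 0 w) (continuous_min (cF w) (cb w))).
  pose psi (i : nat) w : R := Num.min 1 (i%:R * m w).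
  have cpsi i : continuous (psi i).
    move=> w; have c : {for w, continuous (fun w => i%:R * m w)}.
      exact: (continuousM (@cst_continuous _ _ (i%:R : R) w) (cm w)).
    exact: (continuous_min (@cst_continuous _ _ (1 : R) w) c).
  have m0 w : 0 <= m w by rewrite le_max lexx.
  have psi01 i w : 0 <= psi i w <= 1.
    by rewrite /psi le_min ler01 mulr_ge0 ?ge_min ?lexx//=.
  have psi0 i w : m w = 0 -> psi i w = 0.
    by rewrite /psi => ->; rewrite mulr0 min_r.
  have mb0 w : ~ 0 < b w -> m w = 0.
    by move=> /negP; rewrite -leNgt => bw; rewrite /m max_l// ge_min bw orbT.
  rewrite /P integral_mkcondr.
  have mpsi i : measurable_fun W (psi i).
    by apply: measurable_funTS; apply: (continuous_measurable_Cn openT (fun z _ => cpsi i z)).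
  have mf : measurable_fun W ((EFin \o k) \_ (pos_set F)).
    apply/(measurable_restrict _ (mG F cF) mW).
    by apply: measurable_funS mke => // w [].
  have psi1 w : W w -> pos_set F w -> \forall i \near \oo, psi i w = 1.
    move=> Ww Fw; have m1 : 0 < m w by rewrite lt_max lt_min Fw Ww orbT.
    near=> i; rewrite /psi min_l// -ler_pdivrMr// ltW//.
    by near: i; exact: nbhs_infty_gtr.
  have psiE w : W w -> (psi i w * k w)%:E @[i --> \oo] --> ((EFin \o k) \_ (pos_set F)) w.
    move=> Ww; apply: cvg_near_cst; rewrite patchE; case: ifPn => [|].
      rewrite inE => Fw; have := psi1 w Ww Fw; apply: filterS => i ->.
      by rewrite mul1r.
    rewrite notin_setE => /negP; rewrite -leNgt => Fw; near=> i; rewrite psi0 ?mul0r//.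
    by rewrite /m max_l// ge_min Fw.
  have psik w i : W w -> (`|(psi i w * k w)%:E| <= `|(EFin \o k) w|)%E.
    move=> _ /=; have /andP[p0 p1] := psi01 i w.
    by rewrite lee_fin normrM ger0_norm// ler_piMl.
  have [_ _] := @dominated_convergence _ _ _ lambda W mW (fun i w => (psi i w * k w)%:E)
    ((EFin \o k) \_ (pos_set F)) (fun w => `|(EFin \o k) w|%E)
    (fun i => iffRL (measurable_EFinP _ _) (measurable_funM (mpsi i) mk)) mf
    (aeW _ psiE) (integrable_abse ik)
    (aeW _ (fun w i => psik w i)).
  rewrite (_ : [sequence _]_i = cst 0%E); last first.
    by apply/funext => i; apply: H => //= w bw; apply/psi0/mb0.
  by move=> h; apply: (cvg_unique _ h (cvg_cst _)).
have PI A B : measurable A -> measurable B -> A `&` B = set0 -> P (A `|` B) -> P A -> P B.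
  move=> mA mB AB0; rewrite /P setIUr integral_setU//.
  - by move=> h hA; rewrite -h -[LHS]add0e; congr (_ + _)%E.
  - exact: measurableI.
  - exact: measurableI.
  - by apply: measurable_funS mke => // w [] [].
  - by apply/disj_set2P; rewrite setIACA AB0 setI0.
have PW A : measurable A -> P A.
  move=> mA; have := mA; rewrite measurable_continuous_supports.
  apply: (dynkin_induction measurable_continuous_supports).
  - move=> _ _ [F1 c1 ->] [F2 c2 ->]; exists (fun w => Num.min (F1 w) (F2 w)).
      by move=> w; exact: (continuous_min (c1 w) (c2 w)).
    by apply/seteqP; split => w; rewrite /pos_set /= lt_min => /andP.
  - rewrite (_ : setT = pos_set (cst 1)); first by apply: P0; exact: cst_continuous.
    by apply/seteqP; split => w //= _; rewrite /pos_set /=.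
  - by move=> _ [F cF ->]; exact: P0.
  - move=> S mS PS; apply: (PI S) => //; first exact: measurableC.
      by rewrite setICr.
    rewrite setUCr (_ : setT = pos_set (cst 1)); first by apply: P0; exact: cst_continuous.
    by apply/seteqP; split => w //= _; rewrite /pos_set /=.
  - move=> F mF tF PF; rewrite /P setI_bigcupr integral_bigcup//.
    + by apply: eseries0 => i _ _; exact: PF.
    + exact: trivIset_setIl.
    + by move=> i; exact: measurableI.
    + rewrite -setI_bigcupr; apply: integrableS ik => //.
      by apply: measurableI => //; exact: bigcup_measurable.
have : ae_eq lambda W (EFin \o k) (cst 0%E).
  apply: integral_ae_eq => // E EW mE.
  by rewrite integral_cst// mul0e -(setIidr EW); exact: PW.
by apply: filterS => w h bw; have /= := h bw; case.
Unshelve. all: by end_near. Qed.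

End AeZero.

(** * Fubini's theorem for a bounded kernel *)

Section FubiniKernel.
Context d (T : measurableType d) (R : realType).
Implicit Types (f g : T -> R) (D : set T).

Variables (mu : {sigma_finite_measure set T -> \bar R}) (K : T -> T -> R) (B : R).
Hypothesis mK : measurable_fun setT (fun p : T * T => K p.1 p.2).
Hypothesis KB : forall x y, `|K x y| <= B.

Let Fubini_kernelT f g : mu.-integrable setT (EFin \o f) -> mu.-integrable setT (EFin \o g) ->
  mu.-integrable setT (EFin \o (fun x => f x * \int[mu]_y (K x y * g y))) /\
  \int[mu]_x (f x * \int[mu]_y (K x y * g y)) =
  \int[mu]_y (g y * \int[mu]_x (K x y * f x)).
Proof.
move=> iff ig; pose F (p : T * T) : \bar R := (f p.1 * (K p.1 p.2 * g p.2))%:E.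
have iK1 x : mu.-integrable setT (EFin \o (fun y => K x y * g y)).
  by apply: (integrable_bounded_mul (B := B)) => //; exact: (measurable_fun_pair2 x mK).
have iK2 y : mu.-integrable setT (EFin \o (fun x => K x y * f x)).
  by apply: (integrable_bounded_mul (B := B)) => //; exact: (measurable_fun_pair1 y mK).
have mf := (measurable_EFinP _ _).1 (measurable_int _ iff).
have mg := (measurable_EFinP _ _).1 (measurable_int _ ig).
have mF : measurable_fun setT F.
  apply/measurable_EFinP; apply: measurable_funM; first exact: measurableT_comp.
  by apply: measurable_funM => //; exact: measurableT_comp.
have F1 x : (\int[mu]_y F (x, y))%E = (f x * \int[mu]_y (K x y * g y))%:E.
  rewrite -RintegralZl// /Rintegral fineK//.
  exact: (integrable_fin_num measurableT (integrableZl measurableT (f x) (iK1 x))).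
have F2 y : (\int[mu]_x F (x, y))%E = (g y * \int[mu]_x (K x y * f x))%:E.
  rewrite -RintegralZl// /Rintegral fineK//.
    by apply: eq_integral => x _; rewrite /F /=; congr (_%:E); ring.
  exact: (integrable_fin_num measurableT (integrableZl measurableT (g y) (iK2 y))).
have iF : (product_measure1 mu mu).-integrable setT F.
  apply/integrable12ltyP => //.
  have iB := integrableZl measurableT B (integrable_abse ig).
  have iff' := integrable_abse iff.
  pose c := \int[mu]_y (B * `|g y|).
  have Ec : (\int[mu]_y (B * `|g y|)%:E = c%:E)%E.
    by rewrite /c /Rintegral fineK//; exact: (integrable_fin_num measurableT iB).
  have := integrableZl measurableT c (iff').
  move=> /integrableP[_]; apply: le_lt_trans.
  apply: ge0_le_integral => //.
  - by move=> x _; apply: integral_ge0.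
  - have mF' : measurable_fun setT (abse \o F) by exact: measurableT_comp.
    exact: (measurable_fun_fubini_tonelli_F (m2 := mu) _ mF' (fun p => abse_ge0 (F p))).
  - exact: measurableT_comp (measurable_int _ (integrableZl measurableT c iff')).
  - move=> x _ /=; rewrite -[leLHS]/(\int[mu]_y `|F (x, y)|)%E.
    apply: le_trans (_ : (\int[mu]_y (`|f x| * (B * `|g y|))%:E <= _)%E).
      apply: ge0_le_integral => //.
      + exact: measurableT_comp (measurable_fun_pair2 x mF).
      + exact: measurable_int (integrableZl measurableT `|f x| iB).
      + move=> y _; rewrite /= lee_fin !normrM ler_wpM2l// ler_wpM2r//.
    rewrite -(@fineK _ (\int[mu]_y _)%E).
      rewrite -/(Rintegral mu setT _) RintegralZl// lee_fin normrM normr_id mulrC.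
      by rewrite ler_wpM2r// ler_norm.
    exact: (integrable_fin_num measurableT (integrableZl measurableT `|f x| iB)).
have P1 : (fun x => (\int[mu]_y F (x, y))%E) = EFin \o (fun x => f x * \int[mu]_y (K x y * g y)).
  by apply/funext => x; rewrite F1.
split; first by rewrite -P1; exact: (integrable_fubini_F iF).
have := Fubini iF; rewrite P1 => E; rewrite /Rintegral [X in fine X]E.
by congr fine; apply: eq_integral => y _; exact: F2.
Qed.

Lemma Fubini_kernel D f g : measurable D ->
  mu.-integrable D (EFin \o f) -> mu.-integrable D (EFin \o g) ->
  mu.-integrable D (EFin \o (fun x => f x * \int[mu]_(y in D) (K x y * g y))) /\
  \int[mu]_(x in D) (f x * \int[mu]_(y in D) (K x y * g y)) =
  \int[mu]_(y in D) (g y * \int[mu]_(x in D) (K x y * f x)).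
Proof.
move=> mD.
have patchI h : mu.-integrable D (EFin \o h) -> mu.-integrable setT (EFin \o (h \_ D)).
  by move=> ih; rewrite -restrict_EFin; apply/(integrable_mkcond _ mD).
have mulD (h u : T -> R) : (fun x => h x * u x) \_ D = fun x => (h \_ D) x * u x.
  by apply/funext => x; rewrite !patchE; case: ifP => // _; rewrite mul0r.
have patchl (h u : T -> R) : \int[mu]_(x in D) (h x * u x) = \int[mu]_x ((h \_ D) x * u x).
  by rewrite Rintegral_mkcond mulD.
have patchr (h u : T -> R) : \int[mu]_(x in D) (u x * h x) = \int[mu]_x (u x * (h \_ D) x).
  rewrite -[LHS](@eq_Rintegral _ _ _ _ _ _ (fun x => h x * u x)); last by move=> x _; rewrite mulrC.
  by rewrite patchl; apply: eq_Rintegral => x _; rewrite mulrC.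
move=> /patchI iff /patchI ig; have [m1 m2] := Fubini_kernelT iff ig; split.
  apply/(integrable_mkcond _ mD); rewrite restrict_EFin mulD.
  by apply: eq_integrable m1 => // x _ /=; rewrite patchr.
transitivity (\int[mu]_x ((f \_ D) x * \int[mu]_y (K x y * (g \_ D) y))).
  by rewrite patchl; apply: eq_Rintegral => x _; rewrite patchr.
by rewrite m2 patchl; apply: eq_Rintegral => y _; rewrite patchr.
Qed.

End FubiniKernel.

(** * The mean value property almost everywhere *)

Section MeanValue.
Context {R : realType} {n : nat}.
Local Notation Cn := 'rV[C R]_n.
Local Notation lambda := (@lebesgue_Cn R n).
Local Notation re := (@complex.Re R).
Local Notation im := (@complex.Im R).
Implicit Types (z w v : Cn) (a : R) (k f g psi : Cn -> R).

Variable Om : set Cn.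
Hypotheses (oOm : open Om) (bOm : bounded_set Om).
Let mOm : measurable Om := open_measurable_Cn oOm.

Definition rmoll k a z : R := \int[lambda]_(w in Om) (kern a z w * k w).

Lemma bounded_open_lty : (lambda Om < +oo)%E.
Proof.
have [M [_ OmM]] := bounded_setE bOm; apply: le_lt_trans (lebesgue_Cn_box M).
by apply: le_measure => //; rewrite inE//; exact: measurable_Cn_box.
Qed.

Lemma measurable_kern2 a : measurable_fun setT (fun p : Cn * Cn => kern a p.1 p.2).
Proof.
have mS : measurable_fun setT (fun p : Cn * Cn => nsq (p.1 - p.2)).
  apply: measurable_sum => j.
  rewrite (_ : (fun p : Cn * Cn => _) = fun p : Cn * Cn =>
     (re (p.1 0 j) - re (p.2 0 j)) ^+ 2 + (im (p.1 0 j) - im (p.2 0 j)) ^+ 2); last first.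
    by apply/funext => p; rewrite !mxE !raddfB.
  apply: measurable_funD; apply: measurable_funX; apply: measurable_funB.
  - exact: measurableT_comp (measurable_re_coord j) measurable_fst.
  - exact: measurableT_comp (measurable_re_coord j) measurable_snd.
  - exact: measurableT_comp (measurable_im_coord j) measurable_fst.
  - exact: measurableT_comp (measurable_im_coord j) measurable_snd.
apply: measurable_funM => //; apply: measurableT_comp.
  by apply: continuous_measurable_fun; exact: continuous_flat.
by apply: measurable_funB => //; exact: measurable_funM.
Qed.

Lemma rmoll_symmetric a f g : 0 <= a ->
  lambda.-integrable Om (EFin \o f) -> lambda.-integrable Om (EFin \o g) ->
  lambda.-integrable Om (EFin \o (fun z => f z * rmoll g a z)) /\
  \int[lambda]_(z in Om) (f z * rmoll g a z) = \int[lambda]_(w in Om) (g w * rmoll f a w).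
Proof.
move=> a0 iff ig; have [B _ HB] := @kern_bound R n a a0.
have [i1 E] := @Fubini_kernel _ _ _ lambda (kern a) B (measurable_kern2 a) HB Om f g mOm iff ig.
split; first exact: i1.
apply: (etrans E).
apply: eq_Rintegral => w _.
rewrite /rmoll.
apply: (congr1 (fun x => g w * x)).
by apply: eq_Rintegral => z _; rewrite kernC.
Qed.

Lemma integrable_kern a z g : 0 <= a -> lambda.-integrable Om (EFin \o g) ->
  lambda.-integrable Om (EFin \o (fun w => kern a z w * g w)).
Proof.
move=> a0 ig; have [B _ HB] := @kern_bound R n a a0.
by apply: (integrable_bounded_mul (B := B)) => //; exact: measurable_kern.
Qed.

Lemma integrable_bounded_cst (c : R) : lambda.-integrable Om (EFin \o (fun=> c)).
Proof. by apply: (@bounded_integrable _ _ _ _ _ _ `|c|) => //; exact: bounded_open_lty. Qed.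

Lemma rmoll1_ge0 a z : 0 <= a -> 0 <= rmoll (fun=> 1) a z.
Proof. by move=> a0; apply: Rintegral_ge0 => // w _; rewrite mulr1 kern_ge0. Qed.

Lemma rmoll_le a z f : 0 <= a -> lambda.-integrable Om (EFin \o f) ->
  (forall w, 0 <= f w <= 1) -> 0 <= rmoll f a z <= rmoll (fun=> 1) a z.
Proof.
move=> a0 iff f01; apply/andP; split.
  by apply: Rintegral_ge0 => // w _; have /andP[f0 _] := f01 w; rewrite mulr_ge0// kern_ge0.
apply: le_Rintegral => //; try exact: integrable_kern.
  by apply: integrable_kern => //; exact: integrable_bounded_cst.
by move=> w _; have /andP[_ f1] := f01 w; rewrite ler_wpM2l ?kern_ge0.
Qed.

(** The kernel is nonnegative and vanishes outside the ball of squared radius [a^-1], inside which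
    [f] differs from [f z] by at most [e]. *)
Lemma rmoll_close a z f (e r : R) : 0 < a -> a^-1 < r -> lambda.-integrable Om (EFin \o f) ->
  (forall w, nsq (w - z) < r -> `|f w - f z| <= e) ->
  `|rmoll f a z - f z * rmoll (fun=> 1) a z| <= e * rmoll (fun=> 1) a z.
Proof.
move=> a0 ar iff fe; have a00 := ltW a0.
have i1 := integrable_kern z a00 (integrable_bounded_cst 1).
rewrite -!RintegralZl// -RintegralB//; last 2 first.
- exact: integrable_kern.
- exact: (integrableZl mOm (f z) i1).
have i2 : lambda.-integrable Om (EFin \o (fun w => kern a z w * f w - f z * (kern a z w * 1))).
  exact: (integrableB mOm (integrable_kern z a00 iff) (integrableZl mOm (f z) i1)).
apply: le_trans (le_normr_Rintegral mOm i2) _; apply: le_Rintegral => //.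
- exact: (integrable_abse i2).
- exact: (integrableZl mOm e i1).
move=> w _; rewrite mulr1 [f z * _]mulrC -mulrBr normrM ger0_norm ?kern_ge0// mulrC.
have [h|h] := pselect (nsq (z - w) <= a^-1); last by rewrite kern_out// !mulr0.
by rewrite ler_wpM2r ?kern_ge0// fe// nsqC (le_lt_trans h).
Qed.

(* Testing against psi supported in the ball, the symmetry of the kernel moves the
   mollification onto psi; let the radius tend to 0. *)
Lemma moll_mean_value z0 (s a1 : R) k : 0 < s -> s^-1 < a1 ->
  (forall w, nsq (w - z0) < 4 * s -> Om w) -> lambda.-integrable Om (EFin \o k) ->
  (forall a z, s^-1 < a -> nsq (z - z0) < 4 * s -> rmoll k a z = rmoll k a1 z) ->
  (forall a z, s^-1 < a -> nsq (z - z0) < 4 * s ->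
     rmoll (fun=> 1) a z = rmoll (fun=> 1) a1 z) ->
  {ae lambda, forall w, nsq (w - z0) < s -> rmoll k a1 w = k w * rmoll (fun=> 1) a1 w}.
Proof.
move=> s0 a1s ballOm ik kcst mcst.
have a10 : 0 <= a1 by rewrite ltW// (lt_trans _ a1s)// invr_gt0.
pose b w := s - nsq (w - z0).
have cb : continuous b.
  move=> w; apply: (continuousB (@cst_continuous _ _ s w)).
  apply/continuous_nsqP => e e0; have /continuous_nsqP := @continuous_nsq R n (w - z0).
  move=> /(_ e e0)[r r0 H]; exists r => // w' h; apply: H.
  by rewrite (_ : w' - z0 - (w - z0) = w' - w)// opprB addrA subrK.
have bE w : (0 < b w) = (nsq (w - z0) < s) by rewrite subr_gt0.
have WOm : pos_set b `<=` Om.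
  by move=> w; rewrite /pos_set /= bE => h; apply: ballOm; lra.
have mW : measurable (pos_set b).
  rewrite (_ : pos_set b = setT `&` (fun w => nsq (w - z0)) @^-1` `]-oo, s[).
    exact: measurable_nsqB.
  by rewrite setTI; apply/seteqP; split => w; rewrite /pos_set /= bE in_itv.
have i1 := integrable_bounded_cst 1.
have [ik1 _] := rmoll_symmetric a10 ik i1.
have [ik2 _] := rmoll_symmetric a10 i1 ik.
(* The factor 1 keeps the first term in the form for which [rmoll_symmetric] gives integrability. *)
pose D w := 1 * rmoll k a1 w - k w * rmoll (fun=> 1) a1 w.
have iD : lambda.-integrable Om (EFin \o D) := integrableB mOm ik2 ik1.
suff: {ae lambda, forall w, 0 < b w -> D w = 0}.
  apply: filterS => w h ws; have := h; rewrite bE => /(_ ws) /eqP.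
  by rewrite /D mul1r subr_eq0 => /eqP.
apply: (integral_continuous_eq0_ae cb); first exact: integrableS iD.
move=> psi cpsi psi01 psi0.
have mpsi : measurable_fun Om psi by apply: continuous_measurable_Cn => // z _; exact: cpsi.
have psiB w : Om w -> `|psi w| <= 1.
  by move=> _; have /andP[p0 p1] := psi01 w; rewrite ger0_norm.
have ipsi : lambda.-integrable Om (EFin \o psi).
  by apply: bounded_integrable psiB => //; exact: bounded_open_lty.
have ipD : lambda.-integrable Om (EFin \o (fun w => psi w * D w)).
  exact: (integrable_bounded_mul mOm mpsi psiB iD).
pose mass := rmoll (fun=> 1) a1; pose G w := k w * (psi w * mass w).
have [ipk _] := rmoll_symmetric a10 ipsi ik.
have psiW w : psi w != 0 -> nsq (w - z0) < s.
  by move=> p0; apply: contrapT => h; move/eqP: p0; apply; apply: psi0; rewrite bE.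
(* [psi] lives at squared distance less than [s] from [z0] and the kernel has squared radius less
   than [s]; [nsqD] turns this into [2 * s + 2 * s]. *)
have psiOff a w : s^-1 < a -> ~ (nsq (w - z0) < 4 * s) -> rmoll psi a w = 0.
  move=> sa h; have a0 : 0 < a by apply: lt_trans sa; rewrite invr_gt0.
  have as' : a^-1 < s by rewrite -[s]invrK ltf_pV2// posrE invr_gt0.
  rewrite /rmoll -[RHS](mul0r (fine (lambda Om))) -Rintegral_cst//.
  apply: eq_Rintegral => z _; apply/eqP; rewrite mulf_eq0 orbC -implyNb; apply/implyP => /psiW hz.
  apply/eqP/kern_out => // hw; apply: h.
  have := nsqD (w - z) (z - z0); rewrite addrA subrK; lra.
(* On the support of [psi] the scale [a1] may be replaced by any [a_ i]. Symmetry then gives the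
   integral of [k * rmoll psi (a_ i)], and [rmoll psi (a_ i)] tends to [psi * mass] as the kernel
   concentrates. *)
have EG : \int[lambda]_(w in Om) (psi w * rmoll k a1 w) = \int[lambda]_(w in Om) G w.
  pose a_ (i : nat) : R := s^-1 + 1 + i%:R.
  have a_gt i : s^-1 < a_ i by rewrite /a_ -addrA ltrDl ltr_pwDl.
  have a_gt0 i : 0 < a_ i by apply: lt_trans (a_gt i); rewrite invr_gt0.
  pose F i w := k w * rmoll psi (a_ i) w.
  have iF i : lambda.-integrable Om (EFin \o F i).
    by have [] := rmoll_symmetric (ltW (a_gt0 i)) ik ipsi.
  have EF i : \int[lambda]_(w in Om) F i w = \int[lambda]_(w in Om) (psi w * rmoll k a1 w).
    have [_ <-] := rmoll_symmetric (ltW (a_gt0 i)) ipsi ik.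
    apply: eq_Rintegral => w _; have [p0|/psiW h] := eqVneq (psi w) 0.
      have p0' x : psi w * x = 0 by rewrite p0 mul0r.
      exact: etrans (p0' _) (esym (p0' _)).
    by rewrite (kcst _ w (a_gt i))//; lra.
  have FG w : Om w -> F i w @[i --> \oo] --> G w.
    move=> Omw; apply: cvgMr; have [h|h] := pselect (nsq (w - z0) < 4 * s); last first.
      rewrite psi0 ?mul0r; last by rewrite bE => ?; apply: h; lra.
      by under eq_fun do rewrite psiOff//; exact: cvg_cst.
    apply/cvgrPdist_le => e e0; have m0 : 0 <= mass w := rmoll1_ge0 w a10.
    have e'0 : 0 < e / (mass w + 1) by rewrite divr_gt0// ltr_wpDl.
    have /continuous_nsqP/(_ _ e'0)[r r0 Hr] := cpsi w.
    near=> i; have ar : (a_ i)^-1 < r.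
      rewrite -[r]invrK ltf_pV2// ?posrE ?invr_gt0//.
      apply: (@lt_trans _ _ i%:R); first by near: i; exact: nbhs_infty_gtr.
      by rewrite /a_ ltrDr addr_gt0// invr_gt0.
    have := rmoll_close (a_gt0 i) ar ipsi (fun w' h' => ltW (Hr w' h')).
    rewrite (mcst _ w (a_gt i) h) -/(mass w) distrC => H; apply: le_trans H _.
    by rewrite mulrAC ler_pdivrMr ?ltr_wpDl// ler_wpM2l ?lerDl// ltW.
  (* Since [psi <= 1], its mollification is at most that of 1, which does not depend on the scale
     near [z0]; this makes the domination uniform in [i]. *)
  have FB w i : Om w -> `|F i w| <= `|k w * mass w|.
    move=> Omw; rewrite /F !normrM ler_wpM2l//.
    have [h|h] := pselect (nsq (w - z0) < 4 * s); last by rewrite psiOff// normr0.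
    have /andP[p0 p1] := rmoll_le w (ltW (a_gt0 i)) ipsi psi01.
    by rewrite (ger0_norm p0) (le_trans p1)// (mcst _ w (a_gt i) h) ler_norm.
  have mF i : measurable_fun Om (EFin \o F i) := measurable_int _ (iF i).
  have mG : measurable_fun Om (EFin \o G).
    apply: (measurable_int lambda).
    rewrite (_ : EFin \o G = EFin \o (fun w => psi w * (k w * mass w))).
      exact: (integrable_bounded_mul mOm mpsi psiB ik1).
    by apply/funext => w; rewrite /G /= mulrCA.
  have FGe w : Om w -> (EFin \o F i) w @[i --> \oo] --> (EFin \o G) w.
    by move=> Omw; apply/cvg_EFin; [exact: nearW|exact: FG].
  have FBe w i : Om w -> (`|(EFin \o F i) w| <= `|(EFin \o (fun w => k w * mass w)%R) w|)%E.
    by move=> Omw; rewrite lee_fin; exact: FB.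
  have [iG _ lim] := @dominated_convergence _ _ _ lambda Om mOm (fun i => EFin \o F i) (EFin \o G)
    (fun w => `|(EFin \o (fun w => k w * mass w)%R) w|%E) mF mG
    (aeW _ FGe) (integrable_abse ik1) (aeW _ (fun w i => FBe w i)).
  rewrite (_ : [sequence _]_i =
    cst (\int[lambda]_(w in Om) (psi w * rmoll k a1 w))%:E) in lim; last first.
    apply/funext => i; rewrite /= -(EF i) /Rintegral fineK//.
    exact: (integrable_fin_num mOm (iF i)).
  rewrite -[LHS]/(fine (\int[lambda]_(w in Om) (psi w * rmoll k a1 w))%:E).
  by rewrite [RHS]/Rintegral; congr fine; apply: (cvg_unique _ (cvg_cst _) lim).
have R0 : \int[lambda]_(w in Om) (psi w * D w) = 0.
  have iG : lambda.-integrable Om (EFin \o G).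
    apply: eq_integrable (integrable_bounded_mul mOm mpsi psiB ik1) => // w _.
    by rewrite /G /= mulrCA.
  rewrite -[RHS](subrr (\int[lambda]_(w in Om) (psi w * rmoll k a1 w))) [X in _ - X]EG.
  rewrite -RintegralB//; apply: eq_Rintegral => w _.
  by rewrite /D /G mul1r mulrBr mulrCA.
have E0 : (\int[lambda]_(w in Om) (psi w * D w)%:E = 0)%E.
  have := integrable_fin_num mOm ipD; move: R0; rewrite /Rintegral.
  by move=> R0 /fineK <-; rewrite R0.
apply: (etrans _ E0); rewrite -[in LHS](setIidr WOm) integral_mkcondr.
apply: eq_integral => w _; rewrite patchE; case: ifPn => // /negP; rewrite inE => h.
by rewrite psi0// mul0r.
Unshelve. all: by end_near. Qed.

End MeanValue.

Lemma near_eq_differentiable (K : numFieldType) (V W : normedModType K) (f g : V -> W) (x : V) :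
  (\near x, f x = g x) -> differentiable f x -> differentiable g x.
Proof.
move=> fg /diff_locallyP[cd E].
have fgx : f x = g x := nbhs_singleton fg.
have E' : g \o shift x = cst (g x) + 'd f x +o_ 0 id.
  apply/eqaddoP => e e0; have /eqaddoP/(_ e e0) := E.
  have fg' : \forall v \near (0 : V), f (v + x) = g (v + x).
    by move: fg; rewrite (near_shift 0) subr0.
  apply: filterS2 fg' => v fgv.
  by rewrite /= !fctE -fgv -fgx.
apply/diff_locallyP; have D := diff_unique cd E'.
by rewrite D; split.
Qed.

(** * The holomorphic representative of a weakly closed function *)

Section Weyl.
Context {R : realType} {n : nat}.
Local Notation Cn := 'rV[C R]_n.
Local Notation lambda := (@lebesgue_Cn R n).
Local Notation re := (@complex.Re R).
Local Notation im := (@complex.Im R).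
Implicit Types (z w v : Cn) (a : R) (h : Cn -> C R).

Variable Om : set Cn.
Hypotheses (oOm : open Om) (bOm : bounded_set Om).
Let mOm : measurable Om := open_measurable_Cn oOm.

Let one : Cn -> C R := fun=> 1.

Lemma integrable_one : Cintegrable Om one.
Proof. by split; exact: integrable_bounded_cst. Qed.

Lemma weakly_closed_holomorphic h : holomorphic Om h -> weakly_closed Om h.
Proof. by move=> hh j phi K ephi cK KOm phi0; exact: integral_dbar_eq0 cK KOm phi0. Qed.

Lemma weakly_closed_one : weakly_closed Om one.
Proof. by apply: weakly_closed_holomorphic => z _; exact: differentiable_cst. Qed.

Lemma mollRE h a z : moll Om h a z =
  (rmoll Om (Re_part h) a z +i* rmoll Om (Im_part h) a z)%C.
Proof. exact: mollE. Qed.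

Lemma re_moll h a z : re (moll Om h a z) = rmoll Om (Re_part h) a z.
Proof. by rewrite mollRE. Qed.

Lemma im_moll h a z : im (moll Om h a z) = rmoll Om (Im_part h) a z.
Proof. by rewrite mollRE. Qed.

Lemma complex_scaleE (p : C R) (m : R) : (re p * m +i* (im p * m))%C = p * m%:C%C.
Proof. by case: p => x y; apply: eqC; rewrite /= ?mulr0 ?subr0 ?add0r. Qed.

Lemma moll_one a z : moll Om one a z = (rmoll Om (fun=> 1) a z)%:C%C.
Proof.
rewrite mollRE; congr (_ +i* _)%C; rewrite /rmoll.
rewrite -[RHS](mul0r (fine (lambda Om))) -Rintegral_cst//.
by apply: eq_Rintegral => w _; exact: mulr0.
Qed.

(** Otherwise the nonnegative kernel would vanish almost everywhere on [Om], but it is positive on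
    an open ball, which has positive measure. *)
Lemma rmoll_one_gt0 a z : 0 < a -> ball_in Om z a -> 0 < rmoll Om (fun=> 1) a z.
Proof.
move=> a0 zOm; rewrite lt_neqAle rmoll1_ge0 ?ltW// andbT eq_sym; apply/negP => /eqP r0.
have a00 := ltW a0; have i1 := integrable_kern oOm z a00 (integrable_bounded_cst oOm bOm 1).
have : (\int[lambda]_(w in Om) `|(EFin \o (fun w => kern a z w * 1)%R) w| = 0)%E.
  have := integrable_fin_num mOm i1; move: r0; rewrite /rmoll /Rintegral => r0 /fineK.
  rewrite r0 => E; rewrite [RHS]E; apply: eq_integral => w _ /=.
  by rewrite ger0_norm// mulr1 kern_ge0.
move=> /(ae_eq_integral_abs _ mOm (measurable_int _ i1))[N [mN N0 H]].
have := lebesgue_nsq_ball_gt0 z (_ : 0 < a^-1); rewrite invr_gt0 => /(_ a0).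
rewrite ltNge => /negP; apply; rewrite -N0.
apply: le_measure; rewrite ?inE//.
  have -> : nsq_ball z a^-1 = setT `&` (fun w => nsq (w - z)) @^-1` `]-oo, a^-1[.
    by rewrite setTI; apply/seteqP; split => w; rewrite /nsq_ball /= in_itv /= nsqC.
  exact: measurable_nsqB.
move=> w; rewrite /nsq_ball /= => hw; apply: H => /=.
have Omw : Om w by apply: zOm; exact: ltW.
move=> /(_ Omw) [] /eqP; rewrite mulr1 mulf_eq0 expf_eq0 (gt_eqF a0) andbF /=.
apply/negP; rewrite gt_eqF// flat0_gt0// /qker subr_gt0 mulrC -ltr_pdivlMr//.
by rewrite mul1r.
Qed.

Variable h : Cn -> C R.
Hypotheses (ih : Cintegrable Om h) (wh : weakly_closed Om h).

(** The strict inequality reflects [moll_const]: independence of the scale is known only beyond a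
    scale [a0] whose ball already fits in [Om]. *)
Definition admissible z a := exists2 a0, 0 < a0 < a & ball_in Om z a0.

Lemma moll_admissible k z a b : Cintegrable Om k -> weakly_closed Om k ->
  admissible z a -> admissible z b -> moll Om k a z = moll Om k b z.
Proof.
move=> ik wk [a0 /andP[a00 a0a] Ha] [b0 /andP[b00 b0b] Hb].
have [ab|ba] := leP a0 b0.
  by apply: (moll_const oOm bOm ik wk a00 Ha) => //; exact: le_lt_trans ab b0b.
by apply: (moll_const oOm bOm ik wk b00 Hb) => //; exact: lt_trans ba a0a.
Qed.

Lemma rmoll_admissible k z a b : Cintegrable Om k -> weakly_closed Om k ->
  admissible z a -> admissible z b ->
  rmoll Om (Re_part k) a z = rmoll Om (Re_part k) b z /\
  rmoll Om (Im_part k) a z = rmoll Om (Im_part k) b z.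
Proof.
move=> ik wk za zb; have E := moll_admissible ik wk za zb; split.
  exact: etrans (esym (re_moll k a z)) (etrans (congr1 re E) (re_moll k b z)).
exact: etrans (esym (im_moll k a z)) (etrans (congr1 im E) (im_moll k b z)).
Qed.

Lemma admissible_near z0 (s a : R) z : 0 < s -> (forall w, nsq (w - z0) < 16 * s -> Om w) ->
  s^-1 < a -> nsq (z - z0) < 4 * s -> admissible z a.
Proof.
move=> s0 sOm sa zs; exists s^-1; first by rewrite invr_gt0 s0.
move=> w; rewrite invrK nsqC => hw; apply: sOm.
by have := nsqD (w - z) (z - z0); rewrite addrA subrK; lra.
Qed.

(* The quotient does not depend on the admissible a; xget selects one. *)
Definition representative z : C R :=
  let a := xget 1 (admissible z) in moll Om h a z / moll Om one a z.

Lemma representativeE z a : admissible z a ->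
  representative z = moll Om h a z / moll Om one a z.
Proof.
move=> za; rewrite /representative.
have := @xgetI _ 1 (admissible z) a za; move: (xget _ _) => b zb.
by rewrite (moll_admissible ih wh zb za) (moll_admissible integrable_one weakly_closed_one zb za).
Qed.

Lemma moll_one_neq0 z a : admissible z a -> moll Om one a z != 0.
Proof.
move=> [a0 /andP[a00 a0a] zOm]; rewrite moll_one.
have := rmoll_one_gt0 (lt_trans a00 a0a) (ball_in_le a00 (ltW a0a) zOm).
by move=> m0; apply/negP => /eqP/(congr1 re)/=; apply/eqP; rewrite gt_eqF.
Qed.

Lemma open_nsq_ball z : Om z -> exists2 s : R, 0 < s & forall w, nsq (w - z) < 16 * s -> Om w.
Proof.
move=> Omz; have /nbhs_nsqP[r r0 Hr] : nbhs z Om by exact: open_nbhs_nbhs.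
by exists (r / 16); rewrite ?divr_gt0// => w hw; apply: Hr; lra.
Qed.

(** A single scale is admissible on a whole neighbourhood of [z], where the representative is
    therefore a quotient of two differentiable mollifications. *)
Lemma representative_holomorphic : holomorphic Om representative.
Proof.
move=> z Omz; have [s s0 sOm] := open_nsq_ball Omz.
pose a := s^-1 + 1; have sa : s^-1 < a by rewrite /a ltrDl.
have a0 : 0 < a by apply: lt_trans sa; rewrite invr_gt0.
have zz : nsq (z - z) < 4 * s by rewrite subrr nsq0; lra.
have za : admissible z a := admissible_near s0 sOm sa zz.
have ball : ball_in Om z a by have [b /andP[b0 ba] Hb] := za; exact: ball_in_le b0 (ltW ba) Hb.
apply: (@near_eq_differentiable _ _ _ (moll Om h a * (fun z => (moll Om one a z)^-1))).
  apply/nbhs_nsqP; exists (4 * s); first by lra.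
  by move=> w hw; rewrite (representativeE (admissible_near s0 sOm sa hw)).
apply: differentiableM; first exact: moll_differentiable.
apply: differentiableV; last exact: moll_one_neq0.
exact: (moll_differentiable oOm bOm integrable_one weakly_closed_one).
Qed.

(** The mean value property holds off a null set in each ball of a countable cover of [Om],
    separately for the real and imaginary parts. *)
Lemma representative_ae : {ae lambda, forall z, Om z -> h z = representative z}.
Proof.
have [c [s [OmE cs]]] := open_ball_cover oOm.
suff H i : {ae lambda, forall z, nsq (z - c i) < s i -> h z = representative z}.
  have : {ae lambda, forall z i, nsq (z - c i) < s i -> h z = representative z}.
    exact: ae_foralln.
  by apply: filterS => z Hz; rewrite OmE => -[i _ hi]; exact: (Hz i).
have [s0|s0] := ltP 0 (s i); last first.
  by apply: aeW => z hz; have := le_lt_trans (nsq_ge0 _) (lt_le_trans hz s0); rewrite ltxx.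
pose a := (s i)^-1 + 1; have sa : (s i)^-1 < a by rewrite /a ltrDl.
have sub4 w : nsq (w - c i) < 4 * s i -> Om w by move=> hw; apply: (cs i); lra.
have adm b z : (s i)^-1 < b -> nsq (z - c i) < 4 * s i -> admissible z b.
  exact: (admissible_near s0 (cs i)).
have aa z : nsq (z - c i) < 4 * s i -> admissible z a := adm a z sa.
have m1 b z : (s i)^-1 < b -> nsq (z - c i) < 4 * s i ->
    rmoll Om (fun=> 1) b z = rmoll Om (fun=> 1) a z.
  move=> sb zs.
  by have [] := rmoll_admissible integrable_one weakly_closed_one (adm b z sb zs) (aa z zs).
have mR b z : (s i)^-1 < b -> nsq (z - c i) < 4 * s i ->
    rmoll Om (Re_part h) b z = rmoll Om (Re_part h) a z.
  by move=> sb zs; have [] := rmoll_admissible ih wh (adm b z sb zs) (aa z zs).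
have mI b z : (s i)^-1 < b -> nsq (z - c i) < 4 * s i ->
    rmoll Om (Im_part h) b z = rmoll Om (Im_part h) a z.
  by move=> sb zs; have [] := rmoll_admissible ih wh (adm b z sb zs) (aa z zs).
have [i1 i2] := ih.
have AR := moll_mean_value oOm bOm s0 sa sub4 i1 mR m1.
have AI := moll_mean_value oOm bOm s0 sa sub4 i2 mI m1.
apply: filterS2 AR AI => z hR hI hz.
have za : admissible z a by apply: adm => //; lra.
rewrite (representativeE za); have m0 := moll_one_neq0 za.
suff -> : moll Om h a z = h z * moll Om one a z by rewrite mulfK.
rewrite mollRE moll_one (hR hz) (hI hz).
exact: complex_scaleE.
Qed.

End Weyl.

(** * The canonical solution *)

Section Conjugates.
Context {R : realType} {n : nat}.
Local Notation Cn := 'rV[C R]_n.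
Local Notation re := (@complex.Re R).
Local Notation im := (@complex.Im R).
Local Notation normc := Normc.normc.
Implicit Types (z w : Cn) (F : Cn -> R) (f g phi : Cn -> C R).

Definition conj_mul k phi z : C R := (z 0 k)^* * phi z.

Lemma Re_conj_mul k phi : Re_part (conj_mul k phi) =
  fun z => re (z 0 k) * Re_part phi z + im (z 0 k) * Im_part phi z.
Proof.
by apply/funext => z; rewrite /Re_part /conj_mul conjCE reM reJ imJ mulNr opprK.
Qed.

Lemma Im_conj_mul k phi : Im_part (conj_mul k phi) =
  fun z => re (z 0 k) * Im_part phi z + - (im (z 0 k) * Re_part phi z).
Proof.
by apply/funext => z; rewrite /Im_part /conj_mul conjCE imM reJ imJ mulNr.
Qed.

Lemma elementaryN F : elementary F -> elementary (fun z => - F z).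
Proof.
move=> eF; rewrite (_ : (fun z => - F z) = fun z => -1 * F z).
  exact: (elementaryM (elementary_cst _) eF).
by apply/funext => z; rewrite mulN1r.
Qed.

Lemma elementaryC_conj_mul k phi : elementaryC phi -> elementaryC (conj_mul k phi).
Proof.
move=> [sR sI]; split; rewrite ?Re_conj_mul ?Im_conj_mul; apply: elementaryD.
- exact: (elementaryM (elementary_re k) sR).
- exact: (elementaryM (elementary_im k) sI).
- exact: (elementaryM (elementary_re k) sI).
- exact: (elementaryN (elementaryM (elementary_im k) sR)).
Qed.

Lemma dbar_conj_mul k j phi z : elementaryC phi ->
  dbar j (conj_mul k phi) z = (z 0 k)^* * dbar j phi z + (k == j)%:R * phi z.
Proof.
move=> [/(elementary_fdiff j)[Px [Py [_ _ dP]]] /(elementary_fdiff j)[Qx [Qy [_ _ dQ]]]].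
have dR := fdiffCD (fdiffCM (fdiffC_re k j z) (dP z)) (fdiffCM (fdiffC_im k j z) (dQ z)).
have dI := fdiffCD (fdiffCM (fdiffC_re k j z) (dQ z))
  (fdiffCN (fdiffCM (fdiffC_im k j z) (dP z))).
rewrite -Re_conj_mul in dR; rewrite -Im_conj_mul in dI.
rewrite (fdiffC_dbar dR dI) (fdiffC_dbar (dP z) (dQ z)).
have -> : ((k == j)%:R : C R) = ((k == j)%:R : R)%:C%C by rewrite rmorph_nat.
rewrite conjCE.
apply: eqC; rewrite ?reD ?imD ?reM ?imM reJ imJ /= /Re_part /Im_part;
  move: (re (phi z)) (im (phi z)) (re (z 0 k)) (im (z 0 k)) (_%:R) => p q x y d;
  by field.
Qed.

Lemma elementaryC_dbar j phi : elementaryC phi -> elementaryC (dbar j phi).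
Proof.
move=> [/(elementary_fdiff j)[Px [Py [ePx ePy dP]]] /(elementary_fdiff j)[Qx [Qy [eQx eQy dQ]]]].
have half F G : elementary F -> elementary G -> elementary (fun z : Cn => (F z + G z) / 2).
  by move=> eF eG; apply: (elementaryM (elementaryD eF eG)); exact: elementary_cst.
split.
  rewrite (_ : Re_part _ = fun z => (Px z + - Qy z) / 2); first exact: half (elementaryN eQy).
  by apply/funext => z; rewrite /Re_part (fdiffC_dbar (dP z) (dQ z)).
rewrite (_ : Im_part _ = fun z => (Qx z + Py z) / 2); first exact: half.
by apply/funext => z; rewrite /Im_part (fdiffC_dbar (dP z) (dQ z)).
Qed.

Variable Om : set Cn.
Hypotheses (oOm : open Om) (bOm : bounded_set Om).
Let mOm : measurable Om := open_measurable_Cn oOm.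

Lemma elementary_bounded F : elementary F -> exists B, forall w, Om w -> `|F w| <= B.
Proof.
move=> /elementary_continuous cF; have [S S0 HS] := nsq_bounded bOm 0.
have /compact_bounded[M [_ HM]] : compact (F @` [set w | nsq (0 - w) <= S]).
  by apply: continuous_compact; [exact: continuous_subspaceT|exact: compact_nsq_ball].
exists (`|M| + 1) => w Omw; apply: HM; first by rewrite (le_lt_trans (ler_norm _))// ltrDl.
by exists w => //; exact: HS.
Qed.

Lemma continuous_Cmeasurable f : (forall z, Om z -> {for z, continuous f}) -> Cmeasurable Om f.
Proof.
move=> cf; split; apply: continuous_measurable_Cn => // z Omz.
  by apply: continuous_comp; [exact: cf|exact: continuous_re].
by apply: continuous_comp; [exact: cf|exact: continuous_im].
Qed.

Lemma elementaryC_L2 phi : elementaryC phi -> L2 Om phi /\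
  exists B, forall w, Om w -> normc (phi w) <= B.
Proof.
move=> ephi; have [/elementary_bounded[B1 H1] /elementary_bounded[B2 H2]] := ephi.
have H w : Om w -> normc (phi w) <= B1 + B2.
  by move=> Omw; apply: le_trans (normc_le_re_im _) _; apply: lerD; [exact: H1|exact: H2].
split; last by exists (B1 + B2).
apply: (L2_bounded mOm (bounded_open_lty oOm bOm)) H.
by apply: continuous_Cmeasurable => z _; exact: elementaryC_continuous.
Qed.

Lemma A2_measurable f : A2 Om f -> Cmeasurable Om f.
Proof.
by move=> [hf _]; apply: continuous_Cmeasurable => z Omz; exact: (holomorphic_continuous hf).
Qed.

Lemma A2_L2 f : A2 Om f -> L2 Om f.
Proof. by move=> Af; have [mR mI] := A2_measurable Af; split => //; case: Af. Qed.

Lemma L2_Cintegrable f : L2 Om f -> Cintegrable Om f.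
Proof.
move=> Lf; have L1 : L2 Om (fun=> 1 : C R).
  by apply: (elementaryC_L2 _).1; split; exact: elementary_cst.
by apply: eq_Cintegrable (L2M_integrable mOm Lf L1) => // z _ /=; rewrite mulr1.
Qed.

Lemma L2_conj_mul k f : L2 Om f -> L2 Om (conj_mul k f).
Proof.
have ec : elementaryC (conj_mul k (fun=> 1)).
  by apply: elementaryC_conj_mul; split; exact: elementary_cst.
have [Lc [B HB]] := elementaryC_L2 ec.
move=> Lf; have /L2P[mc _] := Lc.
rewrite (_ : conj_mul k f = conj_mul k (fun=> 1) \* f).
  exact: (L2_bounded_mul mOm mc HB Lf).
by apply/funext => z; rewrite /conj_mul /= mulr1.
Qed.

Lemma L2_sum (I : Type) (s : seq I) (F : I -> Cn -> C R) : (forall i, L2 Om (F i)) ->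
  L2 Om (fun z => \sum_(i <- s) F i z).
Proof.
move=> LF; elim: s => [|i s IH].
  under eq_fun do rewrite big_nil; apply: (elementaryC_L2 _).1.
  by split; exact: elementary_cst.
by under eq_fun do rewrite big_cons; exact: L2D.
Qed.

End Conjugates.

(** * The Bergman projection and the integral formula *)

Section Solution.
Context {R : realType} {n : nat}.
Local Notation Cn := 'rV[C R]_n.
Local Notation lambda := (@lebesgue_Cn R n).
Implicit Types (z w : Cn) (f h u phi : Cn -> C R).

Variable Om : set Cn.
Hypotheses (oOm : open Om) (bOm : bounded_set Om).
Let mOm : measurable Om := open_measurable_Cn oOm.

Definition conj_sum (g : 'I_n -> Cn -> C R) z : C R := \sum_k conj_mul k (g k) z.

(** The factor conj z_k is moved onto the test function by Leibniz' rule: conj(z_k) phi is again a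
    test function, against whose dbar the holomorphic [g k] integrates to 0, and only the correction
    term for [k = j] remains. *)
Lemma conj_sum_dbar g j phi (K : set Cn) : A2_01 Om g ->
  elementaryC phi -> compact K -> K `<=` Om -> (forall z, ~ K z -> phi z = 0) ->
  Cintegral Om (fun z => conj_sum g z * dbar j phi z) = - Cintegral Om (fun z => g j z * phi z).
Proof.
move=> Ag ephi cK KOm phi0; have [Lphi _] := elementaryC_L2 oOm bOm ephi.
have [Ldphi _] := elementaryC_L2 oOm bOm (elementaryC_dbar j ephi).
have Lg k := A2_L2 oOm (Ag k).
have Igphi k : Cintegrable Om (fun z => g k z * phi z) := L2M_integrable mOm (Lg k) Lphi.
have Icphi k : Cintegrable Om (fun z => g k z * dbar j (conj_mul k phi) z).
  have [L _] := elementaryC_L2 oOm bOm (elementaryC_dbar j (elementaryC_conj_mul k ephi)).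
  exact: (L2M_integrable mOm (Lg k) L).
pose T k z : C R := g k z * dbar j (conj_mul k phi) z + - (k == j)%:R * (g k z * phi z).
have IT k : Cintegrable Om (T k).
  exact: (CintegrableD mOm (Icphi k) (CintegrableZ mOm (- (k == j)%:R) (Igphi k))).
have [_ ES] := Cintegral_sum mOm (index_enum 'I_n) IT.
rewrite (@eq_Cintegral _ _ Om _ (fun z => \sum_k T k z)); last first.
  move=> z _; rewrite /conj_sum mulr_suml; apply: eq_bigr => k _.
  have E (a b c d e : C R) : a * b * c = b * (a * c + e * d) + - e * (b * d) by ring.
  by rewrite /T (dbar_conj_mul k j z ephi); exact: E.
rewrite ES (bigD1 j)//= big1 => [|k kj].
  rewrite addr0 (CintegralD mOm (Icphi j) (CintegrableZ mOm _ (Igphi j))).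
  rewrite (CintegralZ mOm _ (Igphi j)) eqxx mulN1r.
  rewrite (integral_dbar_eq0 j oOm bOm (Ag j).1 (elementaryC_conj_mul j ephi) cK KOm) ?add0r//.
  by move=> z Kz; rewrite /conj_mul phi0// mulr0.
rewrite (CintegralD mOm (Icphi k) (CintegrableZ mOm _ (Igphi k))).
rewrite (CintegralZ mOm _ (Igphi k)) (negbTE kj) oppr0 mul0r addr0.
apply: (integral_dbar_eq0 j oOm bOm (Ag k).1 (elementaryC_conj_mul k ephi) cK KOm).
by move=> z Kz; rewrite /conj_mul phi0// mulr0.
Qed.

Lemma weakly_closed_difference u g : A2_01 Om g -> L2 Om u -> dbar_eq Om u g ->
  weakly_closed Om (fun z => u z - conj_sum g z).
Proof.
move=> Ag Lu ug j phi K ephi cK KOm phi0.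
have [Ldphi _] := elementaryC_L2 oOm bOm (elementaryC_dbar j ephi).
have Lv : L2 Om (conj_sum g).
  by apply: L2_sum => // k; apply: L2_conj_mul => //; exact: A2_L2.
have I1 : Cintegrable Om (fun z => u z * dbar j phi z) := L2M_integrable mOm Lu Ldphi.
have I2 : Cintegrable Om (fun z => conj_sum g z * dbar j phi z) := L2M_integrable mOm Lv Ldphi.
rewrite (@eq_Cintegral _ _ Om _
  (fun z => u z * dbar j phi z + - 1 * (conj_sum g z * dbar j phi z))).
  rewrite (CintegralD mOm I1 (CintegrableZ mOm (- 1) I2)) (CintegralZ mOm _ I2).
  rewrite (conj_sum_dbar j Ag ephi cK KOm phi0) (ug j phi (elementaryC_test ephi cK KOm phi0)).
  by rewrite mulN1r opprK addNr.
by move=> z _; rewrite mulrBl mulN1r.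
Qed.

Lemma weakly_closed_A2 h : L2 Om h -> weakly_closed Om h ->
  exists2 H, A2 Om H & {ae lambda, forall z, Om z -> h z = H z}.
Proof.
move=> Lh wh; have ih := L2_Cintegrable oOm bOm Lh.
have hH := representative_ae oOm bOm ih wh.
have Hhol := representative_holomorphic oOm bOm ih wh.
exists (representative Om h) => //; split; first exact: Hhol.
have mH : Cmeasurable Om (representative Om h).
  exact: (continuous_Cmeasurable oOm (fun z Omz => holomorphic_continuous Hhol Omz)).
have /L2P[mh _] := Lh; have [_ _ fh] := Lh.
apply: le_lt_trans fh; rewrite le_eqVlt; apply/orP; left; apply/eqP.
apply: ae_eq_integral => //.
- by apply/measurable_EFinP; exact: measurable_normc2.
- by apply/measurable_EFinP; exact: measurable_normc2.
- by apply: filterS hH => z E Omz; rewrite (E Omz).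
Qed.

Lemma bergman_solution (B : Cn -> Cn -> C R) g u : bergman_kernel Om B -> A2_01 Om g ->
  L2 Om u -> dbar_eq Om u g -> orthogonal_A2 Om u ->
  (forall z, Om z -> Cintegrable Om (fun w => B z w * pairing g z w)) /\
  {ae lambda, forall z, Om z -> u z = Cintegral Om (fun w => B z w * pairing g z w)}.
Proof.
move=> bB Ag Lu ug uA; pose v := conj_sum g; pose h z := u z - v z.
have Lg k := A2_L2 oOm (Ag k).
have Lv : L2 Om v by apply: L2_sum => // k; exact: L2_conj_mul.
have Lh : L2 Om h := L2D mOm Lu (L2N mOm Lv).
have [H AH hH] := weakly_closed_A2 Lh (weakly_closed_difference Ag Lu ug).
have LB z : Om z -> L2 Om (B z).
  move=> Omz; have := L2J mOm (A2_L2 oOm (bB z Omz).1).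
  by rewrite (_ : (fun w => ((B z w)^*)^*) = B z)//; apply/funext => w; rewrite conjCK.
have IBg z k : Om z -> Cintegrable Om (fun w => B z w * g k w).
  by move=> Omz; exact: (L2M_integrable mOm (LB z Omz) (Lg k)).
have IBv z : Om z -> Cintegrable Om (fun w => B z w * v w).
  by move=> Omz; exact: (L2M_integrable mOm (LB z Omz) Lv).
have IBh z : Om z -> Cintegrable Om (fun w => B z w * h w).
  by move=> Omz; exact: (L2M_integrable mOm (LB z Omz) Lh).
(* conj z_k is constant in [w], so the first sum is handled by the reproducing property for each
   [g k] and the rest is the projection of [v]. *)
have pairingE z w : B z w * pairing g z w =
    \sum_k ((z 0 k)^* * (B z w * g k w)) + - 1 * (B z w * v w).
  rewrite /pairing /v /conj_sum !mulr_sumr -big_split; apply: eq_bigr => k _.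
  have E (a b c d : C R) : a * (b * (c - d)) = c * (a * b) + - 1 * (a * (d * b)) by ring.
  by rewrite /conj_mul; exact: E.
have IS z k (Omz : Om z) := CintegrableZ mOm ((z 0 k)^*) (IBg z k Omz).
split=> [z Omz|].
  apply: eq_Cintegrable (fun w _ => esym (pairingE z w)) _ => //.
  have [I1 _] := Cintegral_sum mOm (index_enum 'I_n) (fun k => IS z k Omz).
  exact: (CintegrableD mOm I1 (CintegrableZ mOm (- 1) (IBv z Omz))).
(* The exceptional null set for [z] is the one where [h] and [H] differ; the integral is computed
   for every [z] in [Om]. *)
apply: filterS (hH) => z hz Omz.
rewrite (@eq_Cintegral _ _ Om _ _ (fun w _ => pairingE z w)).
have [I1 E1] := Cintegral_sum mOm (index_enum 'I_n) (fun k => IS z k Omz).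
rewrite (CintegralD mOm I1 (CintegrableZ mOm (- 1) (IBv z Omz))) E1.
rewrite (CintegralZ mOm _ (IBv z Omz)).
have -> : \sum_k Cintegral Om (fun w => (z 0 k)^* * (B z w * g k w)) = v z.
  apply: eq_bigr => k _; rewrite (CintegralZ mOm _ (IBg z k Omz)).
  by rewrite -((bB z Omz).2 _ (Ag k)).
(* Here [v + h = u], and orthogonality is tested on the conjugate of [B z], a member of [A2]. *)
have uE : Cintegral Om (fun w => B z w * v w) + Cintegral Om (fun w => B z w * h w) = 0.
  rewrite -(CintegralD mOm (IBv z Omz) (IBh z Omz)) -[RHS](uA _ (bB z Omz).1).
  apply: eq_Cintegral => w _ /=; rewrite conjCK -mulrDr mulrC; congr (_ * _).
  by rewrite /h addrC subrK.
(* The reproducing property applies to [H]; almost everywhere equality lets [h] replace it under the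
   integral. *)
have hE : Cintegral Om (fun w => B z w * h w) = H z.
  rewrite ((bB z Omz).2 _ AH); have /L2P[mB _] := LB z Omz; have /L2P[mh _] := Lh.
  apply: (eq_ae_Cintegral mOm).
  - exact: CmeasurableM.
  - by apply: CmeasurableM => //; exact: A2_measurable.
  - by apply: filterS hH => w E Omw; rewrite (E Omw).
have -> : Cintegral Om (fun w => B z w * v w) = - H z.
  by apply/eqP; rewrite -addr_eq0 -hE; apply/eqP.
by rewrite mulN1r opprK -(hz Omz) /h addrC subrK.
Qed.

End Solution.

Theorem proposition1 (R : realType) (n : nat) (Om : set 'rV[C R]_n)
  (B : 'rV[C R]_n -> 'rV[C R]_n -> C R)
  (S1 : ('I_n -> 'rV[C R]_n -> C R) -> 'rV[C R]_n -> C R) :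
  is_domain Om -> bounded_set Om ->
  bergman_kernel Om B ->
  canonical_solution_operator Om S1 ->
  forall g : 'I_n -> 'rV[C R]_n -> C R, A2_01 Om g ->
    (forall z, Om z -> Cintegrable Om (fun w => B z w * pairing g z w)) /\
    {ae @lebesgue_Cn R n, forall z, Om z ->
      S1 g z = Cintegral Om (fun w => B z w * pairing g z w)}.
Proof.
move=> [_ oOm _] bOm bB cS g Ag; have [Lu ug uA] := cS g Ag.
exact: bergman_solution.
Qed.
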